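(* Let $H$ and $K$ be Hilbert spaces, and let $T: H \to K$ be a bounded linear operator. Then the following are equivalent: (1) $\Lambda(T)$ is bounded. (2) $T$ can be written $T = A + X$ with $A, X: H \to K$ bounded linear operators, $\|A\| \le 1$, and $X$ trace class. (3) $\prod_{n=1}^\infty \max(1, s_n(T)) < \infty$. If these conditions hold, then $\|\Lambda(T)\| = \prod_{n=1}^\infty \max(1, s_n(T))$.
   Context: Hilbert spaces are complex. $\Lambda H = \bigoplus_{n=0}^\infty \Lambda^n H$ is the antisymmetric Fock space of $H$ (Hilbert space direct sum of the Hilbert space exterior powers, with $\Lambda^0 H = \mathbb{C}$). Given a bounded operator $T: H \to K$, $\Lambda(T): \Lambda H \to \Lambda K$ is the (in general only densely defined) linear map determined by $\Lambda(T)(v_1 \wedge \cdots \wedge v_n) = Tv_1 \wedge \cdots \wedge Tv_n$ for all $n \geq 0$ (acting as the identity $\mathbb{C}\to\mathbb{C}$ when $n=0$). The singular values (approximation numbers) of a bounded operator $T: H\to K$ are $s_n(T) = \inf\{\|T-F\| : F: H\to K \text{ bounded},\ \operatorname{rank}(F) < n\}$, $n\ge 1$; $T$ is not assumed compact. *)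

(* Defs.v *)
From HB Require Import structures.
From mathcomp Require Import all_boot all_order all_fingroup all_algebra.
From mathcomp Require Import complex.
From mathcomp Require Import mathcomp_extra boolp classical_sets functions.
From mathcomp Require Import reals ereal topology normedtype sequences esum.
From mathcomp Require Import ring lra.

Set Implicit Arguments.
Unset Strict Implicit.
Unset Printing Implicit Defensive.

Import Order.TTheory GRing.Theory Num.Theory.
Import numFieldNormedType.Exports.
Import Normc.

Local Open Scope classical_set_scope.
Local Open Scope ring_scope.

Section ComplexLimits.
Variable R : realType.
Implicit Types (a b : nat -> R[i]) (c l : R[i]).

Definition cvgC a l := forall e : R, 0 < e ->
  exists N, forall n, (N <= n)%N -> normc (a n - l) < e.

Lemma normc_ge0 c : 0 <= normc c.
Proof. by case: c => x y; rewrite sqrtr_ge0. Qed.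

Lemma normcD_le c l : normc (c + l) <= normc c + normc l.
Proof. exact: le_normcD. Qed.

Lemma normcNE c : normc (- c) = normc c.
Proof. exact: normcN. Qed.

Lemma normc_real (x : R) : normc (x%:C)%C = `|x|.
Proof. by rewrite /= expr0n addr0 sqrtr_sqr. Qed.

Lemma conjE c : c^* = (c^*)%C.
Proof. by []. Qed.

Lemma normc_conj c : normc c^* = normc c.
Proof. by rewrite conjE; case: c => x y /=; rewrite sqrrN. Qed.

Lemma Re_le_normc c : `|complex.Re c| <= normc c.
Proof. by case: c => x y /=; rewrite -sqrtr_sqr ler_wsqrtr// lerDl sqr_ge0. Qed.

Lemma Im_le_normc c : `|complex.Im c| <= normc c.
Proof. by case: c => x y /=; rewrite -sqrtr_sqr ler_wsqrtr// lerDr sqr_ge0. Qed.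

Lemma normc_le c : normc c <= `|complex.Re c| + `|complex.Im c|.
Proof.
case: c => x y /=; rewrite -[leRHS]ger0_norm ?addr_ge0// -sqrtr_sqr.
rewrite ler_wsqrtr// sqrrD !real_normK ?num_real//.
by rewrite -addrA lerD2l lerDr mulrn_wge0// mulr_ge0.
Qed.

Lemma normc_distC c l : normc (c - l) = normc (l - c).
Proof. by rewrite -opprB normcNE. Qed.

Lemma normc_small c : (forall e : R, 0 < e -> normc c < e) -> c = 0.
Proof.
move=> h; apply: eq0_normc; apply/eqP; rewrite eq_le normc_ge0 andbT.
by apply/ler_addgt0Pl => e /h /ltW; rewrite addr0.
Qed.

Lemma cvgC_uniq a l (m : R[i]) : cvgC a l -> cvgC a m -> l = m.
Proof.
move=> al am; apply/eqP; rewrite -subr_eq0; apply/eqP/normc_small => e e0.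
have e20 : 0 < e / 2 by rewrite divr_gt0.
have [N aN] := al _ e20; have [M aM] := am _ e20.
have /aN h1 : (N <= maxn N M)%N by rewrite leq_maxl.
have /aM h2 : (M <= maxn N M)%N by rewrite leq_maxr.
rewrite (_ : l - m = (l - a (maxn N M)) + (a (maxn N M) - m)); last by ring.
rewrite (le_lt_trans (normcD_le _ _))// [e]splitr ltrD// normc_distC.
exact: h1.
Qed.

Lemma cvgC_cst c : cvgC (fun=> c) c.
Proof. by move=> e e0; exists 0%N => n _; rewrite subrr normc0. Qed.

Lemma cvgCD a b l (m : R[i]) : cvgC a l -> cvgC b m ->
  cvgC (fun n => a n + b n) (l + m).
Proof.
move=> al bm e e0; have e20 : 0 < e / 2 by rewrite divr_gt0.
have [N aN] := al _ e20; have [M bM] := bm _ e20.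
exists (maxn N M) => n; rewrite geq_max => /andP[/aN h1 /bM h2].
rewrite opprD addrACA (le_lt_trans (normcD_le _ _))//.
by rewrite [e]splitr ltrD.
Qed.

Lemma cvgCZ c a l : cvgC a l -> cvgC (fun n => c * a n) (c * l).
Proof.
move=> al e e0; have d0 : 0 < normc c + 1 by rewrite ltr_wpDl ?normc_ge0.
have [N aN] := al (e / (normc c + 1)) (divr_gt0 e0 d0).
exists N => n /aN h; rewrite -mulrBr normcM.
rewrite ltr_pdivlMr// mulrC in h; apply: le_lt_trans h.
by rewrite ler_wpM2r ?normc_ge0// lerDl.
Qed.

Lemma cvgC_conj a l : cvgC a l -> cvgC (fun n => (a n)^*) l^*.
Proof.
move=> al e /al[N aN]; exists N => n /aN.
by rewrite -rmorphB normc_conj.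
Qed.

Lemma cvgC_sum (I : Type) (s : seq I) (F : nat -> I -> R[i]) (G : I -> R[i]) :
  (forall i, cvgC (F ^~ i) (G i)) ->
  cvgC (fun n => \sum_(i <- s) F n i) (\sum_(i <- s) G i).
Proof.
move=> FG; elim: s => [|i s IH].
  by rewrite big_nil; under eq_fun do rewrite big_nil; exact: cvgC_cst.
by rewrite big_cons; under eq_fun do rewrite big_cons; exact: cvgCD.
Qed.

Lemma cvgC_near a b l : cvgC a l ->
  (forall e : R, 0 < e -> exists N, forall n, (N <= n)%N ->
    normc (b n - a n) < e) -> cvgC b l.
Proof.
move=> al ab e e0; have e20 : 0 < e / 2 by rewrite divr_gt0.
have [N aN] := al _ e20; have [M abM] := ab _ e20.
exists (maxn N M) => n; rewrite geq_max => /andP[/aN h1 /abM h2].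
rewrite (_ : b n - l = (b n - a n) + (a n - l)); last by ring.
by rewrite (le_lt_trans (normcD_le _ _))// [e]splitr ltrD.
Qed.

Lemma cvgC_norm_le a l (M : R) :
  cvgC a l -> (forall n, normc (a n) <= M) -> normc l <= M.
Proof.
move=> al aM; apply/ler_addgt0Pl => e /al[N /(_ N (leqnn N)) h].
rewrite (_ : l = (l - a N) + a N); last by ring.
by rewrite (le_trans (normcD_le _ _))// lerD// normc_distC ltW.
Qed.

Lemma cvgC_Re_le a l (M : R) :
  cvgC a l -> (exists N, forall n, (N <= n)%N -> complex.Re (a n) <= M) ->
  complex.Re l <= M.
Proof.
move=> al [N0 aM]; apply/ler_addgt0Pl => e /al[N h].
have {}h := h _ (leq_maxl N N0); have {}aM := aM _ (leq_maxr N N0).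
rewrite (_ : l = (l - a (maxn N N0)) + a (maxn N N0)); last by ring.
rewrite raddfD lerD//; apply: le_trans (ler_norm _) _.
by rewrite (le_trans (Re_le_normc _))// normc_distC ltW.
Qed.

Lemma ge0CE c : (0 <= c) = (0 <= complex.Re c) && (complex.Im c == 0).
Proof. by rewrite lecE /= andbC. Qed.

Lemma cvgC_ge0 a l : cvgC a l -> (forall n, 0 <= a n) -> 0 <= l.
Proof.
move=> al a0; rewrite ge0CE; apply/andP; split.
  rewrite -oppr_le0 -raddfN; apply: (@cvgC_Re_le (fun n => - a n)).
    by have := cvgCZ (-1) al; rewrite mulN1r; under eq_fun do rewrite mulN1r.
  exists 0%N => n _.
  by have := a0 n; rewrite ge0CE raddfN oppr_le0 => /andP[].
rewrite -normr_eq0 eq_le normr_ge0 andbT; apply/ler_addgt0Pl => e /al[N aN].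
have := a0 N; rewrite ge0CE => /andP[_ /eqP I0].
have := aN _ (leqnn N); rewrite addr0 => /ltW; apply: le_trans.
apply: le_trans (Im_le_normc _).
by rewrite raddfB/= I0 sub0r normrN.
Qed.

Lemma real_cauchy (u : nat -> R) :
  (forall e : R, 0 < e -> exists N, forall m n, (N <= m)%N -> (N <= n)%N ->
    `|u m - u n| < e) ->
  exists l : R, forall e : R, 0 < e -> exists N, forall n, (N <= n)%N ->
    `|u n - l| < e.
Proof.
move=> cu; have /cvg_ex[/= l ul] : cvgn u.
  apply/cauchy_cvgP/cauchy_exP => e /cu[N uN].
  exists (u N); exists N => //= n Nn.
  by rewrite /ball /= uN.
exists l => e e0; move/cvgrPdist_lt : ul => /(_ _ e0)[N _ uN].
by exists N => n /uN /=; rewrite distrC.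
Qed.

Lemma cauchyC_cvg a :
  (forall e : R, 0 < e -> exists N, forall m n, (N <= m)%N -> (N <= n)%N ->
    normc (a m - a n) < e) ->
  exists l, cvgC a l.
Proof.
move=> ca.
have [x ax] : exists l : R, forall e : R, 0 < e -> exists N, forall n, (N <= n)%N ->
    `|complex.Re (a n) - l| < e.
  apply: real_cauchy => e /ca[N aN]; exists N => m n Nm Nn.
  by rewrite -raddfB (le_lt_trans (Re_le_normc _))// aN.
have [y ay] : exists l : R, forall e : R, 0 < e -> exists N, forall n, (N <= n)%N ->
    `|complex.Im (a n) - l| < e.
  apply: real_cauchy => e /ca[N aN]; exists N => m n Nm Nn.
  by rewrite -raddfB (le_lt_trans (Im_le_normc _))// aN.
exists (x +i* y)%C => e e0; have e20 : 0 < e / 2 by rewrite divr_gt0.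
have [N aN] := ax _ e20; have [M aM] := ay _ e20.
exists (maxn N M) => n; rewrite geq_max => /andP[/aN h1 /aM h2].
by rewrite (le_lt_trans (normc_le _))// [e]splitr !raddfB/= ltrD.
Qed.

Definition limC a : R[i] := xget 0 [set l | cvgC a l]%classic.

Lemma limCP a : (exists l, cvgC a l) -> cvgC a (limC a).
Proof. by move=> [l al]; rewrite /limC; case: xgetP => // /(_ l). Qed.

Lemma limCE a l : cvgC a l -> limC a = l.
Proof. by move=> al; apply: (@cvgC_uniq a) => //; apply: limCP; exists l. Qed.

End ComplexLimits.

Section CauchySchwarz.
Variables (R : realType) (V : lmodType R[i]).
Variable f : {hermitian V for false & Num.conj}.
Hypothesis f_ge0 : forall x, 0 <= f x x.

Lemma herm_conj x y : f y x = (f x y)^*.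
Proof. by rewrite hermC expr0 mul1r. Qed.

Lemma hermCS x y :
  normc (f x y) ^+ 2 <= complex.Re (f x x) * complex.Re (f y y).
Proof.
have h (t : R) : 0 <= complex.Re (f x x) - 2 * t * normc (f x y) ^+ 2
     + t ^+ 2 * normc (f x y) ^+ 2 * complex.Re (f y y).
  have := f_ge0 (x - (t%:C)%C * f x y *: y).
  rewrite linearBl !linearBr linearZl_LR !linearZr_LR/= linearZl_LR.
  rewrite [f y x]herm_conj !rmorphM/=.
  have := f_ge0 y; have := f_ge0 x; rewrite !ge0CE !conjE.
  case: (f x x) => a ? /andP[/= _ /eqP->].
  case: (f y y) => b ? /andP[/= _ /eqP->].
  case: (f x y) => p q /andP[/= h _].
  rewrite (sqr_sqrtr (addr_ge0 (sqr_ge0 p) (sqr_ge0 q))).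
  by apply: le_trans h _; rewrite le_eqVlt; apply/orP; left; apply/eqP; ring.
have fx : 0 <= complex.Re (f x x) by have := f_ge0 x; rewrite ge0CE => /andP[].
have fy : 0 <= complex.Re (f y y) by have := f_ge0 y; rewrite ge0CE => /andP[].
have s0 : 0 <= normc (f x y) ^+ 2 by rewrite sqr_ge0.
move: (complex.Re (f x x)) (complex.Re (f y y)) (normc (f x y) ^+ 2) h fx fy s0.
move=> a b s h a0; rewrite le_eqVlt => /orP[/eqP b0|b0] s0.
  rewrite -b0 mulr0; rewrite leNgt; apply/negP => s1.
  have := h ((a + 1) / (2 * s)); rewrite -b0.
  have -> : a - 2 * ((a + 1) / (2 * s)) * s +
     ((a + 1) / (2 * s)) ^+ 2 * s * 0 = -1 by field; rewrite gt_eqF.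
  by rewrite oppr_ge0 ler10.
have := h b^-1.
have -> : a - 2 * b^-1 * s + b^-1 ^+ 2 * s * b = a - s / b.
  by field; rewrite gt_eqF.
by rewrite subr_ge0 ler_pdivrMr.
Qed.

End CauchySchwarz.

Section DotNorm.
Variables (R : realType) (V : lmodType R[i]) (f : {dot V for Num.conj}).

Definition dotnorm (x : V) : R := Num.sqrt (complex.Re (f x x)).

Definition dot_cauchy (u : nat -> V) := forall e : R, 0 < e ->
  exists N, forall m n, (N <= m)%N -> (N <= n)%N -> dotnorm (u m - u n) < e.

Definition dot_cvg (u : nat -> V) (l : V) := forall e : R, 0 < e ->
  exists N, forall n, (N <= n)%N -> dotnorm (u n - l) < e.

Lemma dot_conj x y : f y x = (f x y)^*.
Proof. exact: herm_conj. Qed.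

Lemma dot_ge0 x : 0 <= f x x.
Proof. exact: dnorm_ge0. Qed.

Lemma Re_dot_ge0 x : 0 <= complex.Re (f x x).
Proof. by have := dot_ge0 x; rewrite ge0CE => /andP[]. Qed.

Lemma dotnorm_ge0 x : 0 <= dotnorm x.
Proof. exact: sqrtr_ge0. Qed.

Lemma dotnormK x : dotnorm x ^+ 2 = complex.Re (f x x).
Proof. by rewrite sqr_sqrtr ?Re_dot_ge0. Qed.

Lemma dotnormKC x : (dotnorm x ^+ 2)%:C%C = f x x.
Proof.
by rewrite dotnormK RRe_real// realE dot_ge0.
Qed.

Lemma dotCS x y : normc (f x y) <= dotnorm x * dotnorm y.
Proof.
rewrite -(@ler_pXn2r _ 2) ?nnegrE ?mulr_ge0 ?normc_ge0 ?dotnorm_ge0//.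
by rewrite exprMn !dotnormK; exact: hermCS dot_ge0 x y.
Qed.

Lemma dotnorm0 : dotnorm 0 = 0.
Proof. by rewrite /dotnorm linear0l raddf0 sqrtr0. Qed.

Lemma dotnorm_eq0 x : dotnorm x = 0 -> x = 0.
Proof.
move=> x0; apply/eqP; rewrite -(dnorm_eq0 f); apply/eqP.
by rewrite -dotnormKC x0 expr0n.
Qed.

Lemma dotnormZ c x : dotnorm (c *: x) = normc c * dotnorm x.
Proof.
apply/eqP; rewrite -(@eqrXn2 _ 2) ?mulr_ge0 ?normc_ge0 ?dotnorm_ge0//.
rewrite exprMn (dotnormK (c *: x)) linearZl_LR linearZr_LR/= -dotnormKC conjE.
case: c => a b /=; rewrite (sqr_sqrtr (addr_ge0 (sqr_ge0 a) (sqr_ge0 b))).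
by apply/eqP; ring.
Qed.

Lemma dotnormN x : dotnorm (- x) = dotnorm x.
Proof. by rewrite /dotnorm linearNl linearNr opprK. Qed.

Lemma dotnormBC x y : dotnorm (x - y) = dotnorm (y - x).
Proof. by rewrite -opprB dotnormN. Qed.

Lemma dotnormD x y : dotnorm (x + y) <= dotnorm x + dotnorm y.
Proof.
rewrite -(@ler_pXn2r _ 2) ?nnegrE ?addr_ge0 ?dotnorm_ge0//.
rewrite sqrrD !dotnormK linearDl !linearDr !raddfD/=.
have -> : complex.Re (f y x) = complex.Re (f x y).
  by rewrite dot_conj conjE; case: (f x y).
have := dotCS x y; have := le_trans (ler_norm _) (Re_le_normc (f x y)).
by move=> h1 /(le_trans h1); rewrite -mulr_natl; lra.
Qed.

Lemma dotnorm_triangle y x z :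
  dotnorm (x - z) <= dotnorm (x - y) + dotnorm (y - z).
Proof. by rewrite (le_trans _ (dotnormD _ _))// addrA subrK. Qed.

Lemma dotnorm_triangle4 x y x' y' :
  dotnorm (x' - y') <= dotnorm (x - x') + dotnorm (x - y) + dotnorm (y - y').
Proof.
have := dotnorm_triangle x x' y'; have := dotnorm_triangle y x y'.
by rewrite (dotnormBC x' x); lra.
Qed.

Lemma dotnorm_small x : (forall e, 0 < e -> dotnorm x < e) -> x = 0.
Proof.
move=> h; apply: dotnorm_eq0; apply/eqP; rewrite eq_le dotnorm_ge0 andbT.
by apply/ler_addgt0Pl => e /h /ltW; rewrite addr0.
Qed.

Lemma dot_cauchyW u : (forall e : R, 0 < e -> exists N, forall n, (N <= n)%N ->
  dotnorm (u n - u N) < e) -> dot_cauchy u.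
Proof.
move=> cu e e0; have [N uN] := cu _ (divr_gt0 e0 (ltr0Sn R 1)).
exists N => m n /uN um /uN un; rewrite (le_lt_trans (dotnorm_triangle (u N) _ _))//.
by rewrite [e]splitr ltrD// dotnormBC.
Qed.

Lemma dot_cauchy_bounded u : dot_cauchy u ->
  exists2 M : R, 0 < M & forall n, dotnorm (u n) <= M.
Proof.
move=> /(_ 1 ltr01)[N uN].
have B0 : 0 <= \sum_(n < N) dotnorm (u n).
  by apply: sumr_ge0 => i _; exact: dotnorm_ge0.
exists (\sum_(n < N) dotnorm (u n) + dotnorm (u N) + 1).
  by rewrite ltr_wpDl// addr_ge0 ?dotnorm_ge0.
move=> n; have [nN|Nn] := ltnP n N.
  rewrite (bigD1 (Ordinal nN))//= -!addrA lerDl !addr_ge0 ?dotnorm_ge0//.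
  by apply: sumr_ge0 => i _; exact: dotnorm_ge0.
have := uN _ _ Nn (leqnn N); have := dotnormD (u n - u N) (u N).
by rewrite subrK; lra.
Qed.

End DotNorm.

HB.mixin Record isHilbert (R : realType) H of GRing.Lmodule R[i] H := {
  hdot : {dot H for Num.conj};
  hdot_complete : forall u : nat -> H,
    dot_cauchy hdot u -> exists l, dot_cvg hdot u l
}.

#[short(type="hilbertType")]
HB.structure Definition Hilbert (R : realType) :=
  {H of isHilbert R H & GRing.Lmodule R[i] H}.

Section CompletionPred.
Variables (R : realType) (V : lmodType R[i]) (f : {dot V for Num.conj}).
Implicit Types (phi psi : V -> R[i]) (u v : nat -> V).

Definition cpl_seq phi u :=
  dot_cauchy f u /\ forall w, cvgC (fun n => f (u n) w) (phi w).

Definition cpl_pred : {pred V -> R[i]} :=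
  [pred phi : V -> R[i] | `[< exists u, cpl_seq phi u >]].

Lemma dot_cauchyD u v : dot_cauchy f u -> dot_cauchy f v ->
  dot_cauchy f (fun n => u n + v n).
Proof.
move=> cu cv e e0; have e20 : 0 < e / 2 by rewrite divr_gt0.
have [N uN] := cu _ e20; have [M vM] := cv _ e20.
exists (maxn N M) => m n; rewrite !geq_max => /andP[m1 m2] /andP[n1 n2].
rewrite opprD addrACA (le_lt_trans (dotnormD _ _ _))//.
by rewrite [e]splitr ltrD ?uN ?vM.
Qed.

Lemma dot_cauchyZ c u : dot_cauchy f u -> dot_cauchy f (fun n => c *: u n).
Proof.
move=> cu e e0; have d0 : 0 < normc c + 1 by rewrite ltr_wpDl ?normc_ge0.
have [N uN] := cu _ (divr_gt0 e0 d0); exists N => m n Nm Nn.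
rewrite -scalerBr dotnormZ; have := uN _ _ Nm Nn.
rewrite ltr_pdivlMr// mulrC; apply: le_lt_trans.
by rewrite ler_wpM2r ?dotnorm_ge0// lerDl.
Qed.

Lemma cpl_seqD phi psi u v : cpl_seq phi u -> cpl_seq psi v ->
  cpl_seq (phi + psi) (fun n => u n + v n).
Proof.
move=> [cu hu] [cv hv]; split; first exact: dot_cauchyD.
by move=> w; under eq_fun do rewrite linearDl; exact: (cvgCD (hu w) (hv w)).
Qed.

Lemma cpl_seqZ c phi u : cpl_seq phi u ->
  cpl_seq (c *: phi) (fun n => c *: u n).
Proof.
move=> [cu hu]; split; first exact: dot_cauchyZ.
by move=> w; under eq_fun do rewrite linearZl_LR; exact: (cvgCZ c (hu w)).
Qed.

Lemma cpl_seqB phi psi u v : cpl_seq phi u -> cpl_seq psi v ->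
  cpl_seq (phi - psi) (fun n => u n - v n).
Proof.
move=> hu hv; rewrite -scaleN1r.
under eq_fun do rewrite -scaleN1r.
by apply: cpl_seqD => //; exact: cpl_seqZ.
Qed.

Lemma cpl_seq_cst w : cpl_seq (f w) (fun=> w).
Proof.
split; last by move=> x; exact: cvgC_cst.
by move=> e e0; exists 0%N => m n _ _; rewrite subrr dotnorm0.
Qed.

Lemma cpl_pred_submod : submod_closed cpl_pred.
Proof.
split; first by apply/asboolP; exists (fun=> 0); split;
  [by move=> e e0; exists 0%N => m n _ _; rewrite subrr dotnorm0|
   by move=> w; rewrite linear0l; exact: cvgC_cst].
move=> c phi psi /asboolP[u hu] /asboolP[v hv]; apply/asboolP.
by exists (fun n => c *: u n + v n); apply: cpl_seqD => //; exact: cpl_seqZ.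
Qed.

HB.instance Definition _ := GRing.isSubmodClosed.Build _ _ cpl_pred
  cpl_pred_submod.

Lemma dot_cauchy_mul u v : dot_cauchy f u -> dot_cauchy f v ->
  exists l, cvgC (fun n => f (u n) (v n)) l.
Proof.
move=> cu cv; apply: cauchyC_cvg => e e0.
have [M M0 uM] := dot_cauchy_bounded cu; have [K K0 vK] := dot_cauchy_bounded cv.
have e20 : 0 < e / 2 by rewrite divr_gt0.
have [N uN] := cu _ (divr_gt0 e20 K0); have [L vL] := cv _ (divr_gt0 e20 M0).
exists (maxn N L) => m n; rewrite !geq_max => /andP[m1 m2] /andP[n1 n2].
have -> : f (u m) (v m) - f (u n) (v n) =
    f (u m - u n) (v m) + f (u n) (v m - v n).
  by rewrite linearBl linearBr; ring.
rewrite (le_lt_trans (normcD_le _ _))// [e]splitr ltrD//.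
  have := uN _ _ m1 n1; rewrite ltr_pdivlMr//.
  apply: le_lt_trans; apply: le_trans (dotCS _ _ _) _.
  by rewrite ler_wpM2l ?dotnorm_ge0.
have := vL _ _ m2 n2; rewrite ltr_pdivlMr// mulrC.
apply: le_lt_trans; apply: le_trans (dotCS _ _ _) _.
by rewrite ler_wpM2r ?dotnorm_ge0.
Qed.

Lemma cpl_seq0 u : cpl_seq 0 u ->
  forall e : R, 0 < e -> exists N, forall n, (N <= n)%N -> dotnorm f (u n) < e.
Proof.
move=> [cu hu] e e0; have [M M0 uM] := dot_cauchy_bounded cu.
have e20 : 0 < e ^+ 2 / 2 by rewrite divr_gt0 ?exprn_gt0.
have [N uN] := cu _ (divr_gt0 e20 M0); have [L hL] := hu (u N) _ e20.
exists (maxn N L) => n; rewrite !geq_max => /andP[n1 n2].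
rewrite -(@ltr_pXn2r _ 2) ?nnegrE ?dotnorm_ge0 ?(ltW e0)// dotnormK.
rewrite (le_lt_trans (ler_norm _))// (le_lt_trans (Re_le_normc _))//.
have -> : f (u n) (u n) = f (u n) (u n - u N) + f (u n) (u N).
  by rewrite linearBr subrK.
rewrite (le_lt_trans (normcD_le _ _))// [e ^+ 2]splitr ltrD//; last first.
  by have := hL _ n2; rewrite subr0.
have := uN _ _ n1 (leqnn N); rewrite ltr_pdivlMr// mulrC.
apply: le_lt_trans; apply: le_trans (dotCS _ _ _) _.
by rewrite ler_wpM2r ?dotnorm_ge0.
Qed.

End CompletionPred.

(* The completion of an inner product space [V], realized as a space of
   antilinear functionals: its elements are the pointwise limits of the
   functionals [f (u n)] with [u] a Cauchy sequence in [V]. *)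
Record completion (R : realType) (V : lmodType R[i])
    (f : {dot V for Num.conj}) := Completion {
  cpl_fun :> V -> R[i] ;
  cpl_funP : cpl_fun \in cpl_pred f }.

Section Completion.
Variables (R : realType) (V : lmodType R[i]) (f : {dot V for Num.conj}).
Local Notation E := (completion f).

HB.instance Definition _ := [isSub of E for @cpl_fun _ _ f].
HB.instance Definition _ := [Choice of E by <:].
HB.instance Definition _ := [SubChoice_isSubLmodule of E by <:].

Lemma cplD (x y : E) : cpl_fun (x + y) = cpl_fun x + cpl_fun y.
Proof. by []. Qed.

Lemma cplZ c (x : E) : cpl_fun (c *: x) = c *: cpl_fun x.
Proof. by []. Qed.

Lemma cplB (x y : E) : cpl_fun (x - y) = cpl_fun x - cpl_fun y.
Proof. by []. Qed.

Lemma cpl_repP (x : E) : exists u, cpl_seq f (cpl_fun x) u.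
Proof. by apply/asboolP; have := cpl_funP x. Qed.

Definition cpl_rep (x : E) : nat -> V := projT1 (cid (cpl_repP x)).

Lemma cpl_rep_seq (x : E) : cpl_seq f x (cpl_rep x).
Proof. by rewrite /cpl_rep; case: cid. Qed.

Definition cpl_dot (x y : E) : R[i] :=
  limC (fun n => f (cpl_rep x n) (cpl_rep y n)).

Lemma cpl_dotP (x y : E) u v : cpl_seq f x u -> cpl_seq f y v ->
  cvgC (fun n => f (u n) (v n)) (cpl_dot x y).
Proof.
move=> xu yv; have xr := cpl_rep_seq x; have yr := cpl_rep_seq y.
have := limCP (dot_cauchy_mul xr.1 yr.1); rewrite -/(cpl_dot x y).
move=> /cvgC_near; apply => e e0.
have [M M0 vM] := dot_cauchy_bounded yv.1.
have [K K0 rK] := dot_cauchy_bounded xr.1.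
have e20 : 0 < e / 2 by rewrite divr_gt0.
have /cpl_seq0 : cpl_seq f 0 (fun n => u n - cpl_rep x n).
  by rewrite -(subrr (cpl_fun x)); exact: cpl_seqB.
move=> /(_ _ (divr_gt0 e20 M0))[N hN].
have /cpl_seq0 : cpl_seq f 0 (fun n => v n - cpl_rep y n).
  by rewrite -(subrr (cpl_fun y)); exact: cpl_seqB.
move=> /(_ _ (divr_gt0 e20 K0))[L hL].
exists (maxn N L) => n; rewrite !geq_max => /andP[n1 n2].
have -> : f (u n) (v n) - f (cpl_rep x n) (cpl_rep y n) =
    f (u n - cpl_rep x n) (v n) + f (cpl_rep x n) (v n - cpl_rep y n).
  by rewrite linearBl linearBr; ring.
rewrite (le_lt_trans (normcD_le _ _))// [e]splitr ltrD//.
  have := hN _ n1; rewrite ltr_pdivlMr//.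
  apply: le_lt_trans; apply: le_trans (dotCS _ _ _) _.
  by rewrite ler_wpM2l ?dotnorm_ge0.
have := hL _ n2; rewrite ltr_pdivlMr// mulrC.
apply: le_lt_trans; apply: le_trans (dotCS _ _ _) _.
by rewrite ler_wpM2r ?dotnorm_ge0.
Qed.

Lemma cpl_dotE (x y : E) u v l : cpl_seq f x u -> cpl_seq f y v ->
  cvgC (fun n => f (u n) (v n)) l -> cpl_dot x y = l.
Proof. by move=> xu yv; apply: cvgC_uniq; exact: cpl_dotP. Qed.

Lemma cpl_dot_herm x y : cpl_dot x y = (-1) ^+ false * (cpl_dot y x)^*.
Proof.
rewrite expr0 mul1r.
apply: (cpl_dotE (cpl_rep_seq x) (cpl_rep_seq y)).
have := cvgC_conj (cpl_dotP (cpl_rep_seq y) (cpl_rep_seq x)).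
by under eq_fun do rewrite -dot_conj.
Qed.

Lemma cpl_dotPl z : GRing.linear_for *%R (cpl_dot ^~ z).
Proof.
move=> c x y.
apply: (@cpl_dotE _ _ (fun n => c *: cpl_rep x n + cpl_rep y n) (cpl_rep z)).
- rewrite cplD cplZ; apply: cpl_seqD; last exact: cpl_rep_seq.
  by apply: cpl_seqZ; exact: cpl_rep_seq.
- exact: cpl_rep_seq.
under eq_fun do rewrite linearDl linearZl_LR.
by apply: cvgCD; [apply: cvgCZ|]; apply: cpl_dotP; exact: cpl_rep_seq.
Qed.

Lemma cpl_dotPr z : GRing.linear_for (Num.conj \; *%R) (cpl_dot z).
Proof.
move=> c x y; rewrite [LHS]cpl_dot_herm cpl_dotPl expr0 mul1r.
by rewrite rmorphD rmorphM/= [cpl_dot z x]cpl_dot_herm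
  [cpl_dot z y]cpl_dot_herm expr0 !mul1r.
Qed.

HB.instance Definition _ := bilinear_isBilinear.Build _ _ _ _ _ _ cpl_dot
  (cpl_dotPl, cpl_dotPr).
HB.instance Definition _ := isHermitianSesquilinear.Build _ _ _ _ cpl_dot
  cpl_dot_herm.

Lemma cpl_dot_ge0 x : 0 <= cpl_dot x x.
Proof.
apply: cvgC_ge0 (cpl_dotP (cpl_rep_seq x) (cpl_rep_seq x)) _ => n.
exact: dot_ge0.
Qed.

Lemma cpl_pure_key w : f w \in cpl_pred f.
Proof. by apply/asboolP; exists (fun=> w); exact: cpl_seq_cst. Qed.

Definition cpl_pure w : E := Completion (cpl_pure_key w).

Lemma cpl_pureE x w : cpl_dot x (cpl_pure w) = cpl_fun x w.
Proof.
apply: (@cpl_dotE x (cpl_pure w) (cpl_rep x) (fun=> w)).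
- exact: cpl_rep_seq.
- exact: cpl_seq_cst.
exact: (cpl_rep_seq x).2.
Qed.

Lemma cpl_dot_gt0 x : x != 0 -> 0 < cpl_dot x x.
Proof.
move=> x0; rewrite lt_def cpl_dot_ge0 andbT; apply: contra x0 => /eqP x0.
apply/eqP/val_inj/funext => w /=.
have : normc (cpl_dot x (cpl_pure w)) ^+ 2 <=
    complex.Re (cpl_dot x x) * complex.Re (cpl_dot (cpl_pure w) (cpl_pure w)).
  exact: (hermCS (f := cpl_dot)) cpl_dot_ge0 _ _.
rewrite x0 mul0r cpl_pureE => h; apply: eq0_normc.
by apply/eqP; rewrite -sqrf_eq0 eq_le h sqr_ge0.
Qed.

HB.instance Definition _ := isDotProduct.Build _ _ cpl_dot cpl_dot_gt0.

Lemma cpl_pure_linear : linear cpl_pure.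
Proof.
move=> c x y; apply/val_inj/funext => w /=.
by rewrite linearDl linearZl_LR.
Qed.

HB.instance Definition _ := GRing.isLinear.Build _ _ _ _ cpl_pure
  cpl_pure_linear.

Lemma cpl_dot_pure v w : cpl_dot (cpl_pure v) (cpl_pure w) = f v w.
Proof. by rewrite cpl_pureE. Qed.

Lemma cpl_seq_lim (x : E) u : cpl_seq f x u ->
  dot_cvg cpl_dot (fun n => cpl_pure (u n)) x.
Proof.
move=> xu e e0; have [N uN] := xu.1 _ (divr_gt0 e0 (ltr0Sn R 1)).
exists N => n Nn; rewrite dotnormBC; apply: (@le_lt_trans _ _ (e / 2)).
  rewrite -(@ler_pXn2r _ 2) ?nnegrE ?dotnorm_ge0 ?divr_ge0 ?(ltW e0)// dotnormK.
  have xun : cpl_seq f (x - cpl_pure (u n)) (fun m => u m - u n).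
    by rewrite cplB; apply: cpl_seqB => //; exact: cpl_seq_cst.
  apply: cvgC_Re_le (cpl_dotP xun xun) _.
  exists N => m Nm; rewrite -dotnormK ler_pXn2r ?nnegrE ?dotnorm_ge0//.
    by rewrite ltW// uN.
  by rewrite divr_ge0// ltW.
by rewrite ltr_pdivrMr// mulr_natr mulr2n ltrDl.
Qed.

Lemma cpl_dense x (e : R) : 0 < e ->
  exists w, dotnorm cpl_dot (x - cpl_pure w) < e.
Proof.
move=> /(cpl_seq_lim (cpl_rep_seq x))[N /(_ _ (leqnn N))].
by rewrite dotnormBC => h; exists (cpl_rep x N).
Qed.

Lemma small_inv (e : R) : 0 < e ->
  exists N, forall n, (N <= n)%N -> n.+1%:R^-1 < e.
Proof.
move=> e0; have [N _ hN] := near_infty_natSinv_lt (PosNum e0).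
by exists N => n /hN.
Qed.

Lemma cpl_complete (x : nat -> E) : dot_cauchy cpl_dot x ->
  exists l, dot_cvg cpl_dot x l.
Proof.
move=> cx.
have /choice[w xw] n : exists w, dotnorm cpl_dot (x n - cpl_pure w) < n.+1%:R^-1.
  by apply: cpl_dense; rewrite invr_gt0.
have pn v : dotnorm f v = dotnorm cpl_dot (cpl_pure v).
  by rewrite /dotnorm -cpl_dot_pure.
have cw : dot_cauchy f w.
  move=> e e0; have e30 : 0 < e / 3 by rewrite divr_gt0.
  have [N xN] := cx _ e30; have [M hM] := small_inv e30.
  exists (maxn N M) => m n; rewrite !geq_max => /andP[m1 m2] /andP[n1 n2].
  rewrite pn linearB; apply: le_lt_trans (dotnorm_triangle4 _ (x m) (x n) _ _) _.
  rewrite (_ : e = e / 3 + e / 3 + e / 3); last by field.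
  apply: ltrD; first apply: ltrD.
  - exact: lt_trans (xw m) (hM _ m2).
  - exact: xN.
  - exact: lt_trans (xw n) (hM _ n2).
have /choice[phi wphi] v : exists l, cvgC (fun n => f (w n) v) l.
  by apply: dot_cauchy_mul => //; exact: (cpl_seq_cst f v).1.
have phiP : phi \in cpl_pred f by apply/asboolP; exists w.
exists (Completion phiP) => e e0; have e20 : 0 < e / 2 by rewrite divr_gt0.
have [N hN] := @cpl_seq_lim (Completion phiP) w (conj cw wphi) _ e20.
have [M hM] := small_inv e20.
exists (maxn N M) => n; rewrite !geq_max => /andP[/hN h1 /hM h2].
apply: le_lt_trans (dotnorm_triangle _ (cpl_pure (w n)) _ _) _.
rewrite [e]splitr ltrD//; exact: lt_trans (xw n) h2.
Qed.

HB.instance Definition _ := isHilbert.Build R E cpl_complete.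

End Completion.

Record psd_kernel (R : realType) (X : Type) := PsdKernel {
  kernel_fun :> X -> X -> R[i] ;
  kernel_herm : forall x y, kernel_fun y x = (kernel_fun x y)^* ;
  kernel_psd : forall s : seq (R[i] * X),
    0 <= \sum_(p <- s) \sum_(q <- s) p.1 * q.1^* * kernel_fun p.2 q.2 }.

Section KernelSpanPred.
Variables (R : realType) (X : Type) (k : psd_kernel R X).

Definition kernel_sum (s : seq (R[i] * X)) : X -> R[i] :=
  \sum_(p <- s) p.1 *: (k p.2 : X -> R[i]).

Lemma kernel_sumE s x : kernel_sum s x = \sum_(p <- s) p.1 * k p.2 x.
Proof. by rewrite /kernel_sum fct_sumE. Qed.

Definition kspan_pred : {pred X -> R[i]} :=
  [pred g : X -> R[i] | `[< exists s, g = kernel_sum s >]].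

Lemma kspan_pred_submod : submod_closed kspan_pred.
Proof.
split; first by apply/asboolP; exists [::]; rewrite /kernel_sum big_nil.
move=> c _ _ /asboolP[s ->] /asboolP[t ->]; apply/asboolP.
exists ([seq (c * p.1, p.2) | p <- s] ++ t).
rewrite /kernel_sum big_cat/= big_map scaler_sumr/=; congr (_ + _).
by apply: eq_bigr => p _; rewrite scalerA.
Qed.

HB.instance Definition _ := GRing.isSubmodClosed.Build _ _ kspan_pred
  kspan_pred_submod.

End KernelSpanPred.

(* The inner product space spanned by symbols [x : X] subject to
   [<x, y> = k x y]; the symbol [x] is realized as the function [k x]. *)
Record kspan (R : realType) (X : Type) (k : psd_kernel R X) := KSpan {
  kspan_fun :> X -> R[i] ;
  kspan_funP : kspan_fun \in kspan_pred k }.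

Section KernelSpan.
Variables (R : realType) (X : Type) (k : psd_kernel R X).
Local Notation E := (kspan k).

HB.instance Definition _ := [isSub of E for @kspan_fun _ _ k].
HB.instance Definition _ := [Choice of E by <:].
HB.instance Definition _ := [SubChoice_isSubLmodule of E by <:].

Lemma kspanD (g h : E) : kspan_fun (g + h) = kspan_fun g + kspan_fun h.
Proof. by []. Qed.

Lemma kspanZ c (g : E) : kspan_fun (c *: g) = c *: kspan_fun g.
Proof. by []. Qed.

Lemma kspan_repP (g : E) : exists s, kspan_fun g = kernel_sum k s.
Proof. by apply/asboolP; have := kspan_funP g. Qed.

Definition kspan_rep (g : E) : seq (R[i] * X) := projT1 (cid (kspan_repP g)).

Lemma kspan_repE (g : E) : kspan_fun g = kernel_sum k (kspan_rep g).
Proof. by rewrite /kspan_rep; case: cid. Qed.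

Definition kspan_dot (g h : E) : R[i] :=
  \sum_(q <- kspan_rep h) (q.1)^* * kspan_fun g q.2.

Lemma kspan_dot_conj (g h : E) :
  kspan_dot g h = \sum_(p <- kspan_rep g) p.1 * (kspan_fun h p.2)^*.
Proof.
rewrite /kspan_dot (kspan_repE g) (kspan_repE h).
under eq_bigr do rewrite kernel_sumE mulr_sumr.
rewrite exchange_big/=; apply: eq_bigr => p _.
rewrite kernel_sumE rmorph_sum mulr_sumr/=; apply: eq_bigr => q _.
by rewrite rmorphM/= -kernel_herm; ring.
Qed.

Lemma kspan_dotPl z : GRing.linear_for *%R (kspan_dot ^~ z).
Proof.
move=> c g h; rewrite /kspan_dot mulr_sumr -big_split/=.
by apply: eq_bigr => q _; rewrite mulrDr mulrCA.
Qed.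

Lemma kspan_dot_herm g h : kspan_dot g h = (-1) ^+ false * (kspan_dot h g)^*.
Proof.
rewrite expr0 mul1r kspan_dot_conj rmorph_sum/=; apply: eq_bigr => q _.
by rewrite rmorphM/= conjCK.
Qed.

Lemma kspan_dotPr z : GRing.linear_for (Num.conj \; *%R) (kspan_dot z).
Proof.
move=> c g h; rewrite [LHS]kspan_dot_herm kspan_dotPl expr0 mul1r.
by rewrite rmorphD rmorphM/= [kspan_dot z g]kspan_dot_herm
  [kspan_dot z h]kspan_dot_herm expr0 !mul1r.
Qed.

HB.instance Definition _ := bilinear_isBilinear.Build _ _ _ _ _ _ kspan_dot
  (kspan_dotPl, kspan_dotPr).
HB.instance Definition _ := isHermitianSesquilinear.Build _ _ _ _ kspan_dot
  kspan_dot_herm.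

Lemma kspan_dot_ge0 g : 0 <= kspan_dot g g.
Proof.
suff -> : kspan_dot g g = \sum_(p <- kspan_rep g) \sum_(q <- kspan_rep g)
    p.1 * q.1^* * k p.2 q.2 by exact: kernel_psd.
rewrite kspan_dot_conj; apply: eq_bigr => p _.
rewrite [in LHS](kspan_repE g) kernel_sumE rmorph_sum mulr_sumr.
by apply: eq_bigr => q _; rewrite rmorphM/= -kernel_herm mulrA.
Qed.

Lemma kernel_sum_kspan s : kernel_sum k s \in kspan_pred k.
Proof. by apply/asboolP; exists s. Qed.

Lemma kspan_pure_key x : (k x : X -> R[i]) \in kspan_pred k.
Proof.
by apply/asboolP; exists [:: (1, x)]; rewrite /kernel_sum big_seq1 scale1r.
Qed.

Definition kspan_pure x : E := KSpan (kspan_pure_key x).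

Lemma kspan_pureE g x : kspan_dot g (kspan_pure x) = kspan_fun g x.
Proof.
rewrite kspan_dot_conj (kspan_repE g) kernel_sumE; apply: eq_bigr => p _.
by rewrite -kernel_herm.
Qed.

Lemma kspan_dot_gt0 g : g != 0 -> 0 < kspan_dot g g.
Proof.
move=> g0; rewrite lt_def kspan_dot_ge0 andbT; apply: contra g0 => /eqP g0.
apply/eqP/val_inj/funext => x /=.
have : normc (kspan_dot g (kspan_pure x)) ^+ 2 <=
    complex.Re (kspan_dot g g) *
    complex.Re (kspan_dot (kspan_pure x) (kspan_pure x)).
  exact: (hermCS (f := kspan_dot)) kspan_dot_ge0 _ _.
rewrite g0 mul0r kspan_pureE => h; apply: eq0_normc.
by apply/eqP; rewrite -sqrf_eq0 eq_le h sqr_ge0.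
Qed.

HB.instance Definition _ := isDotProduct.Build _ _ kspan_dot kspan_dot_gt0.

Lemma kspan_dot_pure x y : kspan_dot (kspan_pure x) (kspan_pure y) = k x y.
Proof. by rewrite kspan_pureE. Qed.

Lemma kspan_gen (g : E) :
  exists s : seq (R[i] * X), g = \sum_(p <- s) p.1 *: kspan_pure p.2.
Proof.
exists (kspan_rep g); apply/val_inj; rewrite raddf_sum/=.
exact: kspan_repE.
Qed.

End KernelSpan.

Section HilbertNorm.
Variables (R : realType) (H : hilbertType R).

Definition hnorm (x : H) : R := dotnorm hdot x.

End HilbertNorm.

Section DirectSumAux.
Variable R : realType.

Lemma sqr_le_double (p q r : R) : 0 <= r -> r <= p + q ->
  r ^+ 2 <= 2 * (p ^+ 2 + q ^+ 2).
Proof.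
move=> r0 rpq; apply: (@le_trans _ _ ((p + q) ^+ 2)).
  by rewrite ler_pXn2r ?nnegrE// (le_trans r0).
by have := sqr_ge0 (p - q); nra.
Qed.

Lemma mul_le_sqr (p q : R) : 0 <= p -> 0 <= q -> p * q <= p ^+ 2 + q ^+ 2.
Proof. by move=> p0 q0; have := sqr_ge0 (p - q); nra. Qed.

Lemma cvgC_Re_ge (a : nat -> R[i]) l (M : R) :
  cvgC a l -> (exists N, forall n, (N <= n)%N -> M <= complex.Re (a n)) ->
  M <= complex.Re l.
Proof.
move=> al [N aM]; rewrite -lerN2 -raddfN.
have al' : cvgC (fun n => - a n) (- l).
  have := cvgCZ (-1) al; rewrite mulN1r.
  by under eq_fun do rewrite mulN1r.
apply: cvgC_Re_le al' _; exists N => n /aM.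
by rewrite raddfN lerN2.
Qed.

Lemma cvg_dot_diag (V : lmodType R[i]) (f : {dot V for Num.conj}) u l :
  dot_cvg f u l -> cvgC (fun n => f (u n) (u n)) (f l l).
Proof.
move=> ul e e0; set K := dotnorm f l + 1.
have K0 : 0 < K by rewrite ltr_wpDl ?dotnorm_ge0.
have K20 : 0 < 2 * K by rewrite mulr_gt0.
have [N hN] := ul _ (divr_gt0 e0 K20); have [M hM] := ul _ ltr01.
exists (maxn N M) => n; rewrite geq_max => /andP[/hN h1 /hM h2].
have -> : f (u n) (u n) - f l l = f (u n - l) (u n) + f l (u n - l).
  by rewrite linearBl linearBr; ring.
have un : dotnorm f (u n) <= K.
  have := dotnormD f (u n - l) l; rewrite subrK /K; lra.
rewrite (le_lt_trans (normcD_le _ _))//.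
apply: le_lt_trans (lerD (dotCS f _ _) (dotCS f _ _)) _.
rewrite [X in _ + X]mulrC -mulrDr.
rewrite ltr_pdivlMr// in h1; apply: le_lt_trans h1.
rewrite ler_wpM2l ?dotnorm_ge0// mulr_natl mulr2n lerD//.
by rewrite /K lerDl.
Qed.

Lemma nondecreasing_cauchy (B : nat -> R) (M : R) :
  {homo B : m n / (m <= n)%N >-> m <= n} -> (forall n, B n <= M) ->
  forall e : R, 0 < e -> exists N, forall m n, (N <= m)%N -> (N <= n)%N ->
    `|B m - B n| < e.
Proof.
move=> ndB BM e e0; have e20 : 0 < e / 2 by rewrite divr_gt0.
have /cvg_ex[/= l Bl] : cvgn B.
  apply: nondecreasing_is_cvgn => //.
  by exists M => _ [n _ <-].
move/cvgrPdist_lt : Bl => /(_ _ e20)[N _ hN].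
exists N => m n /hN /= h1 /hN /= h2.
rewrite (_ : B m - B n = (l - B n) - (l - B m)); last by ring.
by rewrite (le_lt_trans (ler_normB _ _))// [e]splitr ltrD.
Qed.

End DirectSumAux.

Definition dseq (R : realType) (E : nat -> hilbertType R) := forall n, E n.

Section DependentSequences.
Variables (R : realType) (E : nat -> hilbertType R).
Implicit Types x y z : dseq E.

HB.instance Definition _ := gen_eqMixin (dseq E).
HB.instance Definition _ := gen_choiceMixin (dseq E).

Let dadd x y : dseq E := fun n => x n + y n.
Let dopp x : dseq E := fun n => - x n.
Let dzero : dseq E := fun n => 0.
Let dscale (c : R[i]) x : dseq E := fun n => c *: x n.

Fact daddA : associative dadd.
Proof. by move=> x y z; apply: functional_extensionality_dep => n;
  rewrite /dadd addrA. Qed.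
Fact daddC : commutative dadd.
Proof. by move=> x y; apply: functional_extensionality_dep => n;
  rewrite /dadd addrC. Qed.
Fact dadd0 : left_id dzero dadd.
Proof. by move=> x; apply: functional_extensionality_dep => n;
  rewrite /dadd add0r. Qed.
Fact daddN : left_inverse dzero dopp dadd.
Proof. by move=> x; apply: functional_extensionality_dep => n;
  rewrite /dadd addNr. Qed.

HB.instance Definition _ :=
  GRing.isZmodule.Build (dseq E) daddA daddC dadd0 daddN.

Fact dscaleA a b x : dscale a (dscale b x) = dscale (a * b) x.
Proof. by apply: functional_extensionality_dep => n;
  rewrite /dscale scalerA. Qed.
Fact dscale1 : left_id 1 dscale.
Proof. by move=> x; apply: functional_extensionality_dep => n;
  rewrite /dscale scale1r. Qed.
Fact dscaleDr : right_distributive dscale +%R.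
Proof. by move=> a x y; apply: functional_extensionality_dep => n;
  rewrite /dscale scalerDr. Qed.
Fact dscaleDl x : {morph dscale ^~ x : a b / a + b}.
Proof. by move=> a b; apply: functional_extensionality_dep => n;
  rewrite /dscale scalerDl. Qed.

HB.instance Definition _ := GRing.Zmodule_isLmodule.Build R[i] (dseq E)
  dscaleA dscale1 dscaleDr dscaleDl.

Definition sqsum x N : R := \sum_(n < N) hnorm (x n) ^+ 2.

Definition l2_pred : {pred dseq E} :=
  [pred x : dseq E | `[< exists M, forall N, sqsum x N <= M >]].

Lemma sqsumS x N : sqsum x N.+1 = sqsum x N + hnorm (x N) ^+ 2.
Proof. by rewrite /sqsum big_ord_recr. Qed.

Lemma sqsum_le x : {homo sqsum x : m n / (m <= n)%N >-> m <= n}.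
Proof.
apply: homo_leq => [//||n]; first by move=> ? ? ?; exact: le_trans.
by rewrite /sqsum big_ord_recr/= lerDl sqr_ge0.
Qed.

Lemma l2_pred_submod : submod_closed l2_pred.
Proof.
split.
  apply/asboolP; exists 0 => N; rewrite /sqsum big1// => n _.
  by rewrite [X in hnorm X](_ : _ = 0)// /hnorm dotnorm0 expr0n.
move=> c x y /asboolP[M xM] /asboolP[L yL]; apply/asboolP.
exists (2 * (normc c ^+ 2 * M + L)) => N.
apply: (@le_trans _ _ (2 * (normc c ^+ 2 * sqsum x N + sqsum y N))).
  rewrite /sqsum mulr_sumr -big_split mulr_sumr/=; apply: ler_sum => n _.
  rewrite -exprMn -dotnormZ.
  by apply: sqr_le_double; [exact: dotnorm_ge0|exact: dotnormD].
rewrite ler_pM2l// lerD// ler_wpM2l// sqr_ge0//.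
Qed.

HB.instance Definition _ := GRing.isSubmodClosed.Build _ _ l2_pred
  l2_pred_submod.

End DependentSequences.

(* The Hilbert space direct sum of the [E n]: square summable sequences. *)
Record hsum (R : realType) (E : nat -> hilbertType R) := HSum {
  hsum_fun : dseq E ;
  hsum_funP : hsum_fun \in @l2_pred R E }.

Section DirectSum.
Variables (R : realType) (E : nat -> hilbertType R).
Local Notation S := (hsum E).

HB.instance Definition _ := [isSub of S for @hsum_fun _ E].
HB.instance Definition _ := [Choice of S by <:].
HB.instance Definition _ := [SubChoice_isSubLmodule of S by <:].

Lemma hsumD (x y : S) n : hsum_fun (x + y) n = hsum_fun x n + hsum_fun y n.
Proof. by []. Qed.

Lemma hsumZ c (x : S) n : hsum_fun (c *: x) n = c *: hsum_fun x n.
Proof. by []. Qed.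

Lemma hsumB (x y : S) n : hsum_fun (x - y) n = hsum_fun x n - hsum_fun y n.
Proof. by []. Qed.

Definition hsum_dot (x y : S) : R[i] :=
  limC (fun N => \sum_(n < N) hdot (hsum_fun x n) (hsum_fun y n)).

Lemma hsum_dotP (x y : S) :
  cvgC (fun N => \sum_(n < N) hdot (hsum_fun x n) (hsum_fun y n)) (hsum_dot x y).
Proof.
apply: limCP; apply: cauchyC_cvg.
have /asboolP[M xM] := hsum_funP x; have /asboolP[L yL] := hsum_funP y.
pose B N := sqsum (hsum_fun x) N + sqsum (hsum_fun y) N.
have ndB : {homo B : m n / (m <= n)%N >-> m <= n}.
  by move=> m n mn; rewrite lerD// sqsum_le.
have BM n : B n <= M + L by rewrite lerD.
move=> e /(nondecreasing_cauchy ndB BM)[N hN]; exists N.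
have key m n : (m <= n)%N -> normc (\sum_(i < n) hdot (hsum_fun x i) (hsum_fun y i) -
    \sum_(i < m) hdot (hsum_fun x i) (hsum_fun y i)) <= B n - B m.
  move=> /subnKC <-; elim: (n - m)%N => [|j IH].
    by rewrite addn0 !subrr normc0.
  rewrite addnS big_ord_recr/= addrAC (le_trans (normcD_le _ _))//.
  apply: le_trans (lerD IH (le_trans (dotCS hdot _ _)
    (mul_le_sqr (dotnorm_ge0 hdot _) (dotnorm_ge0 hdot _)))) _.
  by rewrite /B !sqsumS /hnorm le_eqVlt; apply/orP; left; apply/eqP; ring.
move=> m n Nm Nn; apply: le_lt_trans (hN _ _ Nm Nn).
have [mn|/ltnW nm] := leqP m n.
  rewrite normc_distC distrC; apply: le_trans (key _ _ mn) _.
  exact: ler_norm.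
by apply: le_trans (key _ _ nm) _; exact: ler_norm.
Qed.

Lemma hsum_dot_herm x y : hsum_dot x y = (-1) ^+ false * (hsum_dot y x)^*.
Proof.
rewrite expr0 mul1r; apply: cvgC_uniq (hsum_dotP x y) _.
have := cvgC_conj (hsum_dotP y x); congr cvgC; apply/funext => N.
by rewrite rmorph_sum/=; apply: eq_bigr => n _; rewrite -dot_conj.
Qed.

Lemma hsum_dotPl z : GRing.linear_for *%R (hsum_dot ^~ z).
Proof.
move=> c x y; apply: cvgC_uniq (hsum_dotP _ z) _.
have := cvgCD (cvgCZ c (hsum_dotP x z)) (hsum_dotP y z).
congr cvgC; apply/funext => N; rewrite mulr_sumr -big_split/=.
by apply: eq_bigr => n _; rewrite linearDl linearZl_LR.
Qed.

Lemma hsum_dotPr z : GRing.linear_for (Num.conj \; *%R) (hsum_dot z).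
Proof.
move=> c x y; rewrite [LHS]hsum_dot_herm hsum_dotPl expr0 mul1r.
by rewrite rmorphD rmorphM/= [hsum_dot z x]hsum_dot_herm
  [hsum_dot z y]hsum_dot_herm expr0 !mul1r.
Qed.

HB.instance Definition _ := bilinear_isBilinear.Build _ _ _ _ _ _ hsum_dot
  (hsum_dotPl, hsum_dotPr).
HB.instance Definition _ := isHermitianSesquilinear.Build _ _ _ _ hsum_dot
  hsum_dot_herm.

Lemma hsum_dot_ge0 x : 0 <= hsum_dot x x.
Proof.
apply: cvgC_ge0 (hsum_dotP x x) _ => N.
by apply: sumr_ge0 => n _; exact: dot_ge0.
Qed.

Lemma Re_sum_hdot (x : S) N :
  complex.Re (\sum_(n < N) hdot (hsum_fun x n) (hsum_fun x n)) = sqsum (hsum_fun x) N.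
Proof.
by rewrite raddf_sum; apply: eq_bigr => n _; rewrite /hnorm dotnormK.
Qed.

Lemma sqsum_le_dot (x : S) N : sqsum (hsum_fun x) N <= complex.Re (hsum_dot x x).
Proof.
apply: cvgC_Re_ge (hsum_dotP x x) _; exists N => n Nn.
by rewrite Re_sum_hdot sqsum_le.
Qed.

Lemma hnorm_le_sqsum (x : dseq E) n : hnorm (x n) ^+ 2 <= sqsum x n.+1.
Proof.
rewrite /sqsum big_ord_recr/= lerDr; apply: sumr_ge0 => i _; exact: sqr_ge0.
Qed.

Lemma hsum_dot_gt0 x : x != 0 -> 0 < hsum_dot x x.
Proof.
move=> x0; rewrite lt_def hsum_dot_ge0 andbT; apply: contra x0 => /eqP x0.
apply/eqP/val_inj/functional_extensionality_dep => n /=.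
apply: (@dotnorm_eq0 _ _ hdot); apply/eqP; rewrite -sqrf_eq0 eq_le sqr_ge0 andbT.
have := le_trans (hnorm_le_sqsum (hsum_fun x) n) (sqsum_le_dot x n.+1).
by rewrite x0.
Qed.

HB.instance Definition _ := isDotProduct.Build _ _ hsum_dot hsum_dot_gt0.

Lemma hnorm_coord (x : S) n : hnorm (hsum_fun x n) <= dotnorm hsum_dot x.
Proof.
rewrite -(@ler_pXn2r _ 2) ?nnegrE ?dotnorm_ge0// [leRHS]dotnormK.
exact: le_trans (hnorm_le_sqsum (hsum_fun x) n) (sqsum_le_dot x n.+1).
Qed.

Lemma hsum_complete (x : nat -> S) : dot_cauchy hsum_dot x ->
  exists l, dot_cvg hsum_dot x l.
Proof.
move=> cx.
have xl0 n : exists l : E n, dot_cvg hdot (fun m => hsum_fun (x m) n) l.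
  apply: hdot_complete => e /cx[N hN]; exists N => m k Nm Nk.
  rewrite -hsumB; apply: le_lt_trans (hN _ _ Nm Nk).
  exact: hnorm_coord.
pose l : dseq E := fun n => projT1 (cid (xl0 n)).
have xl n : dot_cvg hdot (fun m => hsum_fun (x m) n) (l n).
  by rewrite /l; case: cid.
have bound (e : R) : 0 < e -> exists N, forall m, (N <= m)%N -> forall K,
    sqsum (hsum_fun (x m) - l) K <= e ^+ 2.
  move=> e0; have [N hN] := cx _ e0; exists N => m Nm K.
  have := @cvgC_sum R _ (index_enum 'I_K)
    (fun k (n : 'I_K) => hdot (hsum_fun (x m) n - hsum_fun (x k) n) (hsum_fun (x m) n - hsum_fun (x k) n))
    (fun n : 'I_K => hdot (hsum_fun (x m) n - l n) (hsum_fun (x m) n - l n)).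
  move=> /(_ _)/cvgC_Re_le h.
  have -> : sqsum (hsum_fun (x m) - l) K =
      complex.Re (\sum_(n < K) hdot (hsum_fun (x m) n - l n) (hsum_fun (x m) n - l n)).
    by rewrite raddf_sum; apply: eq_bigr => n _; rewrite /hnorm dotnormK.
  apply: h => [n|].
    apply: cvg_dot_diag => e' /(xl n)[N' hN']; exists N' => k /hN' h.
    by rewrite opprB addrC addrA subrK dotnormBC.
  exists N => k Nk; rewrite (_ : \sum_(n < K) _ =
    \sum_(n < K) hdot (hsum_fun (x m - x k) n) (hsum_fun (x m - x k) n))//.
  rewrite Re_sum_hdot (le_trans (sqsum_le_dot _ _))//.
  rewrite -[complex.Re _](dotnormK hsum_dot) ler_pXn2r ?nnegrE ?dotnorm_ge0 ?(ltW e0)//.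
  by rewrite ltW// hN.
have lP : l \in @l2_pred R E.
  have [N hN] := bound _ ltr01.
  rewrite (_ : l = hsum_fun (x N) - (hsum_fun (x N) - l)).
    rewrite rpredB ?hsum_funP//; apply/asboolP; exists (1 ^+ 2) => K.
    exact: hN.
  by rewrite opprB addrC subrK.
exists (HSum lP) => e e0; have e20 : 0 < e / 2 by rewrite divr_gt0.
have [N hN] := bound _ e20; exists N => m Nm.
apply: (@le_lt_trans _ _ (e / 2)); last first.
  by rewrite ltr_pdivrMr// mulr_natr mulr2n ltrDl.
rewrite -(@ler_pXn2r _ 2) ?nnegrE ?dotnorm_ge0 ?(ltW e20)// dotnormK.
apply: cvgC_Re_le (hsum_dotP _ _) _; exists 0%N => K _.
by rewrite Re_sum_hdot; exact: hN.
Qed.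

HB.instance Definition _ := isHilbert.Build R S hsum_complete.

End DirectSum.

Section DirectSumInjection.
Variables (R : realType) (E : nat -> hilbertType R).

Definition dseq_inj n (x : E n) : dseq E := dfwith (0 : dseq E) n x.

Lemma dseq_injE n (x : E n) : dseq_inj x n = x.
Proof. by rewrite /dseq_inj dfwithin. Qed.

Lemma dseq_inj_out n m (x : E n) : n != m -> dseq_inj x m = 0.
Proof. by move=> nm; rewrite /dseq_inj dfwithout. Qed.

Lemma dseq_inj_l2 n (x : E n) : dseq_inj x \in @l2_pred R E.
Proof.
apply/asboolP; exists (hnorm x ^+ 2) => N; elim: N => [|N IH].
  by rewrite /sqsum big_ord0 sqr_ge0.
have [->{IH N}|nN] := eqVneq N n; last first.
  by rewrite sqsumS dseq_inj_out 1?eq_sym// /hnorm dotnorm0 expr0n addr0.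
rewrite sqsumS dseq_injE /sqsum big1 ?add0r// => i _.
by rewrite dseq_inj_out ?gtn_eqF// /hnorm dotnorm0 expr0n.
Qed.

Definition hsum_inj n (x : E n) : hsum E := HSum (dseq_inj_l2 x).

Lemma hsum_inj_linear n : linear (@hsum_inj n).
Proof.
move=> c x y; apply/val_inj/functional_extensionality_dep => m /=.
have [<-|nm] := eqVneq n m.
  by rewrite dseq_injE -[RHS]/(c *: dseq_inj x n + dseq_inj y n) !dseq_injE.
rewrite dseq_inj_out// -[RHS]/(c *: dseq_inj x m + dseq_inj y m).
by rewrite !dseq_inj_out// scaler0 addr0.
Qed.

HB.instance Definition _ n := GRing.isLinear.Build _ _ _ _ (@hsum_inj n)
  (@hsum_inj_linear n).

Lemma hsum_dot_injr (x : hsum E) n (y : E n) :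
  hdot x (hsum_inj y) = hdot (hsum_fun x n) y.
Proof.
apply: cvgC_uniq (hsum_dotP x (hsum_inj y)) _ => e e0.
exists n.+1 => N nN; rewrite (bigD1 (Ordinal nN))//= dseq_injE big1.
  by rewrite addr0 subrr normc0.
move=> i /eqP/val_eqP/= ni; rewrite dseq_inj_out 1?eq_sym//.
by rewrite linear0r.
Qed.

Lemma hsum_dot_inj n (x y : E n) :
  hdot (hsum_inj x) (hsum_inj y) = hdot x y.
Proof. by rewrite hsum_dot_injr/= dseq_injE. Qed.

Lemma hsum_dot_inj_neq m n (x : E m) (y : E n) : m != n ->
  hdot (hsum_inj x) (hsum_inj y) = 0.
Proof. by move=> mn; rewrite hsum_dot_injr/= dseq_inj_out// linear0l. Qed.

Lemma hsum_sum (I : Type) (r : seq I) (F : I -> hsum E) n :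
  hsum_fun (\sum_(i <- r) F i) n = \sum_(i <- r) hsum_fun (F i) n.
Proof.
elim: r => [|i r IH]; first by rewrite !big_nil.
by rewrite !big_cons hsumD IH.
Qed.

Lemma hsum_dense (x : hsum E) (e : R) : 0 < e ->
  exists N, hnorm (x - \sum_(n < N) hsum_inj (hsum_fun x n)) < e.
Proof.
move=> e0; have e20 : 0 < e / 2 by rewrite divr_gt0.
have /asboolP[M xM] := hsum_funP x.
have [N hN] := nondecreasing_cauchy (@sqsum_le _ _ (hsum_fun x)) xM
  (exprn_gt0 2 e20).
exists N; set y := x - _.
have yE n : hsum_fun y n = if (n < N)%N then 0 else hsum_fun x n.
  have -> : hsum_fun y n = hsum_fun x n -
      \sum_(i < N) hsum_fun (hsum_inj (hsum_fun x i)) n.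
    by rewrite /y hsumB hsum_sum.
  case: ltnP => nN.
    rewrite (bigD1 (Ordinal nN))//= dseq_injE big1 ?addr0 ?subrr// => i.
    by move=> /eqP/val_eqP/= ni; rewrite dseq_inj_out.
  rewrite big1 ?subr0// => i _ /=; rewrite dseq_inj_out//.
  by rewrite ltn_eqF// (leq_trans (ltn_ord i)).
have yN m : sqsum (hsum_fun y) m <= (e / 2) ^+ 2.
  have [mN|Nm] := leqP m N.
    rewrite /sqsum big1 ?sqr_ge0// => i _.
    by rewrite yE (leq_trans (ltn_ord i) mN) /hnorm dotnorm0 expr0n.
  have -> : sqsum (hsum_fun y) m = sqsum (hsum_fun x) m - sqsum (hsum_fun x) N.
    rewrite -(subnKC (ltnW Nm)); elim: (m - N)%N => [|j IH].
      rewrite addn0 subrr /sqsum big1// => i _.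
      by rewrite yE ltn_ord /hnorm dotnorm0 expr0n.
    by rewrite addnS !sqsumS IH yE ltnNge leq_addr/= addrAC.
  apply: le_trans (ler_norm _) _.
  by rewrite ltW// hN// ltnW.
apply: (@le_lt_trans _ _ (e / 2)); last first.
  by rewrite ltr_pdivrMr// mulr_natr mulr2n ltrDl.
rewrite -(@ler_pXn2r _ 2) ?nnegrE ?dotnorm_ge0 ?(ltW e20)// [leLHS]dotnormK.
apply: cvgC_Re_le (hsum_dotP _ _) _; exists 0%N => K _.
by rewrite Re_sum_hdot; exact: yN.
Qed.

End DirectSumInjection.

Section CauchyBinet.
Variables (C : comNzRingType) (n d : nat).

Lemma det_mulmx_expand (A : 'M[C]_(n, d)) (B : 'M[C]_(d, n)) :
  \det (A *m B) = \sum_(f : {ffun 'I_n -> 'I_d}) (\prod_i A i (f i)) * \det (rowsub f B).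
Proof.
under [RHS]eq_bigr do rewrite mulr_sumr.
rewrite exchange_big/=; apply: eq_bigr => s _.
under eq_bigr do rewrite mxE.
rewrite bigA_distr_bigA mulr_sumr/=; apply: eq_bigr => f _.
rewrite big_split/= mulrCA; congr (_ * (_ * _)).
by apply: eq_bigr => i _; rewrite mxE.
Qed.

Lemma cauchy_binet (A : 'M[C]_(n, d)) (B : 'M[C]_(d, n)) :
  n`!%:R * \det (A *m B) =
  \sum_(f : {ffun 'I_n -> 'I_d}) \det (colsub f A) * \det (rowsub f B).
Proof.
have key (t : 'S_n) : \det (A *m B) = \sum_(f : {ffun 'I_n -> 'I_d})
    ((-1) ^+ t * \prod_i colsub f A i (t i)) * \det (rowsub f B).
  rewrite det_mulmx_expand.
  rewrite (reindex (fun f : {ffun 'I_n -> 'I_d} => [ffun i => f (t i)]))/=.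
    apply: eq_bigr => f _.
    have -> : rowsub [ffun i => f (t i)] B = row_perm t (rowsub f B).
      by apply/matrixP => i j; rewrite !mxE ffunE.
    rewrite row_permE det_mulmx det_perm mulrA [_ * (-1) ^+ _]mulrC.
    by congr (_ * _ * _); apply: eq_bigr => i _; rewrite ffunE mxE.
  exists (fun f : {ffun 'I_n -> 'I_d} => [ffun i => f (t^-1%g i)]) => f _.
    by apply/ffunP => i; rewrite !ffunE permKV.
  by apply/ffunP => i; rewrite !ffunE permK.
rewrite -card_Sn mulr_natl -sumr_const.
under eq_bigr => t _ do rewrite (key t).
rewrite exchange_big/=; apply: eq_bigr => f _.
by rewrite -mulr_suml.
Qed.

End CauchyBinet.

Section GramSchmidt.
Variables (R : realType) (V : lmodType R[i]) (f : {dot V for Num.conj}).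

Definition gs_proj (e : seq V) x := \sum_(a <- e) f x a *: a.

Lemma gs_proj_linear e : linear (gs_proj e).
Proof.
move=> c x y; rewrite /gs_proj scaler_sumr -big_split/=; apply: eq_bigr => a _.
by rewrite linearDl linearZl_LR/= scalerDl scalerA.
Qed.

HB.instance Definition _ e := GRing.isLinear.Build _ _ _ _ (gs_proj e)
  (gs_proj_linear e).

Lemma gs_proj_adj e x y : f (gs_proj e x) y = f x (gs_proj e y).
Proof.
rewrite /gs_proj linear_sumlz linear_sumr; apply: eq_bigr => a _ /=.
by rewrite linearZl_LR linearZr_LR/= -dot_conj mulrC.
Qed.

Lemma gram_schmidt (s : seq V) : exists e : seq V,
  forall x, x \in e ++ s -> x = \sum_(a <- e) f x a *: a.
Proof.
suff [e he] : exists e : seq V, forall x, x \in e ++ s -> gs_proj e x = x.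
  by exists e => x /he.
elim: s => [|v s [e IH]]; first by exists [::].
have IHe x : x \in e -> gs_proj e x = x.
  by move=> xe; rewrite IH// mem_cat xe.
have IHs x : x \in s -> gs_proj e x = x.
  by move=> xe; rewrite IH// mem_cat xe orbT.
have idem x : gs_proj e (gs_proj e x) = gs_proj e x.
  rewrite {2 3}/gs_proj linear_sum !big_seq; apply: eq_bigr => a ae.
  by rewrite linearZ/= IHe.
pose r := v - gs_proj e v.
have projr : gs_proj e r = 0 by rewrite /r linearB/= idem subrr.
have orth x : gs_proj e x = x -> f x r = 0.
  by move=> <-; rewrite gs_proj_adj projr linear0r.
have [r0|r0] := eqVneq r 0.
  exists e => x; rewrite mem_cat inE => /or3P[/IHe//|/eqP->|/IHs//].
  by apply/eqP; rewrite eq_sym -subr_eq0 -/r r0.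
pose c : R[i] := ((dotnorm f r)^-1%:C)%C.
have c2 : c * c * f r r = 1.
  rewrite -dotnormKC /c -!rmorphM/= -expr2 -exprMn mulVf ?expr1n//.
  by apply: contra r0 => /eqP/dotnorm_eq0->.
have cconj : c^* = c by rewrite conjE conjc_real.
pose u := c *: r.
exists (u :: e) => x.
have projE y : gs_proj (u :: e) y = f y u *: u + gs_proj e y.
  by rewrite /gs_proj big_cons.
have projx y : gs_proj e y = y -> gs_proj (u :: e) y = y.
  by move=> ye; rewrite projE ye /u linearZr_LR/= orth// mulr0 scale0r add0r.
rewrite inE mem_cat inE => /or4P[/eqP->|/IHe/projx//|/eqP->|/IHs/projx//].
  rewrite projE /u linearZl_LR linearZr_LR/= cconj mulrA c2 scale1r.
  by rewrite linearZ/= projr scaler0 addr0.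
rewrite projE; have -> : f v u = c * f r r.
  rewrite /u linearZr_LR/= cconj; congr (_ * _).
  rewrite -[in LHS](subrK (gs_proj e v) v) -/r linearDl/=.
  by rewrite (orth (gs_proj e v)) ?idem// addr0.
by rewrite /u scalerA mulrAC c2 scale1r subrK.
Qed.

End GramSchmidt.

Section GramKernel.
Variables (R : realType) (H : hilbertType R) (n : nat).
Implicit Types v w : n.-tuple H.

Definition gram v w : R[i] :=
  \det (\matrix_(i < n, j < n) hdot (tnth v i) (tnth w j)).

Lemma gram_herm v w : gram w v = (gram v w)^*.
Proof.
rewrite /gram -det_tr -det_map_mx; congr (\det _).
by apply/matrixP => i j; rewrite !mxE/= -dot_conj.
Qed.

Lemma gram_expand (e : seq H) v w :
  (forall i, tnth v i = \sum_(a <- e) hdot (tnth v i) a *: a) ->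
  n`!%:R * gram v w = \sum_(f : {ffun 'I_n -> 'I_(size e)})
    gram v [tuple e`_(f j) | j < n] * gram [tuple e`_(f j) | j < n] w.
Proof.
move=> ve.
pose A : 'M_(n, size e) := \matrix_(i, a) hdot (tnth v i) e`_a.
pose B : 'M_(size e, n) := \matrix_(a, j) hdot e`_a (tnth w j).
have -> : gram v w = \det (A *m B).
  congr (\det _); apply/matrixP => i j; rewrite !mxE [in LHS]ve linear_sumlz.
  rewrite (big_nth 0) big_mkord; apply: eq_bigr => a _.
  by rewrite !mxE linearZl_LR.
rewrite cauchy_binet; apply: eq_bigr => f _.
  congr (_ * _); congr (\det _).
  by apply/matrixP => i j; rewrite !mxE tnth_mktuple.
by apply/matrixP => i j; rewrite !mxE tnth_mktuple.
Qed.

Lemma gram_psd (s : seq (R[i] * n.-tuple H)) :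
  0 <= \sum_(p <- s) \sum_(q <- s) p.1 * q.1^* * gram p.2 q.2.
Proof.
have [e eP] := gram_schmidt hdot (flatten [seq tval p.2 | p <- s]).
have {}eP p i : p \in s ->
    tnth p.2 i = \sum_(a <- e) hdot (tnth p.2 i) a *: a.
  move=> ps; apply: eP; rewrite mem_cat; apply/orP; right.
  by apply/flatten_mapP; exists p => //; exact: mem_tnth.
rewrite -(pmulr_rge0 _ (_ : 0 < n`!%:R)) ?ltr0n ?fact_gt0//.
pose D (f : {ffun 'I_n -> 'I_(size e)}) p : R[i] :=
  p.1 * gram p.2 [tuple e`_(f j) | j < n].
rewrite (_ : _ * _ = \sum_f (\sum_(p <- s) D f p) * (\sum_(p <- s) D f p)^*).
  by apply: sumr_ge0 => f _; rewrite mul_conjC_ge0.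
under [RHS]eq_bigr do rewrite rmorph_sum big_distrlr/=.
rewrite [RHS]exchange_big mulr_sumr/=; apply: eq_big_seq => p ps.
rewrite [RHS]exchange_big mulr_sumr/=; apply: eq_bigr => q _.
rewrite mulrCA (gram_expand _ (fun i => eP p i ps)) mulr_sumr.
apply: eq_bigr => f _; rewrite /D rmorphM/= -gram_herm; ring.
Qed.

Definition gram_kernel : psd_kernel R (n.-tuple H) :=
  PsdKernel gram_herm gram_psd.

End GramKernel.

Section FockSpace.
Variables (R : realType) (H : hilbertType R).

(* The Hilbert space exterior power: the completion of the algebraic exterior
   power, spanned by the symbols [v1 /\ ... /\ vn], for the inner product
   [<v1 /\ ... /\ vn, w1 /\ ... /\ wn> = det (<vi, wj>)]. *)
Definition extpow (n : nat) : hilbertType R :=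
  completion (@kspan_dot R (n.-tuple H) (gram_kernel H n)).

Definition extpow_wedge n (v : n.-tuple H) : extpow n :=
  cpl_pure (@kspan_dot R (n.-tuple H) (gram_kernel H n))
    (kspan_pure (gram_kernel H n) v).

Definition fock : hilbertType R := hsum extpow.

Definition wedge (v : seq H) : fock :=
  hsum_inj (extpow_wedge (in_tuple v)).

Lemma extpow_wedge_dot n (v w : n.-tuple H) :
  hdot (extpow_wedge v) (extpow_wedge w) =
  \det (\matrix_(i < n, j < n) hdot (tnth v i) (tnth w j)).
Proof. by rewrite [LHS]cpl_dot_pure; exact: kspan_dot_pure. Qed.

Lemma extpow_dense n (x : extpow n) (e : R) : 0 < e ->
  exists s : seq (R[i] * n.-tuple H),
    hnorm (x - \sum_(p <- s) p.1 *: extpow_wedge p.2) < e.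
Proof.
move=> /(@cpl_dense _ _ (@kspan_dot R (n.-tuple H) (gram_kernel H n)) x)[w].
have [s ->] := kspan_gen w; rewrite linear_sum => h; exists s.
by under eq_bigr do rewrite /extpow_wedge -linearZ.
Qed.

Lemma wedge_tuple n (v : n.-tuple H) :
  wedge v = hsum_inj (extpow_wedge v).
Proof.
rewrite /wedge; case: v => v vn /=; have h := eqP vn; case: _ / h vn => vn.
by congr (hsum_inj (extpow_wedge _)); apply/val_inj.
Qed.

Lemma wedge_dot (v w : seq H) :
  hdot (wedge v) (wedge w) = (size v == size w)%:R *
  \det (\matrix_(i < size w, j < size w) hdot v`_i w`_j).
Proof.
have [vw|vw] := eqVneq (size v) (size w); last first.
  by rewrite mul0r; exact: hsum_dot_inj_neq.
rewrite mul1r -[v]/(tval (Tuple (introT eqP vw))) wedge_tuple.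
rewrite [LHS]hsum_dot_inj extpow_wedge_dot; congr (\det _).
by apply/matrixP => i j; rewrite !mxE !(tnth_nth 0).
Qed.

Lemma wedge_dense (x : fock) (e : R) : 0 < e ->
  exists s : seq (R[i] * seq H),
    hnorm (x - \sum_(p <- s) p.1 *: wedge p.2) < e.
Proof.
move=> e0; have e20 : 0 < e / 2 by rewrite divr_gt0.
have [N hN] := hsum_dense x e20.
suff [s hs] : exists s : seq (R[i] * seq H),
    hnorm (\sum_(n < N) hsum_inj (hsum_fun x n) -
      \sum_(p <- s) p.1 *: wedge p.2) < e / 2.
  exists s; apply: le_lt_trans (dotnorm_triangle hdot
    (\sum_(n < N) hsum_inj (hsum_fun x n)) _ _) _.
  by rewrite [e]splitr; apply: ltrD; [exact: hN|exact: hs].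
elim: N {hN} (e / 2) e20 => [|N IH] {e0}e' e0.
  by exists [::]; rewrite big_ord0 big_nil subr0 /hnorm dotnorm0.
have e20 : 0 < e' / 2 by rewrite divr_gt0.
have [s hs] := IH _ e20; have [t ht] := extpow_dense (hsum_fun x N) e20.
exists (s ++ [seq (p.1, tval p.2) | p <- t]).
rewrite big_ord_recr big_cat/= big_map opprD addrACA.
apply: le_lt_trans (dotnormD hdot _ _) _; rewrite [e']splitr.
apply: ltrD; first exact: hs.
under eq_bigr do rewrite wedge_tuple -linearZ.
rewrite -linear_sum -linearB/= /dotnorm.
by rewrite [hdot _ _]hsum_dot_inj.
Qed.

End FockSpace.

(* [Lambda_graph T] is the graph of the densely defined operator [Lambda(T)], with
   domain the linear span of the vectors [wedge v]. *)
Definition Lambda_graph (R : realType) (H K : hilbertType R)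
    (T : {linear H -> K}) (x : fock H) (y : fock K) : Prop :=
  exists s : seq (R[i] * seq H),
    x = \sum_(p <- s) p.1 *: wedge p.2 /\
    y = \sum_(p <- s) p.1 *: wedge (map T p.2).

Section LambdaGraph.
Variables (R : realType) (H K : hilbertType R) (T : {linear H -> K}).

Lemma Lambda_graph_linear c (x x' : fock H) (y y' : fock K) :
  Lambda_graph T x y -> Lambda_graph T x' y' ->
  Lambda_graph T (c *: x + x') (c *: y + y').
Proof.
move=> [s [-> ->]] [t [-> ->]].
exists ([seq (c * p.1, p.2) | p <- s] ++ t).
rewrite !big_cat/= !big_map !scaler_sumr/=; split; congr (_ + _).
  by apply: eq_bigr => p _; rewrite scalerA.
by apply: eq_bigr => p _; rewrite scalerA.
Qed.

Lemma Lambda_graph_wedge v : Lambda_graph T (wedge v) (wedge (map T v)).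
Proof. by exists [:: (1, v)]; rewrite !big_seq1 !scale1r. Qed.

Lemma Lambda_graph0 y : Lambda_graph T 0 y -> y = 0.
Proof.
move=> [s [s0 ->]]; set y' := \sum_(p <- s) _.
suff h u : hdot y' (wedge u) = 0.
  apply/eqP; rewrite -(dnorm_eq0 hdot); apply/eqP.
  rewrite {2}/y' linear_sumr big1// => p _.
  by rewrite linearZr_LR/= h mulr0.
pose n := size u.
have [e eP] := gram_schmidt hdot (flatten [seq p.2 | p <- s]).
have {}eP p i : p \in s -> (i < size p.2)%N ->
    p.2`_i = \sum_(a <- e) hdot p.2`_i a *: a.
  move=> ps ip; apply: eP; rewrite mem_cat; apply/orP; right.
  by apply/flatten_mapP; exists p => //; exact: mem_nth.
pose word (f : {ffun 'I_n -> 'I_(size e)}) : seq H := [seq e`_(f j) | j <- enum 'I_n].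
have wordS f : size (word f) = n by rewrite size_map size_enum_ord.
have wordE f (j : 'I_n) : (word f)`_j = e`_(f j).
  by rewrite (nth_map j) ?size_enum_ord// nth_ord_enum.
pose G (f : {ffun 'I_n -> 'I_(size e)}) : R[i] := \det (\matrix_(j < n, l < n) hdot (T e`_(f j)) u`_l).
have key p : p \in s -> n`!%:R * hdot (wedge (map T p.2)) (wedge u) =
    \sum_f hdot (wedge p.2) (wedge (word f)) * G f.
  move=> ps; rewrite wedge_dot size_map -/n.
  under eq_bigr do rewrite wedge_dot wordS.
  have [pn|_] := eqVneq (size p.2) n; last first.
    by rewrite mul0r mulr0 big1// => f _; rewrite !mul0r.
  under eq_bigr do rewrite mul1r.
  rewrite mul1r.
  pose A : 'M_(n, size e) := \matrix_(i, a) hdot p.2`_i e`_a.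
  pose B : 'M_(size e, n) := \matrix_(a, j) hdot (T e`_a) u`_j.
  rewrite (_ : \matrix_(i, j) _ = A *m B).
    rewrite cauchy_binet; apply: eq_bigr => f _.
    congr (_ * _); congr (\det _).
      by apply/matrixP => i j; rewrite !mxE wordE.
    by apply/matrixP => i j; rewrite !mxE.
  apply/matrixP => i j; rewrite !mxE (nth_map 0) ?pn//.
  rewrite (eP _ _ ps) ?pn// linear_sum linear_sumlz.
  rewrite (big_nth 0) big_mkord; apply: eq_bigr => a _.
  by rewrite !mxE linearZ/= linearZl_LR.
have n0 : n`!%:R != 0 :> R[i] by rewrite pnatr_eq0 -lt0n fact_gt0.
apply: (mulfI n0); rewrite mulr0 /y' linear_sumlz mulr_sumr/=.
rewrite (eq_big_seq (fun p => \sum_f p.1 * hdot (wedge p.2) (wedge (word f)) * G f)).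
  rewrite exchange_big/= big1// => f _; rewrite -mulr_suml.
  rewrite (_ : \sum_(p <- s) _ = hdot 0 (wedge (word f))).
    by rewrite linear0l mul0r.
  rewrite {1}s0 linear_sumlz; apply: eq_bigr => p _.
  by rewrite linearZl_LR.
move=> p ps; rewrite linearZl_LR/= mulrCA key// mulr_sumr.
by apply: eq_bigr => f _; rewrite mulrA.
Qed.

Lemma Lambda_graph_fun x y y' : Lambda_graph T x y -> Lambda_graph T x y' -> y = y'.
Proof.
move=> xy xy'; have := Lambda_graph_linear (-1) xy' xy.
rewrite !scaleN1r addNr => /Lambda_graph0/eqP.
by rewrite addrC subr_eq0 => /eqP.
Qed.

Lemma Lambda_graph_dense (x : fock H) (e : R) : 0 < e ->
  exists x' y, Lambda_graph T x' y /\ hnorm (x - x') < e.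
Proof.
move=> /(wedge_dense x)[s hs].
by exists (\sum_(p <- s) p.1 *: wedge p.2); eexists; split => //; exists s.
Qed.

End LambdaGraph.

Section BoundedOperators.
Variables (R : realType) (H K : hilbertType R).

Definition bounded_op (T : H -> K) : Prop :=
  exists M : R, forall x, hnorm (T x) <= M * hnorm x.

Definition opnorm (T : H -> K) : R :=
  sup [set hnorm (T x) | x in [set x | hnorm x <= 1]].

(* Boundedness and norm of an operator which need not be everywhere defined,
   given by its graph. *)
Definition graph_bounded (G : H -> K -> Prop) : Prop :=
  exists M : R, forall x y, G x y -> hnorm y <= M * hnorm x.

Definition graph_norm (G : H -> K -> Prop) : R :=
  sup [set hnorm y | y in [set y | exists x, G x y /\ hnorm x <= 1]].

(* The range of [F] is spanned by fewer than [n] vectors. *)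
Definition rank_lt (F : H -> K) (n : nat) : Prop :=
  exists s : seq K, (size s < n)%N /\
    forall x, exists c : nat -> R[i], F x = \sum_(i < size s) c i *: s`_i.

(* The n-th singular value, for n >= 1. *)
Definition sing_val (T : H -> K) (n : nat) : R :=
  inf [set opnorm (fun x => T x - F x) |
       F in [set F : {linear H -> K} | bounded_op F /\ rank_lt F n]].

Definition sing_val_prod (T : H -> K) : \bar R :=
  limn (fun N => (\prod_(1 <= n < N.+1) Num.max 1 (sing_val T n))%:E).

End BoundedOperators.

Section TraceClass.
Variables (R : realType) (H K : hilbertType R).

Definition orthonormal_basis (B : set H) : Prop :=
  (forall a b, B a -> B b -> hdot a b = (a == b)%:R) /\
  forall (x : H) (e : R), 0 < e ->
    exists s : seq (R[i] * H), (forall p, p \in s -> B p.2) /\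
      hnorm (x - \sum_(p <- s) p.1 *: p.2) < e.

(* [P] is the positive square root of [X^* X]. *)
Definition is_abs (P : {linear H -> H}) (X : {linear H -> K}) : Prop :=
  [/\ bounded_op P, (forall x, 0 <= hdot (P x) x) &
      forall x y, hdot (P (P x)) y = hdot (X x) (X y)].

(* [\tr |X|] is finite; it does not depend on the orthonormal basis. *)
Definition trace_class (X : {linear H -> K}) : Prop :=
  bounded_op X /\
  exists (P : {linear H -> H}) (B : set H), [/\ is_abs P X,
    orthonormal_basis B &
    (\esum_(b in B) (complex.Re (hdot (P b) b))%:E < +oo)%E].

End TraceClass.

(* Main.v *)
(* Lower bound. Let v_1, v_2, ... be chosen one after the other in the unit ball,
   v_(n+1) nearly maximizing the distance of T v_(n+1) to the span of T v_1, ...,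
   T v_n. Composing T with the projection onto this span has rank at most n, so this
   distance nearly reaches s_(n+1)(T). The norm of T v_1 /\ ... /\ T v_N is the
   product of these distances, and that of v_1 /\ ... /\ v_N is at most 1
   (Hadamard), so every bound of Lambda(T) is at least s_1(T) ... s_N(T).

   Upper bound. An element of the domain of Lambda(T) involves finitely many
   vectors. By the spectral theorem their span has a frame (e_a) with (T e_a)
   orthogonal, and the Cauchy-Binet formula diagonalizes Lambda(T) over words in
   this frame, the entries being products of distinct |T e_a|. The smallest of n
   such norms is at most s_n(T) by min-max.

   (3) => (2). Only countably many singular values exceed 1, and such a value lies
   above the essential norm, hence is attained at a unit vector e_k, which is a
   singular vector. Peeling these off gives X = sum_k (1 - 1/s_k) <., e_k> T e_k
   with |X| = sum_k (s_k - 1) <., e_k> e_k, and T - X is a contraction.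

   (2) => (3). As s_n(A + X) <= 1 + s_n(X), it suffices that sum_n s_n(X) is finite.
   A greedy choice of orthogonal g_k and f_k yields
   s_(2k+1)(X) / 2 <= <|X| g_k, f_k>, and the right-hand sides sum to at most the
   trace of |X|, up to a constant. *)

Require Import Defs.
From HB Require Import structures.
From mathcomp Require Import all_boot all_order all_algebra complex spectral.
From mathcomp Require Import boolp classical_sets cardinality fsbigop.
From mathcomp Require Import reals ereal normedtype sequences esum exp.
From mathcomp Require Import ring lra.

Set Implicit Arguments.
Unset Strict Implicit.
Unset Printing Implicit Defensive.

Import Order.TTheory GRing.Theory Num.Theory.
Import numFieldNormedType.Exports.
Import Normc.
Local Open Scope ring_scope.

(** * Inner products, projections and operator norms *)

Section RealInclusion.
Variable R : realType.

(** Packaged as a ring morphism: identities between squared norms are proved after embedding into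
    [R[i]], where they become identities of inner products. *)
Definition rC : {rmorphism R -> R[i]} := real_complex R.

Lemma rC_inj : injective rC.
Proof. by move=> x y []. Qed.

Lemma Re_rC x : complex.Re (rC x) = x.
Proof. by []. Qed.

Lemma conj_rC x : (rC x)^* = rC x.
Proof. by rewrite conjE conjc_real. Qed.

Lemma normc_rC x : normc (rC x) = `|x|.
Proof. exact: normc_real. Qed.

End RealInclusion.
Arguments rC : simpl never.

Section InnerProduct.
Variables (R : realType) (H : hilbertType R).
Implicit Types (x y z : H) (c : R[i]).

Lemma normcKC c : rC R (normc c ^+ 2) = c * c^*.
Proof.
rewrite conjE; case: c => a b /=.
rewrite (sqr_sqrtr (addr_ge0 (sqr_ge0 a) (sqr_ge0 b))).
by apply/eqP; rewrite eq_complex/=; apply/andP; split; apply/eqP; ring.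
Qed.

Lemma hnormK x : hnorm x ^+ 2 = complex.Re (hdot x x).
Proof. exact: dotnormK. Qed.

Lemma hnormKC x : rC R (hnorm x ^+ 2) = hdot x x.
Proof. exact: dotnormKC. Qed.

Lemma hnorm_ge0 x : 0 <= hnorm x.
Proof. exact: dotnorm_ge0. Qed.

Lemma hnorm0 : hnorm (0 : H) = 0.
Proof. exact: dotnorm0. Qed.

Lemma hnormZ c x : hnorm (c *: x) = normc c * hnorm x.
Proof. exact: dotnormZ. Qed.

Lemma hnorm_opp x : hnorm (- x) = hnorm x.
Proof. exact: dotnormN. Qed.

Lemma hnormD_le x y : hnorm (x + y) <= hnorm x + hnorm y.
Proof. exact: dotnormD. Qed.

Lemma hnormB_le x y : hnorm (x - y) <= hnorm x + hnorm y.
Proof. by rewrite -(hnorm_opp y) hnormD_le. Qed.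

Lemma hnorm_sum (I : Type) (r : seq I) (F : I -> H) :
  hnorm (\sum_(i <- r) F i) <= \sum_(i <- r) hnorm (F i).
Proof.
elim: r => [|i r IH]; first by rewrite !big_nil hnorm0.
by rewrite !big_cons (le_trans (hnormD_le _ _))// lerD2l.
Qed.

Lemma hdotC x y : hdot y x = (hdot x y)^*.
Proof. exact: dot_conj. Qed.

Lemma hdotC0 x y : hdot x y = 0 -> hdot y x = 0.
Proof. by move=> xy; rewrite hdotC xy conjE conjc0. Qed.

Lemma hdot_CS x y : normc (hdot x y) <= hnorm x * hnorm y.
Proof. exact: dotCS. Qed.

Lemma hdotBl x y z : hdot (x - y) z = hdot x z - hdot y z.
Proof. exact: linearBl. Qed.

Lemma hdotBr x y z : hdot x (y - z) = hdot x y - hdot x z.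
Proof. exact: linearBr. Qed.

Lemma hdotDl x y z : hdot (x + y) z = hdot x z + hdot y z.
Proof. exact: linearDl. Qed.

Lemma hdotDr x y z : hdot x (y + z) = hdot x y + hdot x z.
Proof. exact: linearDr. Qed.

Lemma hdotZl c x y : hdot (c *: x) y = c * hdot x y.
Proof. exact: linearZl_LR. Qed.

Lemma hdotZr c x y : hdot x (c *: y) = c^* * hdot x y.
Proof. exact: linearZr_LR. Qed.

Lemma hdot0l x : hdot 0 x = 0.
Proof. exact: linear0l. Qed.

Lemma hdot0r x : hdot x 0 = 0.
Proof. exact: linear0r. Qed.

Lemma hdot_suml (I : Type) (r : seq I) (P : pred I) (F : I -> H) x :
  hdot (\sum_(i <- r | P i) F i) x = \sum_(i <- r | P i) hdot (F i) x.
Proof. exact: linear_sumlz. Qed.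

Lemma hdot_sumr (I : Type) (r : seq I) (P : pred I) (F : I -> H) x :
  hdot x (\sum_(i <- r | P i) F i) = \sum_(i <- r | P i) hdot x (F i).
Proof. exact: linear_sumr. Qed.

Lemma pythagoras x y : hdot x y = 0 ->
  hnorm (x + y) ^+ 2 = hnorm x ^+ 2 + hnorm y ^+ 2.
Proof.
move=> xy; apply: rC_inj; rewrite /= rmorphD/= !hnormKC.
by rewrite hdotDl !hdotDr xy (hdotC0 xy) add0r addr0.
Qed.

Lemma hnorm_eq0 x : hnorm x = 0 -> x = 0.
Proof. exact: dotnorm_eq0. Qed.

Lemma hdot_eq0 x : hdot x x = 0 -> x = 0.
Proof.
by move=> x0; apply: hnorm_eq0; apply/eqP; rewrite -sqrf_eq0 hnormK x0.
Qed.

Lemma ler_sqr2 (a b : R) : 0 <= a -> 0 <= b -> (a ^+ 2 <= b ^+ 2) = (a <= b).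
Proof. by move=> a0 b0; rewrite ler_pXn2r. Qed.

Lemma orth_sum (I : finType) (e : I -> H) (a : I -> R[i]) :
  (forall i j, i != j -> hdot (e i) (e j) = 0) ->
  hnorm (\sum_i a i *: e i) ^+ 2 =
  \sum_i normc (a i) ^+ 2 * hnorm (e i) ^+ 2.
Proof.
move=> orth; apply: rC_inj => /=; rewrite hnormKC rmorph_sum hdot_suml.
apply: eq_bigr => i _; rewrite hdotZl hdot_sumr (bigD1 i)//= big1.
  by rewrite addr0 hdotZr mulrA -hnormKC -normcKC -rmorphM.
by move=> j ji; rewrite hdotZr orth ?mulr0// eq_sym.
Qed.

(** Synthesis from square summable coefficients is a contraction. Unlike orthonormality, this allows
    zero vectors in the family. *)
Definition bessel (I : finType) (e : I -> H) :=
  forall a : I -> R[i],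
    hnorm (\sum_i a i *: e i) ^+ 2 <= \sum_i normc (a i) ^+ 2.

Lemma hdot_sum (I : finType) (e : I -> H) x :
  hdot (\sum_i hdot x (e i) *: e i) x = rC R (\sum_i normc (hdot x (e i)) ^+ 2).
Proof.
rewrite hdot_suml rmorph_sum; apply: eq_bigr => i _.
by rewrite hdotZl [hdot (e i) x]hdotC -normcKC.
Qed.

(** The adjoint of a contraction is a contraction: pairing [\sum_i hdot x (e i) *: e i] with [x]
    gives [S], and Cauchy-Schwarz yields [S ^+ 2 <= S * hnorm x ^+ 2]. *)
Lemma bessel_le (I : finType) (e : I -> H) : bessel e ->
  forall x, \sum_i normc (hdot x (e i)) ^+ 2 <= hnorm x ^+ 2.
Proof.
move=> be x; set S := \sum_i _.
have S0 : 0 <= S by apply: sumr_ge0 => i _; exact: sqr_ge0.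
have := hdot_CS (\sum_i hdot x (e i) *: e i) x.
rewrite hdot_sum -/S normc_rC ger0_norm// -ler_sqr2//; last first.
  by rewrite mulr_ge0 ?hnorm_ge0.
rewrite exprMn => h; have {}h : S ^+ 2 <= S * hnorm x ^+ 2.
  by apply: le_trans h _; rewrite ler_wpM2r ?sqr_ge0//; exact: be.
move: S0; rewrite le_eqVlt => /orP[/eqP<-|S0]; first exact: sqr_ge0.
by rewrite -(ler_pM2l S0) -expr2.
Qed.

(** The converse duality: the arithmetic-geometric inequality gives [2 * hnorm y ^+ 2 <= S + T], and
    the hypothesis at [y] absorbs [T]. *)
Lemma le_bessel (I : finType) (e : I -> H) :
  (forall x, \sum_i normc (hdot x (e i)) ^+ 2 <= hnorm x ^+ 2) -> bessel e.
Proof.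
move=> be a; set y := \sum_i _.
pose S := \sum_i normc (a i) ^+ 2; pose T := \sum_i normc (hdot y (e i)) ^+ 2.
have amgm (i : I) : 2 * normc (a i * hdot (e i) y) <=
    normc (a i) ^+ 2 + normc (hdot y (e i)) ^+ 2.
  rewrite normcM hdotC normc_conj.
  by have := sqr_ge0 (normc (a i) - normc (hdot y (e i))); nra.
have yE : hnorm y ^+ 2 <= \sum_i normc (a i * hdot (e i) y).
  rewrite hnormK; apply: le_trans (ler_norm _) _.
  apply: le_trans (Re_le_normc _) _; rewrite {1}/y hdot_suml.
  apply: (@big_rec2 _ _ (fun (z : R[i]) (r : R) => normc z <= r)).
    by rewrite normc0.
  move=> i z r _ zr; rewrite hdotZl.
  by rewrite (le_trans (normcD_le _ _))// lerD2l.
have : 2 * hnorm y ^+ 2 <= S + T.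
  rewrite /S /T -big_split/= (le_trans (ler_wpM2l _ yE))// mulr_sumr.
  by apply: ler_sum => i _.
by have := be y; rewrite -/T -/S; lra.
Qed.

Lemma bessel_orth (I : finType) (e : I -> H) :
  (forall i j, i != j -> hdot (e i) (e j) = 0) ->
  (forall i, hnorm (e i) <= 1) -> bessel e.
Proof.
move=> oe ne a; rewrite orth_sum//; apply: ler_sum => i _.
rewrite -[leRHS]mulr1 ler_wpM2l ?sqr_ge0//.
by rewrite expr_le1 ?hnorm_ge0.
Qed.

End InnerProduct.

Section SpanProjection.
Variables (R : realType) (H : hilbertType R).
Implicit Types (x y z : H) (s : seq H).

(** The coefficients have the same form as in [rank_lt], so that a range contained in a span is
    literally a rank bound. *)
Definition in_span s x :=
  exists c : nat -> R[i], x = \sum_(i < size s) c i *: s`_i.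

Lemma in_spanP s x : in_span s x <->
  exists c : 'I_(size s) -> R[i], x = \sum_(i < size s) c i *: s`_i.
Proof.
split=> [[c ->]|[c ->]]; first by exists c.
exists (fun i => if insub i is Some j then c j else 0).
by apply: eq_bigr => i _; rewrite valK.
Qed.

Lemma in_span_cons v s x :
  in_span (v :: s) x <-> exists c y, in_span s y /\ x = c *: v + y.
Proof.
split=> [[c ->]|[c [_ [[d ->]]] ->]].
  exists (c 0%N), (\sum_(i < size s) c i.+1 *: s`_i); split; first by exists (c \o succn).
  by rewrite big_ord_recl.
by exists (fun i => if i is i.+1 then d i else c); rewrite big_ord_recl.
Qed.

Lemma in_span0 s : in_span s 0.
Proof. by exists (fun=> 0); rewrite big1// => i _; rewrite scale0r. Qed.

Lemma in_spanD s x y : in_span s x -> in_span s y -> in_span s (x + y).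
Proof.
move=> [c ->] [d ->]; exists (fun i => c i + d i).
by rewrite -big_split; apply: eq_bigr => i _; rewrite scalerDl.
Qed.

Lemma in_spanZ s c x : in_span s x -> in_span s (c *: x).
Proof.
move=> [d ->]; exists (fun i => c * d i).
by rewrite scaler_sumr; apply: eq_bigr => i _; rewrite scalerA.
Qed.

Lemma in_spanB s x y : in_span s x -> in_span s y -> in_span s (x - y).
Proof. by move=> sx sy; rewrite -scaleN1r; apply/in_spanD/in_spanZ. Qed.

Lemma in_span_mem s x : x \in s -> in_span s x.
Proof.
elim: s => // v s IH; rewrite inE => /orP[/eqP->|/IH sx]; apply/in_span_cons.
  by exists 1, 0; rewrite scale1r addr0; split => //; exact: in_span0.
by exists 0, x; rewrite scale0r add0r.
Qed.

Lemma in_span_orth s x y : in_span s x ->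
  (forall z, z \in s -> hdot z y = 0) -> hdot x y = 0.
Proof.
move=> [c ->] h; rewrite hdot_suml big1// => i _.
by rewrite hdotZl h ?mulr0// mem_nth.
Qed.

Definition is_proj s (Q : H -> H) :=
  (forall x, in_span s (Q x)) /\
  (forall x z, z \in s -> hdot z (x - Q x) = 0).

(** One Gram-Schmidt step per vector: the component [u] of [v] orthogonal to the earlier span
    contributes a projection of rank at most one. *)
Lemma projection_exists s : exists Q : {linear H -> H}, is_proj s Q.
Proof.
elim: s => [|v s [Q [Qs Qo]]].
  by exists \0; split=> [x|x z//]; exact: in_span0.
(* If [v] already lies in the span then [u = 0] and the correction term is zero, so one formula
   covers both cases. *)
pose u := v - Q v; pose k : R[i] := rC R (hnorm u ^- 2).
pose Q' x := Q x + (k * hdot x u) *: u.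
have Q'lin : linear Q'.
  move=> c x y; rewrite /Q' linearD linearZ/= hdotDl hdotZl.
  by rewrite mulrDr scalerDl mulrCA addrACA -(scalerA c) -(scalerDr c).
pose QL := GRing.isLinear.Build _ _ _ _ Q' Q'lin.
pose Q'' : {linear H -> H} := HB.pack Q' QL.
exists Q''; split => [x|x z] /=.
  apply/in_span_cons; exists (k * hdot x u), (Q x - (k * hdot x u) *: Q v).
  split; first by apply: in_spanB => //; exact: in_spanZ.
  by rewrite /Q' /u scalerBr addrCA.
have Q'E y : hdot y (x - Q' x) = hdot y (x - Q x) - (k * hdot x u)^* * hdot y u.
  by rewrite /Q' opprD addrA (hdotBr y (x - Q x)) hdotZr.
have Q'o y : y \in s -> hdot y (x - Q' x) = 0.
  by move=> ys; rewrite Q'E Qo// [hdot y u]Qo// mulr0 subrr.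
have uo : hdot u (x - Q' x) = 0.
  rewrite Q'E hdotBr; have uQ y : hdot u (Q y) = 0.
    by apply: hdotC0; apply: in_span_orth (Qs y) _ => w ws; exact: Qo.
  rewrite uQ subr0 rmorphM/= -hdotC -hnormKC conj_rC.
  have [u0|u0] := eqVneq u 0; first by rewrite u0 hdot0l mulr0 mul0r subrr.
  rewrite mulrAC -rmorphM/= mulVf ?mul1r ?subrr//.
  by rewrite expf_eq0/=; apply: contra u0 => /eqP/hnorm_eq0->.
rewrite inE => /orP[/eqP->|]; last exact: Q'o.
rewrite -[v](subrK (Q v)) -/u hdotDl uo add0r.
by apply: in_span_orth (Qs v) _ => w; exact: Q'o.
Qed.

Section ProjectionTheory.
Variables (s : seq H) (Q : H -> H) (Qp : is_proj s Q).

Lemma proj_orth x y : in_span s x -> hdot x (y - Q y) = 0.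
Proof. by move=> sx; apply: in_span_orth sx _ => z; exact: Qp.2. Qed.

Lemma proj_orthQ x y : hdot (Q x) (y - Q y) = 0.
Proof. by apply: proj_orth; exact: Qp.1. Qed.

Lemma proj_split x : hnorm x ^+ 2 = hnorm (Q x) ^+ 2 + hnorm (x - Q x) ^+ 2.
Proof. by rewrite -pythagoras ?proj_orthQ// addrC subrK. Qed.

Lemma projC_le x : hnorm (x - Q x) <= hnorm x.
Proof.
by rewrite -ler_sqr2 ?hnorm_ge0// (proj_split x) lerDr sqr_ge0.
Qed.

Lemma proj_le x : hnorm (Q x) <= hnorm x.
Proof.
by rewrite -ler_sqr2 ?hnorm_ge0// (proj_split x) lerDl sqr_ge0.
Qed.

Lemma proj_best x y : in_span s y -> hnorm (x - Q x) <= hnorm (x - y).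
Proof.
move=> sy; rewrite -ler_sqr2 ?hnorm_ge0//.
have -> : x - y = (Q x - y) + (x - Q x) by rewrite [RHS]addrC addrA subrK.
rewrite [leRHS]pythagoras ?lerDr ?sqr_ge0//; apply: proj_orth; apply: in_spanB => //.
exact: Qp.1.
Qed.

Lemma proj_id x : in_span s x -> Q x = x.
Proof.
move=> sx; apply/eqP; rewrite eq_sym -subr_eq0; apply/eqP/hdot_eq0.
by apply: proj_orth; apply: in_spanB => //; exact: Qp.1.
Qed.

End ProjectionTheory.
End SpanProjection.

Section OperatorNorm.
Variables (R : realType) (H K : hilbertType R).
Implicit Types (T F : {linear H -> K}).

Lemma opnorm_set0 (T : H -> K) : T 0 = 0 ->
  ([set hnorm (T x) | x in [set x | hnorm x <= 1]] !=set0)%classic.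
Proof. by move=> T0; exists (hnorm (T 0)), 0 => //=; rewrite hnorm0. Qed.

Lemma bounded_opP (T : H -> K) : bounded_op T ->
  exists2 M : R, 0 <= M & forall x, hnorm (T x) <= M * hnorm x.
Proof.
move=> [M TM]; exists (Num.max 0 M) => [|x]; first by rewrite le_max lexx.
apply: le_trans (TM x) _; rewrite ler_wpM2r ?hnorm_ge0//.
by rewrite le_max lexx orbT.
Qed.

Lemma opnorm_ub (T : H -> K) : bounded_op T ->
  has_ubound [set hnorm (T x) | x in [set x | hnorm x <= 1]]%classic.
Proof.
move=> /bounded_opP[M M0 TM]; exists M => _ [x /= x1 <-].
by apply: le_trans (TM x) _; rewrite ler_piMr.
Qed.

Lemma opnorm_le_unit T x : bounded_op T -> hnorm x <= 1 -> hnorm (T x) <= opnorm T.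
Proof. by move=> bT x1; apply: ub_le_sup; [exact: opnorm_ub|exists x]. Qed.

Lemma opnorm_ge0 T : bounded_op T -> 0 <= opnorm T.
Proof.
move=> bT; have := opnorm_le_unit bT (x := 0); rewrite linear0 !hnorm0.
exact.
Qed.

Lemma opnormP T x : bounded_op T -> hnorm (T x) <= opnorm T * hnorm x.
Proof.
move=> bT; have [x0|x0] := eqVneq (hnorm x) 0.
  by rewrite x0 mulr0 (hnorm_eq0 x0) linear0 hnorm0.
have xp : 0 < hnorm x by rewrite lt_def x0 hnorm_ge0.
rewrite -ler_pdivrMr// mulrC.
have -> : (hnorm x)^-1 * hnorm (T x) = hnorm (T (rC R (hnorm x)^-1 *: x)).
  by rewrite linearZ/= hnormZ normc_rC ger0_norm// invr_ge0 ltW.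
apply: opnorm_le_unit => //.
by rewrite hnormZ normc_rC ger0_norm ?invr_ge0 ?(ltW xp)// mulVf.
Qed.

Lemma opnorm_le (T : H -> K) M : T 0 = 0 -> 0 <= M ->
  (forall x, hnorm (T x) <= M * hnorm x) -> opnorm T <= M.
Proof.
move=> T0 M0 TM; apply: ge_sup; first exact: opnorm_set0.
move=> _ [x /= x1 <-]; apply: le_trans (TM x) _.
by rewrite ler_piMr.
Qed.

Lemma lt_opnorm T t : t < opnorm T ->
  exists2 x, hnorm x <= 1 & t < hnorm (T x).
Proof.
move=> /sup_gt[]; first by apply: opnorm_set0; rewrite linear0.
by move=> _ [x /= x1 <-] tT; exists x.
Qed.

Lemma bounded_opB T F : bounded_op T -> bounded_op F -> bounded_op (T \- F).
Proof.
move=> [M TM] [N FN]; exists (M + N) => x; rewrite mulrDl.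
by apply: le_trans (hnormB_le _ _) _; exact: lerD.
Qed.

Lemma bounded_opD T F : bounded_op T -> bounded_op F -> bounded_op (T \+ F).
Proof.
move=> [M TM] [N FN]; exists (M + N) => x; rewrite mulrDl.
by apply: le_trans (hnormD_le _ _) _; exact: lerD.
Qed.

Lemma bounded_op0 : bounded_op (\0 : H -> K).
Proof. by exists 0 => x; rewrite mul0r /= hnorm0. Qed.

End OperatorNorm.

Lemma bounded_op_comp (R : realType) (H K L : hilbertType R)
    (T : {linear H -> K}) (U : {linear K -> L}) :
  bounded_op T -> bounded_op U -> bounded_op (U \o T).
Proof.
move=> bT bU; exists (opnorm U * opnorm T) => x /=.
apply: le_trans (opnormP _ bU) _; rewrite -mulrA ler_wpM2l ?opnorm_ge0//.
exact: opnormP.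
Qed.

Lemma bounded_proj (R : realType) (H : hilbertType R) (s : seq H)
    (Q : H -> H) : is_proj s Q -> bounded_op Q.
Proof. by move=> Qp; exists 1 => x; rewrite mul1r (proj_le Qp). Qed.

(** * Singular values *)

Section SingularValues.
Variables (R : realType) (H K : hilbertType R).
Implicit Types (T F : {linear H -> K}) (n : nat).

Lemma sing_val_set0 T n : (0 < n)%N ->
  ([set opnorm (fun x => T x - F x) |
     F in [set F : {linear H -> K} | bounded_op F /\ rank_lt F n]] !=set0)%classic.
Proof.
move=> n0; exists (opnorm (fun x => T x - (\0 : H -> K) x)); exists \0 => //=.
split; first exact: bounded_op0.
by exists [::]; split => // x; exists (fun=> 0); rewrite big_ord0.
Qed.

Lemma sing_val_lb T n : bounded_op T -> has_lbound
  [set opnorm (fun x => T x - F x) |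
     F in [set F : {linear H -> K} | bounded_op F /\ rank_lt F n]]%classic.
Proof.
move=> bT; exists 0 => _ [F [bF _] <-].
exact: opnorm_ge0 (bounded_opB bT bF).
Qed.

Lemma sing_val_le T F n M : bounded_op T -> bounded_op F -> rank_lt F n -> 0 <= M ->
  (forall x, hnorm (T x - F x) <= M * hnorm x) -> sing_val T n <= M.
Proof.
move=> bT bF rF M0 TF; apply: (@le_trans _ _ (opnorm (fun x => T x - F x))).
  by apply: ge_inf; [exact: sing_val_lb|exists F].
by apply: opnorm_le => //; rewrite linear0 (linear0 F) subr0.
Qed.

Lemma le_sing_val T n M : (0 < n)%N ->
  (forall F, bounded_op F -> rank_lt F n -> M <= opnorm (T \- F)) ->
  M <= sing_val T n.
Proof.
move=> n0 h; apply: lb_le_inf; first exact: sing_val_set0.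
by move=> _ [F [bF rF] <-]; exact: h.
Qed.

Lemma sing_val_lt T n t : (0 < n)%N -> sing_val T n < t ->
  exists F, [/\ bounded_op F, rank_lt F n & opnorm (T \- F) < t].
Proof.
move=> n0 /inf_lt[]; first exact: sing_val_set0.
by move=> _ [F [bF rF] <-] h; exists F.
Qed.

Lemma sing_val_ge0 T n : bounded_op T -> (0 < n)%N -> 0 <= sing_val T n.
Proof.
move=> bT n0; apply: le_sing_val => // F bF rF.
exact: opnorm_ge0 (bounded_opB bT bF).
Qed.

Lemma rank_lt_le (F : H -> K) m n : (m <= n)%N -> rank_lt F m -> rank_lt F n.
Proof. by move=> mn [s [sm sF]]; exists s; split => //; exact: leq_trans mn. Qed.

Lemma sing_val_mono T m n : bounded_op T -> (0 < m <= n)%N ->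
  sing_val T n <= sing_val T m.
Proof.
move=> bT /andP[m0 mn]; apply: le_sing_val => // F bF rF.
apply: (sing_val_le bT bF (rank_lt_le mn rF)).
  exact: opnorm_ge0 (bounded_opB bT bF).
move=> x; exact: opnormP (bounded_opB bT bF).
Qed.

(** The coordinates of the [F (e i)] form a matrix with [n] rows and fewer columns, hence with a
    nonzero left kernel. It is the coefficient vector that is nonzero, as [e] may be dependent. *)
Lemma rank_lt_ker F n (e : 'I_n -> H) : rank_lt F n ->
  exists2 a : 'I_n -> R[i], 0 < \sum_i normc (a i) ^+ 2 &
    F (\sum_i a i *: e i) = 0.
Proof.
move=> [s [sn sF]].
have /choice[c cF] (i : 'I_n) : exists c : nat -> R[i],
    F (e i) = \sum_(j < size s) c j *: s`_j by exact: sF.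
pose C : 'M[R[i]]_(n, size s) := \matrix_(i, j) c i j.
have : kermx C != 0.
  rewrite -mxrank_eq0 mxrank_ker -lt0n subn_gt0.
  exact: leq_ltn_trans (rank_leq_col C) sn.
move=> /rowV0Pn[v /sub_kermxP vC v0].
exists (v 0).
  have /rV0Pn[i vi] := v0.
  rewrite (bigD1 i)//= ltr_pwDl ?sumr_ge0//; last by move=> j _; exact: sqr_ge0.
  rewrite exprn_gt0// lt_def normc_ge0 andbT.
  by apply: contra vi => /eqP/eq0_normc->.
rewrite linear_sum; under eq_bigr do rewrite linearZ/= cF scaler_sumr.
rewrite exchange_big big1// => j _.
under eq_bigr do rewrite scalerA.
rewrite -scaler_suml (_ : \sum_i _ = 0) ?scale0r//.
have /matrixP/(_ 0 j) := vC; rewrite !mxE => vCj; rewrite -[RHS]vCj.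
by apply: eq_bigr => i _; rewrite mxE.
Qed.

(* Min-max: a space of dimension n on which T is bounded below meets the
   kernel of every operator of rank less than n. *)
Lemma le_sing_val_bessel T n (e : 'I_n -> H) t : bounded_op T -> (0 < n)%N ->
  0 <= t -> bessel e ->
  (forall a : 'I_n -> R[i], t ^+ 2 * \sum_i normc (a i) ^+ 2 <=
     hnorm (T (\sum_i a i *: e i)) ^+ 2) ->
  t <= sing_val T n.
Proof.
move=> bT n0 t0 be Te; apply: le_sing_val => // F bF rF.
have [a a0 Fa] := rank_lt_ker e rF.
have bTF := bounded_opB bT bF.
have o0 := opnorm_ge0 bTF.
rewrite -ler_sqr2// -(ler_pM2r a0) (le_trans (Te a))//.
have : hnorm (T (\sum_i a i *: e i)) <= opnorm (T \- F) * hnorm (\sum_i a i *: e i).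
  by rewrite -[T _]subr0 -Fa; exact: opnormP bTF.
rewrite -ler_sqr2 ?hnorm_ge0 ?mulr_ge0 ?hnorm_ge0// exprMn => h.
by apply: le_trans h _; rewrite ler_wpM2l ?sqr_ge0//; exact: be.
Qed.

(** Pythagoras in the image space supplies the lower bound required by min-max. *)
Lemma le_sing_val_orth T n (e : 'I_n -> H) t : bounded_op T -> (0 < n)%N ->
  0 <= t -> bessel e ->
  (forall i j, i != j -> hdot (T (e i)) (T (e j)) = 0) ->
  (forall i, t <= hnorm (T (e i))) -> t <= sing_val T n.
Proof.
move=> bT n0 t0 be oT tT; apply: (le_sing_val_bessel bT n0 t0 be) => a.
rewrite linear_sum; under [X in hnorm X]eq_bigr do rewrite linearZ/=.
rewrite orth_sum// mulr_sumr; apply: ler_sum => i _.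
by rewrite mulrC ler_wpM2l ?sqr_ge0// ler_sqr2 ?hnorm_ge0.
Qed.

(** [T \o Q] has its range in the span of [map T s]. This version produces near-maximal vectors
    orthogonal to [s] in the domain. *)
Lemma sing_val_projr T s (Q : {linear H -> H}) n : bounded_op T ->
  is_proj s Q -> (size s < n)%N ->
  sing_val T n <= opnorm (T \- (T \o Q)).
Proof.
move=> bT Qp sn; have bQ := bounded_proj Qp.
have bTQ := bounded_op_comp bQ bT.
apply: (sing_val_le bT bTQ).
- exists (map T s); rewrite size_map; split => // x.
  have [c cE] := Qp.1 x; exists c => /=; rewrite cE linear_sum.
  by apply: eq_bigr => i _; rewrite linearZ/= (nth_map 0).
- exact: opnorm_ge0 (bounded_opB bT bTQ).
- by move=> x; exact: opnormP (bounded_opB bT bTQ).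
Qed.

(** The counterpart in the target space: it produces vectors whose images are far from the span of
    [s]. *)
Lemma sing_val_projl T s (Q : {linear K -> K}) n : bounded_op T ->
  is_proj s Q -> (size s < n)%N ->
  sing_val T n <= opnorm (T \- (Q \o T)).
Proof.
move=> bT Qp sn; have bQ := bounded_proj Qp.
have bQT := bounded_op_comp bT bQ.
apply: (sing_val_le bT bQT).
- by exists s; split => // x; exact: Qp.1.
- exact: opnorm_ge0 (bounded_opB bT bQT).
- by move=> x; exact: opnormP (bounded_opB bT bQT).
Qed.

End SingularValues.

(** * Lower bound for the norm on the Fock space *)

Section WedgeNorm.
Variables (R : realType) (H : hilbertType R).
Implicit Types (v : H) (s : seq H).

Lemma wedge_normKC s : rC R (hnorm (wedge s) ^+ 2) =
  \det (\matrix_(i < size s, j < size s) hdot s`_i s`_j).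
Proof. by rewrite hnormKC wedge_dot eqxx mul1r. Qed.

Lemma wedge_nil_norm : hnorm (wedge ([::] : seq H)) = 1.
Proof.
apply/eqP; rewrite -(@eqrXn2 _ 2) ?hnorm_ge0// expr1n; apply/eqP/rC_inj.
by rewrite wedge_normKC det_mx00 rmorph1.
Qed.

(* Row-reducing the Gram matrix of [v :: s] replaces [v] by its component
   orthogonal to the span of [s]. *)
Lemma wedge_cons_norm v s (Q : {linear H -> H}) : is_proj s Q ->
  hnorm (wedge (v :: s)) = hnorm (v - Q v) * hnorm (wedge s).
Proof.
move=> Qp; apply/eqP; rewrite -(@eqrXn2 _ 2) ?mulr_ge0 ?hnorm_ge0//.
rewrite exprMn; apply/eqP/rC_inj.
rewrite (wedge_normKC (v :: s)).
rewrite (rmorphM (rC R) (hnorm (v - Q v) ^+ 2)).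
rewrite (wedge_normKC s).
rewrite (hnormKC (v - Q v)).
set u := v - Q v; have [c cE] := Qp.1 v.
have vE w : hdot v w = hdot u w + \sum_(k < size s) c k * hdot s`_k w.
  have -> : hdot v w = hdot u w + hdot (Q v) w by rewrite -hdotDl subrK.
  rewrite cE hdot_suml; congr (_ + _).
  by apply: eq_bigr => k _; rewrite hdotZl.
have uo w : in_span s w -> hdot u w = 0.
  by move=> sw; apply: hdotC0; exact: (proj_orth Qp).
pose G : 'M_(size s) := \matrix_(i, j) hdot s`_i s`_j.
pose L : 'M_(1 + size s) := block_mx 1%:M (\row_k c k) 0 1%:M.
pose B : 'M_(1 + size s) :=
  block_mx (hdot u u)%:M 0 (\col_k hdot s`_k v) G.
have ML : \matrix_(i < (1 + size s)%N, j < (1 + size s)%N)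
    hdot (v :: s)`_i (v :: s)`_j = L *m B.
  have rsh (k : 'I_(size s)) : (v :: s)`_(rshift 1 k) = s`_k by [].
  have lsh : (v :: s)`_(lshift (size s) (0 : 'I_1)) = v by [].
  rewrite mulmx_block !mul1mx !mul0mx !add0r; apply/matrixP => i j.
  case: (split_ordP i) => i' ->; case: (split_ordP j) => j' ->.
  - rewrite block_mxEul !mxE !ord1 lsh vE eqxx mulr1n.
    have -> : hdot u v = hdot u u + hdot u (Q v) by rewrite -hdotDr subrK.
    rewrite [hdot u (Q v)]uo ?addr0; last exact: Qp.1.
    by congr (_ + _); apply: eq_bigr => k _; rewrite !mxE.
  - rewrite block_mxEur !mxE !ord1 rsh lsh vE [hdot u _]uo; last first.
      by apply: in_span_mem; rewrite mem_nth.
    by rewrite add0r; apply: eq_bigr => k _; rewrite !mxE.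
  - by rewrite block_mxEdl !mxE !ord1 rsh lsh.
  - by rewrite block_mxEdr !mxE !rsh.
rewrite (_ : \det _ = \det (L *m B)); last by rewrite -ML.
by rewrite det_mulmx det_ublock !det1 !mul1r det_lblock det_scalar1.
Qed.

(** Each factor of the norm is that of an orthogonal component, hence at most the norm of the
    vector. *)
Lemma hadamard s : hnorm (wedge s) <= \prod_(v <- s) hnorm v.
Proof.
elim: s => [|v s IH]; first by rewrite big_nil wedge_nil_norm.
have [Q Qp] := projection_exists s.
rewrite big_cons (wedge_cons_norm v Qp) ler_pM ?hnorm_ge0//.
exact: (projC_le Qp).
Qed.

End WedgeNorm.

Section LowerBound.
Variables (R : realType) (H K : hilbertType R) (T : {linear H -> K}).
Hypothesis bT : bounded_op T.

(** The threshold varies in the induction: the first [N] vectors must beat [t / s], and the new one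
    supplies the missing factor. The strict inequality leaves room for suprema that are not
    attained. *)
Lemma wedge_greedy N t : 0 <= t -> t < \prod_(1 <= n < N.+1) sing_val T n ->
  exists v : seq H, [/\ size v = N, (forall x, x \in v -> hnorm x <= 1) &
    t < hnorm (wedge (map T v))].
Proof.
elim: N t => [|N IH] t t0.
  rewrite big_geq// => t1; exists [::]; split => //.
  by rewrite wedge_nil_norm.
rewrite big_nat_recr//=; set s := sing_val T N.+1 => ts.
have s0 : 0 <= s by exact: sing_val_ge0.
have sp : 0 < s.
  rewrite lt_def s0 andbT; apply/eqP => s00; move: ts.
  by rewrite s00 mulr0 ltNge t0.
have [||v [sv v1 tv]] := IH (t / s); first by rewrite divr_ge0.
  by rewrite ltr_pdivrMr.
have w0 : 0 < hnorm (wedge (map T v)) by apply: le_lt_trans tv; rewrite divr_ge0.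
have [Q Qp] := projection_exists (map T v).
have bQT := bounded_op_comp bT (bounded_proj Qp).
have : t / hnorm (wedge (map T v)) < opnorm (T \- (Q \o T)).
  apply: lt_le_trans (sing_val_projl (n := N.+1) bT Qp _); last first.
    by rewrite size_map sv.
  by rewrite ltr_pdivrMr// mulrC -ltr_pdivrMr.
move=> /lt_opnorm[x x1 tx]; exists (x :: v); split => /=.
- by rewrite sv.
- by move=> y; rewrite inE => /orP[/eqP->//|/v1].
- by rewrite (wedge_cons_norm _ Qp) -ltr_pdivrMr.
Qed.

Lemma prod_sing_val_le M N :
  (forall x y, Lambda_graph T x y -> hnorm y <= M * hnorm x) ->
  \prod_(1 <= n < N.+1) sing_val T n <= M.
Proof.
(* The vacuum vector, which is mapped to the vacuum vector, forces this. *)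
move=> hM; have M1 : 1 <= M.
  have := hM _ _ (Lambda_graph_wedge T [::]).
  by rewrite !wedge_nil_norm mulr1.
rewrite leNgt; apply/negP => /(wedge_greedy (le_trans ler01 M1)).
move=> [v [_ v1]]; rewrite ltNge => /negP; apply.
apply: le_trans (hM _ _ (Lambda_graph_wedge T v)) _.
rewrite ler_piMr ?(le_trans ler01)//; apply: le_trans (hadamard v) _.
elim: v v1 => [|x v IH] v1; first by rewrite big_nil.
rewrite big_cons mulr_ile1 ?hnorm_ge0 ?prodr_ge0//.
- by move=> i _; exact: hnorm_ge0.
- by rewrite v1// mem_head.
- by apply: IH => y yv; rewrite v1// inE yv orbT.
Qed.

Lemma prod_max_sing_val_le M N :
  (forall x y, Lambda_graph T x y -> hnorm y <= M * hnorm x) ->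
  \prod_(1 <= n < N.+1) Num.max 1 (sing_val T n) <= M.
Proof.
move=> hM; elim: N => [|N IH].
  by have := prod_sing_val_le 0 hM; rewrite !big_geq.
have [s1|s1] := leP (sing_val T N.+1) 1.
  by rewrite big_nat_recr//= (max_idPl s1) mulr1.
rewrite (eq_big_nat _ _ (F2 := sing_val T)); first exact: prod_sing_val_le.
move=> n /andP[n0 nN]; apply/max_idPr/ltW/(lt_le_trans s1).
by apply: sing_val_mono => //; rewrite n0.
Qed.

End LowerBound.

(** * Upper bound for the norm on the Fock space *)

Section Frames.
Variables (R : realType) (H K : hilbertType R).

(** The frame operator. It is self-adjoint, so when idempotent it is the orthogonal projection onto
    the span of [e], and [e] is a Parseval frame there. This property survives unitary rotations of
    [e]. *)
Definition frame_op (I : finType) (e : I -> H) (x : H) : H :=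
  \sum_i hdot x (e i) *: e i.

Lemma frame_op_adj (I : finType) (e : I -> H) x y :
  hdot (frame_op e x) y = hdot x (frame_op e y).
Proof.
rewrite hdot_suml hdot_sumr; apply: eq_bigr => i _.
by rewrite hdotZl hdotZr -hdotC mulrC.
Qed.

Lemma frame_dot (I : finType) (e : I -> H) x y :
  hdot (frame_op e x) y = \sum_i hdot x (e i) * hdot (e i) y.
Proof. by rewrite hdot_suml; apply: eq_bigr => i _; rewrite hdotZl. Qed.

(** For a self-adjoint idempotent, [S = hdot (frame_op e x) x] is also the squared norm of
    [frame_op e x], and Cauchy-Schwarz concludes. *)
Lemma bessel_frame (I : finType) (e : I -> H) :
  (forall x, frame_op e (frame_op e x) = frame_op e x) -> bessel e.
Proof.
move=> idem; apply: le_bessel => x; set S := \sum_i _.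
have S0 : 0 <= S by apply: sumr_ge0 => i _; exact: sqr_ge0.
have SE : hdot (frame_op e x) x = rC R S by exact: hdot_sum.
have QS : hnorm (frame_op e x) ^+ 2 = S.
  by apply: rC_inj; rewrite hnormKC -frame_op_adj idem.
have := hdot_CS (frame_op e x) x; rewrite SE normc_rC ger0_norm//.
rewrite -ler_sqr2 ?mulr_ge0 ?hnorm_ge0// exprMn QS => h.
move: S0; rewrite le_eqVlt => /orP[/eqP<-|S0]; first exact: sqr_ge0.
by rewrite -(ler_pM2l S0) -expr2.
Qed.

Lemma bessel_frame_norm (I : finType) (e : I -> H) i : bessel e -> hnorm (e i) <= 1.
Proof.
move=> be; have := be (fun j => (j == i)%:R).
rewrite (bigD1 i)//= eqxx scale1r big1 ?addr0; last first.
  by move=> j /negPf->; rewrite scale0r.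
rewrite (bigD1 i)//= eqxx big1 ?addr0; last first.
  by move=> j /negPf->; rewrite normc0 expr0n.
by rewrite normc1 expr1n expr_le1 ?hnorm_ge0.
Qed.

Lemma bessel_sub (I : finType) (e : I -> H) (A : {set I}) : bessel e ->
  bessel (fun i : 'I_#|A| => e (enum_val i)).
Proof.
move=> be; apply: le_bessel => x; apply: le_trans (bessel_le be x).
rewrite -(big_enum_val (A := mem A) (fun i => normc (hdot x (e i)) ^+ 2))/=.
rewrite [leRHS](bigID (mem A))/= lerDl; apply: sumr_ge0 => i _.
exact: sqr_ge0.
Qed.

(** The list given by [gram_schmidt] reproduces its own members as well as those of [s]; the former
    makes the frame operator idempotent. *)
Lemma frame_exists (s : seq H) : exists d (e : 'I_d -> H),
  (forall x, frame_op e (frame_op e x) = frame_op e x) /\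
  (forall x, x \in s -> frame_op e x = x).
Proof.
have [e eP] := gram_schmidt hdot s.
have feE x : frame_op (fun i : 'I_(size e) => e`_i) x = \sum_(a <- e) hdot x a *: a.
  by rewrite (big_nth 0) big_mkord.
exists (size e), (fun i => e`_i); split => [x|x xs].
  rewrite {1}/frame_op {2}/frame_op; under eq_bigr do rewrite frame_dot scaler_suml.
  rewrite exchange_big; apply: eq_bigr => i _.
  under eq_bigr do rewrite -scalerA.
  by rewrite -scaler_sumr -[\sum_j _]/(frame_op _ _) feE -eP// mem_cat mem_nth.
by rewrite feE -eP// mem_cat xs orbT.
Qed.

(* Rotating a frame by a unitary matrix leaves its frame operator unchanged;
   the spectral theorem provides a rotation which diagonalizes the form. *)
Lemma frame_diag d (e : 'I_d -> H) (S U : {linear H -> K}) :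
  (forall x y, hdot (S y) (U x) = (hdot (S x) (U y))^*) ->
  exists e' : 'I_d -> H,
  [/\ forall x, frame_op e' x = frame_op e x,
      forall i j, i != j -> hdot (S (e' i)) (U (e' j)) = 0 &
      \sum_i hdot (S (e' i)) (U (e' i)) = \sum_i hdot (S (e i)) (U (e i))].
Proof.
move=> herm; pose M : 'M[R[i]]_d := \matrix_(a, b) hdot (S (e a)) (U (e b)).
have Mh : M \is hermsymmx.
  apply/is_hermitianmxP; rewrite expr0 scale1r; apply/matrixP => a b.
  by rewrite !mxE herm.
have /orthomx_spectralP := hermitian_normalmx Mh.
set V := spectralmx M; set D := spectral_diag M.
have Vu : V \is unitarymx := spectral_unitarymx M.
rewrite invmx_unitary// => MD.
have VV : V *m (map_mx Num.conj V^T) = 1%:M by apply/unitarymxP.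
have VV' : (map_mx Num.conj V^T) *m V = 1%:M by apply: mulmx1C.
have VMV : V *m M *m (map_mx Num.conj V^T) = diag_mx D.
  by rewrite MD !mulmxA VV mul1mx -mulmxA VV mulmx1.
pose e' j := \sum_a V j a *: e a.
have e'E i j : hdot (S (e' i)) (U (e' j)) = (V *m M *m (map_mx Num.conj V^T)) i j.
  rewrite /e' (linear_sum S) (linear_sum U) hdot_sumr mxE; apply: eq_bigr => b _.
  rewrite linearZ/= hdotZr !mxE mulrC; congr (_ * _).
  rewrite hdot_suml; apply: eq_bigr => a _.
  by rewrite linearZ/= hdotZl !mxE.
exists e'; split.
- move=> x.
  (* The columns of [V] are orthonormal as well as its rows, which collapses the double sum over [a]
     and [b] to the diagonal. *)
  have cE a b : \sum_j hdot x (V j a *: e a) * V j b = hdot x (e a) * (a == b)%:R.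
    have := congr1 (fun X : 'M[R[i]]_d => X a b) VV'; rewrite !mxE => <-.
    by rewrite mulr_sumr; apply: eq_bigr => j _; rewrite hdotZr !mxE; ring.
  rewrite /frame_op.
  under eq_bigr => j _.
    rewrite {1}/e' hdot_sumr {1}/e' scaler_sumr.
    under eq_bigr do rewrite scalerA mulr_suml scaler_suml.
    over.
  rewrite exchange_big/=; under eq_bigr do rewrite exchange_big/=.
  rewrite exchange_big/=; apply: eq_bigr => a _.
  rewrite (bigD1 a)//= [X in _ + X]big1 ?addr0 => [|b ba].
    by rewrite -scaler_suml cE eqxx mulr1.
  by rewrite -scaler_suml cE eq_sym (negPf ba) mulr0 scale0r.
- by move=> i j ij; rewrite e'E VMV mxE (negPf ij) mulr0n.
under eq_bigr do rewrite e'E.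
rewrite -/(mxtrace _) mxtrace_mulC mulmxA VV' mul1mx.
by apply: eq_bigr => i _; rewrite mxE.
Qed.

End Frames.

Section WedgeExpansion.
Variables (R : realType) (H K : hilbertType R) (d : nat).
Variables (e : 'I_d -> H) (w : 'I_d -> R) (T : {linear H -> K}).
Implicit Types v u : seq H.

(** The inner product of [wedge v] with the wedge of the word [e (f 0), ..., e (f (n - 1))];
    different degrees are orthogonal. *)
Definition wedge_coef n (f : {ffun 'I_n -> 'I_d}) v : R[i] :=
  (size v == n)%:R * \det (\matrix_(i < n, j < n) hdot v`_i (e (f j))).

(** A repeated letter gives two equal columns. *)
Lemma wedge_coef_noninj n (f : {ffun 'I_n -> 'I_d}) v :
  ~~ injectiveb f -> wedge_coef f v = 0.
Proof.
move=> /injectivePn[i [j ij fij]]; rewrite /wedge_coef -det_tr.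
rewrite (determinant_alternate ij) ?mulr0// => k.
by rewrite !mxE fij.
Qed.

Lemma wedge_map_dot N v u : (size v < N)%N ->
  (forall x y, x \in v -> y \in u -> hdot (T x) (T y) =
     \sum_a rC R (w a) * (hdot x (e a) * hdot (e a) y)) ->
  hdot (wedge (map T v)) (wedge (map T u)) =
  \sum_(n < N) (n`!%:R)^-1 * \sum_(f : {ffun 'I_n -> 'I_d})
    rC R (\prod_j w (f j)) * (wedge_coef f v * (wedge_coef f u)^*).
Proof.
move=> vN Tvu; rewrite wedge_dot !size_map (bigD1 (Ordinal vN))//=.
rewrite [X in _ + X]big1 ?addr0; last first.
  move=> n /eqP/val_eqP/= nv; rewrite big1 ?mulr0// => f _.
  by rewrite /wedge_coef eq_sym (negPf nv) !mul0r mulr0.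
have [vu|vu] := eqVneq (size v) (size u); last first.
  rewrite mul0r big1 ?mulr0// => f _.
  by rewrite /wedge_coef [size u == _]eq_sym (negPf vu) mul0r rmorph0 !mulr0.
rewrite mul1r vu; set n := size u.
have n0 : n`!%:R != 0 :> R[i] by rewrite pnatr_eq0 -lt0n fact_gt0.
apply: (mulfI n0); rewrite mulrA mulfV// mul1r.
pose A : 'M_(n, d) := \matrix_(i, a) hdot v`_i (e a).
pose B : 'M_(d, n) := \matrix_(a, j) (rC R (w a) * hdot (e a) u`_j).
rewrite (_ : \matrix_(i, j) _ = A *m B); last first.
  apply/matrixP => i j; rewrite !mxE !(nth_map 0) ?vu// Tvu ?mem_nth ?vu//.
  by apply: eq_bigr => a _; rewrite !mxE; ring.
rewrite cauchy_binet; apply: eq_bigr => f _.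
rewrite /wedge_coef vu eqxx !mul1r.
have -> : \det (colsub f A) = \det (\matrix_(i < n, j < n) hdot v`_i (e (f j))).
  by congr (\det _); apply/matrixP => i j; rewrite !mxE.
rewrite (_ : rowsub f B = diag_mx (\row_j rC R (w (f j))) *m
    map_mx Num.conj (\matrix_(i < n, j < n) hdot u`_i (e (f j)))^T); last first.
  by apply/matrixP => i j; rewrite mul_diag_mx !mxE -hdotC.
rewrite det_mulmx det_diag det_map_mx det_tr rmorph_prod mulrCA.
by under eq_bigr do rewrite mxE.
Qed.

(** The weights depend only on the word, so the coefficients of all terms can be added before the
    modulus is squared. *)
Lemma wedge_sum_norm N (s : seq (R[i] * seq H)) :
  (forall p, p \in s -> (size p.2 < N)%N) ->
  (forall p q, p \in s -> q \in s -> forall x y, x \in p.2 -> y \in q.2 ->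
     hdot (T x) (T y) = \sum_a rC R (w a) * (hdot x (e a) * hdot (e a) y)) ->
  hnorm (\sum_(p <- s) p.1 *: wedge (map T p.2)) ^+ 2 =
  \sum_(n < N) (n`!%:R)^-1 * \sum_(f : {ffun 'I_n -> 'I_d})
    (\prod_j w (f j)) * normc (\sum_(p <- s) p.1 * wedge_coef f p.2) ^+ 2.
Proof.
move=> sN sT; apply: (@rC_inj R); rewrite hnormKC hdot_suml.
transitivity (\sum_(p <- s) \sum_(q <- s) \sum_(n < N) \sum_(f : {ffun 'I_n -> 'I_d})
    (n`!%:R)^-1 * (rC R (\prod_j w (f j)) *
      (p.1 * wedge_coef f p.2 * (q.1 * wedge_coef f q.2)^*))).
  apply: eq_big_seq => p ps; rewrite hdot_sumr.
  apply: eq_big_seq => q qs; rewrite hdotZl hdotZr.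
  rewrite (wedge_map_dot (sN p ps) (sT p q ps qs)) mulrA mulr_sumr.
  apply: eq_bigr => n _; rewrite !mulr_sumr; apply: eq_bigr => f _.
  rewrite (rmorphM _ q.1)/=; move: (rC R _) (_^-1) => b a; ring.
under eq_bigr do rewrite exchange_big/=.
rewrite exchange_big rmorph_sum/=; apply: eq_bigr => n _.
under eq_bigr do rewrite exchange_big/=.
rewrite exchange_big rmorphM fmorphV rmorph_nat rmorph_sum mulr_sumr/=.
apply: eq_bigr => f _.
rewrite (rmorphM (rC R) (\prod_j w (f j))) normcKC rmorph_sum big_distrlr/=.
rewrite !mulr_sumr; apply: eq_bigr => p _; rewrite !mulr_sumr.
by apply: eq_bigr => q _.
Qed.

End WedgeExpansion.

Section UpperBound.
Variables (R : realType) (H K : hilbertType R) (T : {linear H -> K}).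
Hypothesis bT : bounded_op T.

(** Removing the index of least image norm at each step avoids sorting: that norm is compared with
    the singular value of index [#|A|]. *)
Lemma orth_prod_le (I : finType) (e : I -> H) (A : {set I}) :
  bessel e -> (forall i j, i != j -> hdot (T (e i)) (T (e j)) = 0) ->
  \prod_(i in A) hnorm (T (e i)) <= \prod_(1 <= n < #|A|.+1) sing_val T n.
Proof.
move=> be oT; have [m] := ubnP #|A|; elim: m A => // m IH A Am.
have [->|[i0 i0A]] := set_0Vmem A; first by rewrite big_set0 cards0 big_geq.
have [i iA imin] := Order.TotalTheory.arg_minP (fun i => hnorm (T (e i))) i0A.
have {}iA : i \in A by [].
have cA : #|A| = #|A :\ i|.+1 by rewrite (cardsD1 i) iA.
rewrite (big_setD1 i iA)/= cA big_nat_recr//= mulrC.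
apply: ler_pM; rewrite ?hnorm_ge0//.
- by apply: prodr_ge0 => j _; exact: hnorm_ge0.
- by apply: IH; rewrite -ltnS -cA.
rewrite -cA; apply: (le_sing_val_orth bT (e := fun j : 'I_#|A| => e (enum_val j))).
- by rewrite cA.
- exact: hnorm_ge0.
- exact: bessel_sub.
- by move=> j k jk; apply: oT; rewrite (inj_eq enum_val_inj).
- by move=> j; apply: imin; exact: enum_valP.
Qed.

Lemma Lambda_bounded L :
  (forall N, \prod_(1 <= n < N.+1) Num.max 1 (sing_val T n) <= L) ->
  forall x y, Lambda_graph T x y -> hnorm y <= L * hnorm x.
Proof.
move=> TL _ _ [s [-> ->]].
have L0 : 0 <= L by apply: le_trans (TL 0%N); rewrite big_geq.
have [d [e0 [idem0 fix0]]] := frame_exists (flatten [seq p.2 | p <- s]).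
have [e [eE oT _]] := @frame_diag _ _ _ d e0 T T (fun x y => hdotC _ _).
have efix p x : p \in s -> x \in p.2 -> frame_op e x = x.
  by move=> ps xp; rewrite eE fix0//; apply/flatten_mapP; exists p.
have be : bessel e by apply: bessel_frame => x; rewrite !eE.
pose N := (\max_(p <- s) size p.2).+1.
have sN p : p \in s -> (size p.2 < N)%N.
  by move=> ps; rewrite ltnS /= (@leq_bigmax_seq _ s xpredT (fun p => size p.2)).
(* Both norms expand over the same words: with weights [hnorm (T (e a)) ^+ 2] for the image, and
   with weights 1 and the identity operator for the vector itself. *)
have yE := @wedge_sum_norm _ _ _ d e (fun a => hnorm (T (e a)) ^+ 2) T N s sN.
have xE := @wedge_sum_norm _ _ _ d e (fun=> 1) idfun N s sN.
rewrite -ler_sqr2 ?mulr_ge0 ?hnorm_ge0// exprMn {}yE; last first.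
  move=> p q ps qs x y xp yq; rewrite -{1}(efix _ _ ps xp) -{1}(efix _ _ qs yq).
  rewrite /frame_op !(linear_sum T) hdot_suml; apply: eq_bigr => a _.
  rewrite linearZ/= hdotZl hdot_sumr (bigD1 a)//= big1 ?addr0.
    by rewrite linearZ/= hdotZr -hdotC hnormKC; ring.
  by move=> b ba; rewrite linearZ/= hdotZr oT ?mulr0// eq_sym.
have {}xE : hnorm (\sum_(p <- s) p.1 *: wedge p.2) ^+ 2 =
    \sum_(n < N) (n`!%:R)^-1 * \sum_(f : {ffun 'I_n -> 'I_d})
    (\prod_(j < n) 1) * normc (\sum_(p <- s) p.1 * wedge_coef e f p.2) ^+ 2.
  rewrite -xE => [|p q ps qs x y xp yq /=].
    by congr (hnorm _ ^+ 2); apply: eq_bigr => p _; rewrite map_id.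
  rewrite -{1}(efix _ _ ps xp) frame_dot; apply: eq_bigr => a _.
  by rewrite rmorph1 mul1r.
rewrite {}xE mulr_sumr; apply: ler_sum => n _.
rewrite mulrCA ler_wpM2l ?invr_ge0 ?ler0n// mulr_sumr; apply: ler_sum => f _.
rewrite big1_eq mul1r.
(* Words with repetitions have coefficient zero; the others are products over a set of indices,
   whose cardinal selects the partial product. *)
have [fi|nfi] := boolP (injectiveb f); last first.
  rewrite [X in normc X]big1 ?normc0 ?expr0n ?mulr0// => p _.
  by rewrite wedge_coef_noninj// mulr0.
rewrite ler_wpM2r ?sqr_ge0// prodrXl ler_sqr2//; last first.
  by apply: prodr_ge0 => j _; exact: hnorm_ge0.
apply: le_trans (TL #|[set f i | i : 'I_n]|).
rewrite (_ : \prod_(j < n) _ = \prod_(a in [set f i | i : 'I_n]) hnorm (T (e a))).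
  apply: le_trans (orth_prod_le _ be oT) _.
  rewrite !big_nat; apply: ler_prod => k /andP[k0 _].
  by rewrite sing_val_ge0//= le_max lexx orbT.
rewrite big_imset/=; last by move=> i j _ _; exact/injectiveP.
by apply: eq_bigl.
Qed.

End UpperBound.

(** * Trace class perturbations of contractions *)

Section PositiveOperators.
Variables (R : realType) (H : hilbertType R) (P : {linear H -> H}).
Hypothesis P_ge0 : forall x, 0 <= hdot (P x) x.

(** Polarization: the form is real at [x], [y], [x + y] and [x + i y]. Thus the positivity in
    [is_abs] entails self-adjointness. *)
Lemma pos_herm x y : hdot (P y) x = (hdot (P x) y)^*.
Proof.
have := P_ge0 (x + y); have := P_ge0 (x + 'i%C *: y).
have := P_ge0 x; have := P_ge0 y.
rewrite !(linearD P) (linearZZ P) !hdotDl !hdotDr !hdotZl !hdotZr !ge0CE !conjE.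
case: (hdot (P x) x) => ? ?; case: (hdot (P y) y) => ? ?.
case: (hdot (P x) y) => a b; case: (hdot (P y) x) => c d /=.
move=> /andP[_ /eqP->] /andP[_ /eqP->] /andP[_ /eqP h1] /andP[_ /eqP h2].
by apply/eqP; rewrite eq_complex/=; apply/andP; split; apply/eqP; lra.
Qed.

Lemma Re_pos_ge0 x : 0 <= complex.Re (hdot (P x) x).
Proof. by have := P_ge0 x; rewrite ge0CE => /andP[]. Qed.

Lemma pos_amgm x y : 2 * complex.Re (hdot (P x) y) <=
  complex.Re (hdot (P x) x) + complex.Re (hdot (P y) y).
Proof.
have := Re_pos_ge0 (x - y).
rewrite (linearB P) hdotBl !hdotBr (pos_herm x y) conjE.
by case: (hdot (P x) y) => a b; rewrite !raddfB/=; lra.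
Qed.

(** Once the frame is rotated to diagonalize [P], the left side weighs the diagonal entry at [e' j]
    by [\sum_k normc (hdot (g k) (e' j)) ^+ 2], at most 1 by Bessel. The rotation preserves the
    trace on the right. *)
Lemma frame_trace d n (e : 'I_d -> H) (g : 'I_n -> H) :
  (forall x, frame_op e (frame_op e x) = frame_op e x) -> bessel g ->
  \sum_k complex.Re (hdot (P (frame_op e (g k))) (frame_op e (g k))) <=
  \sum_a complex.Re (hdot (P (e a)) (e a)).
Proof.
move=> idem bg.
have [e' [e'E oe' tre']] := frame_diag e (U := idfun) pos_herm.
have be' : bessel e' by apply: bessel_frame => x; rewrite !e'E.
have := congr1 (@complex.Re R) tre'; rewrite !raddf_sum/= => <-.
rewrite (eq_bigr (fun k => \sum_j normc (hdot (g k) (e' j)) ^+ 2 *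
    complex.Re (hdot (P (e' j)) (e' j)))); last first.
  move=> k _; rewrite -e'E /frame_op (linear_sum P) hdot_suml raddf_sum.
  apply: eq_bigr => j _; rewrite linearZ/= hdotZl hdot_sumr (bigD1 j)//= big1.
    rewrite addr0 hdotZr mulrA -normcKC.
    by case: (hdot (P _) _) => a b; rewrite /rC /=; ring.
  by move=> i ij; rewrite hdotZr [hdot (P _) _]oe' ?mulr0// eq_sym.
rewrite exchange_big/=; apply: ler_sum => j _; rewrite -mulr_suml ler_piMl ?Re_pos_ge0//.
under eq_bigr do rewrite hdotC normc_conj.
apply: le_trans (bessel_le bg _) _.
by rewrite expr_le1 ?hnorm_ge0// bessel_frame_norm.
Qed.

Hypothesis bP : bounded_op P.

Lemma pos_approx x y d : hnorm x <= 1 -> hnorm y <= 1 -> hnorm (x - y) <= d ->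
  complex.Re (hdot (P x) x) <=
  complex.Re (hdot (P y) y) + 2 * opnorm P * d.
Proof.
move=> x1 y1 xyd.
have P0 := opnorm_ge0 bP.
have d0 : 0 <= d by apply: le_trans xyd; exact: hnorm_ge0.
have -> : hdot (P x) x = hdot (P y) y + (hdot (P (x - y)) x + hdot (P y) (x - y)).
  by rewrite (linearB P) hdotBl hdotBr; ring.
rewrite raddfD/= lerD2l; apply: le_trans (ler_norm _) _.
apply: le_trans (Re_le_normc _) _; apply: le_trans (normcD_le _ _) _.
rewrite -mulrA mulrC mulr_natr mulr2n; apply: lerD.
  apply: le_trans (hdot_CS _ _) _; rewrite -[leRHS]mulr1.
  apply: ler_pM; rewrite ?hnorm_ge0//; apply: le_trans (opnormP _ bP) _.
  by rewrite ler_wpM2l.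
apply: le_trans (hdot_CS _ _) _.
apply: ler_pM; rewrite ?hnorm_ge0//; apply: le_trans (opnormP _ bP) _.
by rewrite ler_piMr.
Qed.

End PositiveOperators.

Lemma frame_proj (R : realType) (H : hilbertType R) (s : seq H) :
  (forall i j : 'I_(size s), hdot s`_i s`_j = (i == j)%:R) ->
  is_proj s (frame_op (fun i : 'I_(size s) => s`_i)).
Proof.
move=> os; split => [x|x z zs].
  by apply/in_spanP; exists (fun i => hdot x s`_i).
have zi : (index z s < size s)%N by rewrite index_mem.
have -> : z = s`_(Ordinal zi) by rewrite /= nth_index.
rewrite hdotBr hdot_sumr (bigD1 (Ordinal zi))//= big1 ?addr0.
  have := os (Ordinal zi) (Ordinal zi); rewrite eqxx /= => zz.
  by rewrite hdotZr zz mulr1 -hdotC subrr.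
move=> i ij; rewrite hdotZr.
by have := os (Ordinal zi) i; rewrite eq_sym (negPf ij) /= => ->; rewrite mulr0.
Qed.

Section TraceBound.
Variables (R : realType) (H : hilbertType R) (P : {linear H -> H}) (B : set H).
Hypothesis P_ge0 : forall x, 0 <= hdot (P x) x.
Hypothesis bP : bounded_op P.
Hypothesis oB : orthonormal_basis B.

(** Each [g k] is replaced by its projection onto the span of finitely many basis vectors, where
    [frame_trace] applies. The additive 1 pays for the replacement. *)
Lemma trace_bessel t :
  (forall s : seq H, uniq s -> (forall b, b \in s -> B b) ->
     \sum_(b <- s) complex.Re (hdot (P b) b) <= t) ->
  forall n (g : 'I_n -> H), bessel g ->
  \sum_k complex.Re (hdot (P (g k)) (g k)) <= t + 1.
Proof.
move=> Bt n g bg; have p0 := opnorm_ge0 bP.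
have c0 : 0 < 2 * opnorm P * n%:R + 1.
  by rewrite ltr_wpDl// !mulr_ge0// ler0n.
(* Each of the [n] replacements costs [2 * opnorm P * dl], in total at most 1. *)
pose dl := (2 * opnorm P * n%:R + 1)^-1.
have dl0 : 0 < dl by rewrite invr_gt0.
have /choice[c cP] (k : 'I_n) := oB.2 (g k) dl dl0.
pose s := undup (flatten [seq [seq p.2 | p <- c k] | k <- enum 'I_n]).
have mems k p : p \in c k -> p.2 \in s.
  move=> pc; rewrite mem_undup; apply/flatten_mapP; exists k.
    by rewrite mem_enum.
  by apply/mapP; exists p.
have sB b : b \in s -> B b.
  rewrite mem_undup => /flatten_mapP[k _ /mapP[p pc ->]].
  exact: (cP k).1.
have os (i j : 'I_(size s)) : hdot s`_i s`_j = (i == j)%:R.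
  rewrite (oB.1 _ _ (sB _ (mem_nth 0 (ltn_ord i))) (sB _ (mem_nth 0 (ltn_ord j)))).
  by rewrite nth_uniq ?undup_uniq.
have Qp := frame_proj os; set e := (fun i : 'I_(size s) => s`_i) in Qp.
have gQ k : hnorm (g k - frame_op e (g k)) <= dl.
  apply: le_trans (proj_best Qp _ (y := \sum_(p <- c k) p.1 *: p.2) _) _.
    have : {subset c k <= c k} by [].
    elim: {1 3}(c k) => [|p r IH] pr; first by rewrite big_nil; exact: in_span0.
    rewrite big_cons; apply: in_spanD.
      by apply/in_spanZ/in_span_mem/mems/pr; rewrite mem_head.
    by apply: IH => q qr; apply: pr; rewrite inE qr orbT.
  exact: ltW (cP k).2.
have g1 k : hnorm (g k) <= 1 by exact: bessel_frame_norm.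
apply: (@le_trans _ _ (\sum_k (complex.Re (hdot (P (frame_op e (g k)))
    (frame_op e (g k))) + 2 * opnorm P * dl))).
  apply: ler_sum => k _; apply: pos_approx => //.
  exact: le_trans (proj_le Qp _) (g1 k).
rewrite big_split/= lerD//.
  apply: le_trans (frame_trace P_ge0 _ bg) _.
    by move=> x; apply: (proj_id Qp); exact: Qp.1.
  apply: le_trans (Bt s (undup_uniq _) sB).
  by rewrite (big_nth 0) big_mkord.
rewrite sumr_const card_ord -[_ *+ n]mulr_natr mulrAC /dl ler_pdivrMr// mul1r.
by rewrite lerDl.
Qed.

End TraceBound.

Section SingularValueSum.
Variables (R : realType) (H K : hilbertType R).
Variables (X : {linear H -> K}) (P : {linear H -> H}).
Hypothesis bX : bounded_op X.
Hypothesis PX : is_abs P X.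

Lemma abs_bounded : bounded_op P. Proof. by case: PX. Qed.

Lemma abs_ge0 x : 0 <= hdot (P x) x. Proof. by case: PX => _ + _; exact. Qed.

Lemma abs_adj x y : hdot (P x) y = hdot x (P y).
Proof. by rewrite (pos_herm abs_ge0 y x) -hdotC. Qed.

(** Lets vectors that nearly maximize [X] be used for the self-adjoint operator [P]. *)
Lemma abs_norm x : hnorm (P x) = hnorm (X x).
Proof.
apply/eqP; rewrite -(@eqrXn2 _ 2) ?hnorm_ge0//; apply/eqP/rC_inj.
rewrite (hnormKC (P x)) (hnormKC (X x)).
by case: PX => _ _ <-; rewrite [RHS]abs_adj.
Qed.

(* A new pair (g, f) is chosen with g orthogonal to the previous g's and to the
   P f's, so that f, the direction of P g, is orthogonal to the previous f's. *)
Lemma abs_greedy N : exists g f : seq H, [/\ size g = N, size f = N,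
  (forall i j : 'I_N, i != j -> hdot g`_i g`_j = 0 /\ hdot f`_i f`_j = 0),
  (forall i : 'I_N, hnorm g`_i <= 1 /\ hnorm f`_i <= 1) &
  \sum_(k < N) sing_val X k.*2.+1 / 2 <= \sum_(k < N) complex.Re (hdot (P g`_k) f`_k)].
Proof.
elim: N => [|N [g [f [sg sf ogf ngf le_gf]]]].
  by exists [::], [::]; split => //; rewrite ?big_ord0//; case.
suff [x [y [x1 y1 xg yf xy]]] : exists x y : H, [/\ hnorm x <= 1, hnorm y <= 1,
    forall i : 'I_N, hdot x g`_i = 0, forall i : 'I_N, hdot y f`_i = 0 &
    sing_val X N.*2.+1 / 2 <= complex.Re (hdot (P x) y)].
  exists (x :: g), (y :: f); split => /=.
  - by rewrite sg.
  - by rewrite sf.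
  - move=> i j; case: (unliftP ord0 i) => [i'|] ->; case: (unliftP ord0 j) => [j'|] ->.
    + by rewrite (inj_eq lift_inj) => /ogf.
    + by move=> _; split; apply: hdotC0; [exact: xg|exact: yf].
    + by move=> _; split; [exact: xg|exact: yf].
    + by rewrite eqxx.
  - by move=> i; case: (unliftP ord0 i) => [i'|] ->; [exact: ngf|split].
  (* The new pair stands at the head of the lists, while its singular value is the last term. *)
  - by rewrite big_ord_recr big_ord_recl/= addrC lerD.
have s0 : 0 <= sing_val X N.*2.+1 by exact: sing_val_ge0.
have [s00|sp] := eqVneq (sing_val X N.*2.+1) 0.
  exists 0, 0; rewrite s00 hnorm0 mul0r hdot0r; split => // i; exact: hdot0l.
(* This list has [2 N] members, whence the index [2 N + 1]. *)
have [Q Qp] := projection_exists (g ++ map P f).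
have := sing_val_projr (n := N.*2.+1) bX Qp.
rewrite size_cat size_map sg sf addnn ltnSn => /(_ isT) sQ.
have : sing_val X N.*2.+1 / 2 < opnorm (X \- (X \o Q)).
  apply: lt_le_trans sQ; rewrite ltr_pdivrMr// ltr_pMr ?ltr1n//.
  by rewrite lt_def sp.
move=> /lt_opnorm[z z1]; rewrite /= -linearB/= -abs_norm => sz.
set x := z - Q z in sz *.
have Px0 : 0 < hnorm (P x) by apply: le_lt_trans sz; rewrite divr_ge0.
have xo w : w \in g ++ map P f -> hdot x w = 0.
  by move=> wg; apply: hdotC0; exact: Qp.2.
exists x, (rC R (hnorm (P x))^-1 *: P x); split.
- exact: le_trans (projC_le Qp z) z1.
- rewrite hnormZ normc_rC ger0_norm ?invr_ge0 ?hnorm_ge0//. by rewrite mulVf ?lt0r_neq0.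
- by move=> i; rewrite xo// mem_cat mem_nth// sg.
- move=> i; rewrite hdotZl abs_adj xo ?mulr0// mem_cat map_f ?orbT//.
  by rewrite mem_nth// sf.
rewrite hdotZr conj_rC -hnormKC -rmorphM Re_rC expr2 mulrA mulVf ?lt0r_neq0//.
by rewrite mul1r ltW.
Qed.

(** In the constant 4, one factor 2 bounds each even-indexed value by the preceding odd-indexed one,
    the other undoes the halving in [abs_greedy]. The mixed terms are bounded by [pos_amgm] and the
    hypothesis on [g] and [f]. *)
Lemma sing_val_sum_le t N :
  (forall n (g : 'I_n -> H), bessel g ->
     \sum_k complex.Re (hdot (P (g k)) (g k)) <= t) ->
  \sum_(1 <= n < N.+1) sing_val X n <= 4 * t.
Proof.
move=> Pt; have [g [f [_ _ ogf ngf le_gf]]] := abs_greedy N.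
have bg : bessel (fun k : 'I_N => g`_k).
  by apply: bessel_orth => [i j /ogf[]|i]; have [] := ngf i.
have bf : bessel (fun k : 'I_N => f`_k).
  by apply: bessel_orth => [i j /ogf[]|i]; have [] := ngf i.
have gft : 2 * \sum_(k < N) complex.Re (hdot (P g`_k) f`_k) <= t + t.
  apply: le_trans (lerD (Pt _ _ bg) (Pt _ _ bf)).
  rewrite mulr_sumr -big_split/=; apply: ler_sum => k _.
  exact: (pos_amgm abs_ge0).
have s2 : \sum_(1 <= n < N.*2.+1) sing_val X n <=
    4 * \sum_(k < N) sing_val X k.*2.+1 / 2.
  elim: N {g f ogf ngf le_gf bg bf gft} => [|N IH]; first by rewrite big_geq// big_ord0 mulr0.
  rewrite big_ord_recr doubleS big_nat_recr//= big_nat_recr//= mulrDr -addrA lerD//.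
  have : sing_val X N.*2.+2 <= sing_val X N.*2.+1 by apply: sing_val_mono => //=.
  lra.
have : \sum_(1 <= n < N.+1) sing_val X n <= \sum_(1 <= n < N.*2.+1) sing_val X n.
  rewrite (@big_cat_nat _ _ _ N.+1 1 N.*2.+1)//= ?ltnS -?addnn ?leq_addr//.
  rewrite lerDl big_nat; apply: sumr_ge0 => n /andP[n0 _].
  by rewrite sing_val_ge0// (leq_trans _ n0).
lra.
Qed.

End SingularValueSum.

Section PerturbedContraction.
Variables (R : realType) (H K : hilbertType R).
Variables (T A X : {linear H -> K}).
Hypothesis TAX : forall x, T x = A x + X x.
Hypothesis bA : bounded_op A.
Hypothesis bX : bounded_op X.
Hypothesis A1 : opnorm A <= 1.

(** An approximant [F] of [X] also approximates [T], since [T - F = A + (X - F)]. *)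
Lemma sing_val_perturb n : (0 < n)%N -> sing_val T n <= 1 + sing_val X n.
Proof.
move=> n0; rewrite -lerBlDl; apply: le_sing_val => // F bF rF; rewrite lerBlDl.
have bXF := bounded_opB bX bF.
have bT : bounded_op T.
  by have := bounded_opD bA bX; congr bounded_op; apply/funext => x; rewrite TAX.
apply: (sing_val_le bT bF rF); first by rewrite addr_ge0// opnorm_ge0.
move=> x; rewrite TAX -addrA mulrDl.
apply: le_trans (hnormD_le _ _) _.
apply: lerD; last exact: opnormP bXF.
by apply: le_trans (opnormP x bA) _; rewrite ler_wpM2r ?hnorm_ge0.
Qed.

(** The inequality [1 + s <= expR s] turns the product into the exponential of the sum of the
    singular values of [X]. *)
Lemma prod_max_sing_val_bounded : trace_class X ->
  exists L, forall N, \prod_(1 <= n < N.+1) Num.max 1 (sing_val T n) <= L.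
Proof.
move=> [_ [P [B [PX oB trP]]]].
have [t trt] : exists t : R, forall s : seq H, uniq s -> (forall b, b \in s -> B b) ->
    \sum_(b <- s) complex.Re (hdot (P b) b) <= t.
  have e0 : (0 <= \esum_(b in B) (complex.Re (hdot (P b) b))%:E)%E.
    by apply: esum_ge0 => b _; rewrite lee_fin (Re_pos_ge0 (abs_ge0 PX)).
  exists (fine (\esum_(b in B) (complex.Re (hdot (P b) b))%:E)) => s us sB.
  rewrite -lee_fin fineK ?ge0_fin_numE// -sumEFin.
  rewrite (fsbig_seq _ _ us); apply: ereal_sup_ubound => /=.
  by exists [set` s]%classic => //; split => //; exact: finite_seq.
have Pt := trace_bessel (abs_ge0 PX) (abs_bounded PX) oB trt.
exists (expR (4 * (t + 1))) => N.
apply: (@le_trans _ _ (expR (\sum_(1 <= n < N.+1) sing_val X n))); last first.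
  by rewrite ler_expR; exact: (sing_val_sum_le bX PX).
rewrite expR_sum !big_nat; apply: ler_prod => n /andP[n0 _].
have s0 := sing_val_ge0 bX n0.
rewrite le_max ler01/= ge_max; apply/andP; split.
  by rewrite -expR0 ler_expR.
exact: le_trans (sing_val_perturb n0) (expR_ge1Dx _).
Qed.

End PerturbedContraction.

(** * Orthonormal bases *)

Section Limits.
Variables (R : realType) (H : hilbertType R).
Implicit Types (u v : nat -> H) (l m x y : H).

Lemma dot_cvg_uniq u l m : dot_cvg hdot u l -> dot_cvg hdot u m -> l = m.
Proof.
move=> ul um; apply: subr0_eq; apply: (@dotnorm_small _ _ hdot).
move=> e e0; have e20 : 0 < e / 2 by rewrite divr_gt0.
have [N hN] := ul _ e20; have [M hM] := um _ e20.
apply: le_lt_trans (dotnorm_triangle hdot (u (maxn N M)) _ _) _.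
rewrite [e]splitr ltrD//; last exact: hM (leq_maxr _ _).
by rewrite dotnormBC; exact: hN (leq_maxl _ _).
Qed.

Lemma dot_cvgD u v l m : dot_cvg hdot u l -> dot_cvg hdot v m ->
  dot_cvg hdot (fun n => u n + v n) (l + m).
Proof.
move=> ul vm e e0; have e20 : 0 < e / 2 by rewrite divr_gt0.
have [N hN] := ul _ e20; have [M hM] := vm _ e20.
exists (maxn N M) => n; rewrite geq_max => /andP[/hN h1 /hM h2].
rewrite opprD addrACA; apply: le_lt_trans (dotnormD hdot _ _) _.
by rewrite [e]splitr ltrD.
Qed.

Lemma dot_cvgZ c u l : dot_cvg hdot u l ->
  dot_cvg hdot (fun n => c *: u n) (c *: l).
Proof.
move=> ul e e0; have d0 : 0 < normc c + 1 by rewrite ltr_wpDl ?normc_ge0.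
have [N hN] := ul _ (divr_gt0 e0 d0); exists N => n /hN h.
rewrite -scalerBr dotnormZ; move: h; rewrite ltr_pdivlMr// mulrC.
by apply: le_lt_trans; rewrite ler_wpM2r ?dotnorm_ge0// lerDl.
Qed.

Lemma dot_cvg_hdot u l x : dot_cvg hdot u l ->
  cvgC (fun n => hdot (u n) x) (hdot l x).
Proof.
move=> ul e e0; have d0 : 0 < hnorm x + 1 by rewrite ltr_wpDl ?hnorm_ge0.
have [N hN] := ul _ (divr_gt0 e0 d0); exists N => n /hN h.
rewrite -hdotBl; apply: le_lt_trans (hdot_CS _ _) _.
move: h; rewrite ltr_pdivlMr//; apply: le_lt_trans.
by rewrite ler_wpM2l ?dotnorm_ge0// lerDl.
Qed.

(** The bound is only asked eventually and up to [e], as it is available for minimizing sequences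
    and for partial sums. *)
Lemma dot_cvg_norm_le u l (M : R) : dot_cvg hdot u l ->
  (forall e, 0 < e -> exists N, forall n, (N <= n)%N -> hnorm (u n) <= M + e) ->
  hnorm l <= M.
Proof.
move=> ul uM; apply/ler_addgt0Pl => e e0; have e20 : 0 < e / 2 by rewrite divr_gt0.
have [N hN] := ul _ e20; have [N' hN'] := uM _ e20.
have h1 := hN _ (leq_maxl N N'); have h2 := hN' _ (leq_maxr N N').
have := hnormD_le (l - u (maxn N N')) (u (maxn N N')); rewrite subrK.
have -> : hnorm (l - u (maxn N N')) = hnorm (u (maxn N N') - l) by exact: dotnormBC.
rewrite -/(hnorm _) in h1; move: h1 h2; lra.
Qed.

Lemma parallelogram x y :
  hnorm (x + y) ^+ 2 + hnorm (x - y) ^+ 2 = 2 * hnorm x ^+ 2 + 2 * hnorm y ^+ 2.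
Proof.
rewrite !hnormK hdotBl !hdotBr hdotDl !hdotDr !raddfB !raddfD/=.
by ring.
Qed.

End Limits.

Section OrthonormalBasis.
Variables (R : realType) (H : hilbertType R).
Local Open Scope classical_set_scope.
Implicit Types (B : set H) (x y : H).

Definition orthonormal B :=
  forall a b, B a -> B b -> hdot a b = (a == b)%:R.

Definition lin_comb B y := exists s : seq (R[i] * H),
  (forall p, p \in s -> B p.2) /\ y = \sum_(p <- s) p.1 *: p.2.

Lemma lin_combD B x y : lin_comb B x -> lin_comb B y -> lin_comb B (x + y).
Proof.
move=> [s [sB ->]] [t [tB ->]]; exists (s ++ t); rewrite big_cat; split => // p.
by rewrite mem_cat => /orP[/sB|/tB].
Qed.

Lemma lin_combZ B c x : lin_comb B x -> lin_comb B (c *: x).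
Proof.
move=> [s [sB ->]]; exists [seq (c * p.1, p.2) | p <- s]; split.
  by move=> _ /mapP[p ps ->]; exact: (sB _ ps).
by rewrite big_map scaler_sumr; apply: eq_bigr => p _; rewrite scalerA.
Qed.

Lemma lin_comb1 B x : B x -> lin_comb B x.
Proof.
move=> Bx; exists [:: (1, x)]; rewrite big_seq1 scale1r; split => // p.
by rewrite inE => /eqP->.
Qed.

Lemma lin_comb0 B : lin_comb B 0.
Proof. by exists [::]; split => //; rewrite big_nil. Qed.

(* The closest point to x in the closed span of B, as the limit of a minimizing
   sequence; r is the difference. *)
Lemma orth_component B x : (forall b, B b -> hnorm b = 1) ->
  exists r, (forall b, B b -> hdot r b = 0) /\
    forall e : R, 0 < e -> exists y, lin_comb B y /\ hnorm (x - r - y) < e.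
Proof.
move=> B1; pose D := [set hnorm (x - y) | y in lin_comb B].
have D0 : D !=set0 by exists (hnorm (x - 0)), 0 => //; exact: lin_comb0.
have Dlb : lbound D 0 by move=> _ [y _ <-]; exact: hnorm_ge0.
have hlb : has_lbound D by exists 0.
pose d := inf D.
have d0 : 0 <= d by exact: lb_le_inf.
have dle y : lin_comb B y -> d <= hnorm (x - y) by move=> By; apply: ge_inf => //; exists y.
have /choice[y yP] n : exists y, lin_comb B y /\ hnorm (x - y) < d + n.+1%:R^-1.
  have /inf_lt[//|_ [y By <-] ylt] : d < d + n.+1%:R^-1 by rewrite ltrDl invr_gt0.
  by exists y.
have cau : dot_cauchy hdot y.
  (* As the midpoint of [y m] and [y n] is at distance at least [d] from [x], the parallelogram law
     bounds the squared distance of [y m] and [y n] by [(4 * d + 2) * (m.+1%:R^-1 + n.+1%:R^-1)]. *)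
  move=> e e0; have c0 : 0 < 8 * d + 4 + 1 by lra.
  have [N hN] := small_inv (divr_gt0 (exprn_gt0 2 e0) c0).
  exists N => m n Nm Nn.
  have im0 : 0 < m.+1%:R^-1 :> R by rewrite invr_gt0.
  have in0 : 0 < n.+1%:R^-1 :> R by rewrite invr_gt0.
  have im1 : m.+1%:R^-1 <= 1 :> R by rewrite invf_le1// ler1n.
  have in1 : n.+1%:R^-1 <= 1 :> R by rewrite invf_le1// ler1n.
  have /= hm := hN _ Nm; have /= hn := hN _ Nn.
  have [ym xm] := yP m; have [yn xn] := yP n.
  have mid : lin_comb B (rC R 2^-1 *: (y m + y n)) by apply/lin_combZ/lin_combD.
  have := parallelogram (x - y n) (x - y m).
  rewrite (_ : x - y n - (x - y m) = y m - y n); last first.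
    by rewrite opprB addrC addrA subrK.
  have -> : x - y n + (x - y m) = rC R 2 *: (x - rC R 2^-1 *: (y m + y n)).
    rewrite scalerBr scalerA -rmorphM mulfV ?pnatr_eq0// rmorph1 scale1r.
    rewrite [rC R 2](_ : _ = 2%:R); last by rewrite rmorph_nat.
    by rewrite scaler_nat mulr2n addrACA opprD [- y n - _]addrC.
  rewrite hnormZ normc_rC ger0_norm// exprMn => pm.
  rewrite -[dotnorm _ _]/(hnorm _) -(@ltr_pXn2r _ 2) ?nnegrE ?hnorm_ge0 ?ltW//.
  have sqle (k h : R) : 0 <= k -> 0 <= h <= 1 -> k < d + h ->
      k ^+ 2 <= d ^+ 2 + h * (2 * d + 1).
    move=> k0 /andP[h0 h1] kd; apply: (@le_trans _ _ ((d + h) ^+ 2)).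
      by rewrite ler_sqr2 ?(ltW kd) ?addr_ge0.
    rewrite sqrrD -addrA lerD2l mulrDr mulr1; apply: lerD.
      by rewrite -mulr_natl mulrCA mulrC -mulrA mulrCA mulrA.
    by rewrite expr2 ler_piMr.
  have hm2 := sqle _ _ (hnorm_ge0 _) (introT andP (conj (ltW im0) im1)) xm.
  have hn2 := sqle _ _ (hnorm_ge0 _) (introT andP (conj (ltW in0) in1)) xn.
  have hc2 : d ^+ 2 <= hnorm (x - rC R 2^-1 *: (y m + y n)) ^+ 2.
    by rewrite ler_sqr2 ?hnorm_ge0// dle.
  move: hm hn; rewrite !ltr_pdivlMr//.
  move: im0 in0 pm hm2 hn2 hc2; move: (m.+1%:R^-1) (n.+1%:R^-1) => p q.
  move: (hnorm _ ^+ 2) (hnorm _ ^+ 2) (hnorm _ ^+ 2) (hnorm _ ^+ 2) => a b c z.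
  lra.
have [l yl] := hdot_complete y cau.
exists (x - l); split; last first.
  move=> e /yl[N /(_ N (leqnn N)) h]; exists (y N); split; first by have [] := yP N.
  by rewrite opprB addrCA subrr addr0 /hnorm dotnormBC.
move=> b Bb; pose r := x - l.
have rE n : x - y n - r = l - y n by rewrite /r opprB addrC addrA subrK.
have rd : hnorm r <= d.
  apply: (@dot_cvg_norm_le _ _ (fun n => x - y n)).
    by move=> e /yl[N hN]; exists N => n /hN h; rewrite rE dotnormBC.
  move=> e /small_inv[N hN]; exists N => n /hN h.
  by apply/ltW; apply: lt_trans (yP n).2 _; rewrite ltrD2l.
(* [r - c *: b] is a limit of differences of [x] with linear combinations. Since [hnorm r <= d],
   Pythagoras then forces [c = 0]. *)
set c := hdot r b; have rle : d <= hnorm (r - c *: b).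
  apply/ler_addgt0Pr => e /yl[N /(_ N (leqnn N)) h].
  apply: le_trans (dle (y N + c *: b) _) _.
    by apply: lin_combD; [have [] := yP N|exact/lin_combZ/lin_comb1].
  have -> : x - (y N + c *: b) = (r - c *: b) + (l - y N).
    by rewrite -rE [RHS]addrC [RHS]addrA (subrK r) opprD addrA.
  apply: le_trans (hnormD_le _ _) _; rewrite lerD2l ltW//.
  by rewrite /hnorm dotnormBC.
have co : hdot (r - c *: b) (c *: b) = 0.
  by rewrite hdotZr hdotBl hdotZl -hnormKC B1// expr1n rmorph1 mulr1 subrr mulr0.
have := pythagoras co; rewrite subrK hnormZ (B1 b Bb) mulr1 => rc.
have rd2 : hnorm r ^+ 2 <= d ^+ 2 by rewrite ler_sqr2 ?hnorm_ge0.
have rle2 : d ^+ 2 <= hnorm (r - c *: b) ^+ 2 by rewrite ler_sqr2 ?hnorm_ge0.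
apply: eq0_normc; apply/eqP; rewrite -sqrf_eq0 eq_le sqr_ge0 andbT -/r -/c.
by move: rc rd2 rle2; lra.
Qed.

(** By Zorn's lemma, hence without separability: were a maximal orthonormal set not total, a nonzero
    [r] from [orth_component], normalized, would enlarge it. *)
Lemma orthonormal_basis_exists : exists B, orthonormal_basis B.
Proof.
have [|B [oB maxB]] := @Zorn_bigcup H orthonormal.
  move=> F Fo Ft a b [X FX Xa] [Y FY Yb].
  have [XY|YX] := Ft _ _ FX FY.
    by apply: (Fo _ FY) => //; exact: XY.
  by apply: (Fo _ FX) => //; exact: YX.
have B1 b : B b -> hnorm b = 1.
  move=> Bb; apply/eqP; rewrite -(@eqrXn2 _ 2) ?hnorm_ge0// hnormK oB// eqxx.
  by rewrite expr1n.
exists B; split => // x e e0; have [r [rB xr]] := orth_component x B1.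
have [r0|r0] := eqVneq r 0.
  have [_ [[s [sB ->]] xs]] := xr e e0; exists s; split => //.
  by move: xs; rewrite r0 subr0.
exfalso; have nr : hnorm r != 0 by apply: contra r0 => /eqP/hnorm_eq0->.
pose c := rC R (hnorm r)^-1.
apply: (maxB (B `|` [set c *: r])).
  rewrite properEneq; split; last exact: subsetUl.
  apply/eqP => BE; have Bc : B (c *: r) by rewrite BE; right.
  have := rB _ Bc; rewrite hdotZr conj_rC -hnormKC -rmorphM => /eqP.
  rewrite fmorph_eq0 mulf_eq0 invr_eq0 (negPf nr)/= expf_eq0/=.
  by rewrite (negPf nr).
have cr : hdot (c *: r) (c *: r) = 1.
  rewrite hdotZl hdotZr conj_rC -hnormKC -!rmorphM mulrA -expr2 -exprMn.
  by rewrite mulVf// expr1n rmorph1.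
have crB b : B b -> hdot (c *: r) b = 0.
  by move=> Bb; rewrite hdotZl rB// mulr0.
have neq b : B b -> (b == c *: r) = false.
  move=> Bb; apply/eqP => bE; move: (crB _ Bb); rewrite bE cr.
  by move/eqP; rewrite oner_eq0.
move=> a b [Ba|->] [Bb|->].
- exact: oB.
- by rewrite neq// hdotC crB// conjE conjc0.
- by rewrite eq_sym neq// crB.
- by rewrite eqxx cr.
Qed.

End OrthonormalBasis.

(** * Vectors attaining the norm *)

Section NormAttainment.
Variables (R : realType) (H K : hilbertType R).
Local Open Scope classical_set_scope.

Lemma ultra_fmap (S U : Type) (f : S -> U) (G : set_system S) :
  UltraFilter G -> UltraFilter (fmap f G).
Proof.
move=> UG; split; first exact: fmap_proper_filter.
move=> F FF GF; apply/seteqP; split=> A; last exact: GF.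
move=> FA; have [//|GnA] := in_ultra_setVsetC (f @^-1` A) UG.
have FAA : F (A `&` ~` A) by apply: filterI => //; exact: GF.
by have [? []] := filter_ex FAA.
Qed.

(** Compactness of the segment makes [phi] converge along [G]; the ultrafilter stands in for the
    extraction of subsequences. *)
Lemma ultra_bounded_cauchy (G : set_system H) (phi : H -> R) (M : R) :
  UltraFilter G -> G [set x | `|phi x| <= M] ->
  forall e : R, 0 < e -> exists A, G A /\
    forall x y, A x -> A y -> `|phi x - phi y| < e.
Proof.
move=> UG GM e e0; have e20 : 0 < e / 2 by rewrite divr_gt0.
have := @segment_compact R (- M) M; rewrite compact_ultra.
move=> /(_ (phi @ G) _ _)[||c [_ phic]].
- exact: ultra_fmap.
- have : G (phi @^-1` `[- M, M]); last by [].
  by apply: filterS GM => x /= xM; rewrite in_itv/= -ler_norml.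
have /cvgrPdist_lt/(_ _ e20) Gc : phi @ G --> c by [].
exists [set x | `|c - phi x| < e / 2]; split => // x y /= xc yc.
rewrite (_ : phi x - phi y = (c - phi y) - (c - phi x)); last by ring.
by rewrite (le_lt_trans (ler_normB _ _))// [e]splitr ltrD.
Qed.

(** The range of [F] has a finite frame, and the real and imaginary parts of each coordinate
    converge along [G]. *)
Lemma ultra_finite_rank (G : set_system H) (F : {linear H -> K}) n :
  UltraFilter G -> G [set x | hnorm x <= 1] -> bounded_op F -> rank_lt F n ->
  forall e : R, 0 < e -> exists A, G A /\
    forall x y, A x -> A y -> hnorm (F x - F y) < e.
Proof.
move=> UG G1 bF [s [_ sF]] e e0.
have [d [b [idem bs]]] := frame_exists s.
have be := bessel_frame idem.
have FE x : F x = frame_op b (F x).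
  have [c ->] := sF x; rewrite /frame_op.
  under [RHS]eq_bigr do rewrite hdot_suml scaler_suml.
  rewrite exchange_big; apply: eq_bigr => i _.
  rewrite -{1}(bs s`_i) ?mem_nth// scaler_sumr; apply: eq_bigr => j _.
  by rewrite hdotZl scalerA.
(* There are [2 * d] real coordinates; the added 1 makes the total variation strictly less than [e],
   also when [d = 0]. *)
have c0 : 0 < 2 * d%:R + 1 :> R by rewrite ltr_wpDl ?mulr_ge0 ?ler0n.
have ed0 : 0 < e / (2 * d%:R + 1) by rewrite divr_gt0.
have FM x j : hnorm x <= 1 -> normc (hdot (F x) (b j)) <= opnorm F.
  move=> x1; apply: le_trans (hdot_CS _ _) _; rewrite -[leRHS]mulr1.
  apply: ler_pM; rewrite ?hnorm_ge0//; last exact: bessel_frame_norm.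
  exact: opnorm_le_unit.
have /choice[A AP] (j : 'I_d) : exists A, G A /\ forall x y, A x -> A y ->
    `|complex.Re (hdot (F x) (b j)) - complex.Re (hdot (F y) (b j))| <
       e / (2 * d%:R + 1).
  apply: (@ultra_bounded_cauchy _ _ (opnorm F)) => //.
  by apply: filterS G1 => x /= /(FM _ j); apply: le_trans; exact: Re_le_normc.
have /choice[B BP] (j : 'I_d) : exists A, G A /\ forall x y, A x -> A y ->
    `|complex.Im (hdot (F x) (b j)) - complex.Im (hdot (F y) (b j))| <
       e / (2 * d%:R + 1).
  apply: (@ultra_bounded_cauchy _ _ (opnorm F)) => //.
  by apply: filterS G1 => x /= /(FM _ j); apply: le_trans; exact: Im_le_normc.
exists [set x | forall j, A j x /\ B j x]; split.
  apply: filter_forall => j.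
  by apply: filterI; [have [] := AP j|have [] := BP j].
move=> x y /= xAB yAB; rewrite FE [F y]FE /frame_op -sumrB.
under eq_bigr do rewrite -scalerBl.
apply: le_lt_trans (hnorm_sum _ _) _.
apply: (@le_lt_trans _ _ (\sum_(j < d) 2 * (e / (2 * d%:R + 1)))).
  apply: ler_sum => j _; rewrite hnormZ -[leRHS]mulr1.
  apply: ler_pM; rewrite ?hnorm_ge0 ?normc_ge0//; last exact: bessel_frame_norm.
  apply: le_trans (normc_le _) _; rewrite !raddfB/= mulr_natl mulr2n.
  have [[xA xB] [yA yB]] := (xAB j, yAB j).
  by apply: lerD; apply: ltW; [exact: (AP j).2|exact: (BP j).2].
rewrite sumr_const card_ord -[_ *+ d]mulr_natl.
rewrite (_ : _ * _ = e * ((2 * d%:R) / (2 * d%:R + 1))); last by ring.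
by rewrite gtr_pMr// ltr_pdivrMr// mul1r ltrDl.
Qed.

(* A maximizing sequence on the unit ball, chosen inside an ultrafilter, is
   Cauchy: its image under F is, and the parallelogram law together with
   g < opnorm T transfers this to the sequence itself. *)
Lemma norm_attained (T F : {linear H -> K}) r (g : R) :
  bounded_op T -> bounded_op F -> rank_lt F r -> 0 <= g -> g < opnorm T ->
  (forall x, hnorm (T x - F x) <= g * hnorm x) ->
  exists2 x, hnorm x = 1 & hnorm (T x) = opnorm T.
Proof.
move=> bT bF rF g0; set s := opnorm T => gs TFg.
have s0 : 0 < s by exact: le_lt_trans gs.
pose D (d : R) : set H := [set x | hnorm x <= 1 /\ s - d < hnorm (T x)].
have Dfil : Filter (filter_from [set d : R | 0 < d] D).
  apply: filter_from_filter; first by exists 1 => /=.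
  move=> i j /= i0 j0; exists (Num.min i j); first by rewrite /= lt_min i0.
  move=> x [x1 xs]; split; split => //; apply: le_lt_trans xs; rewrite lerD2l lerN2.
    by rewrite ge_min lexx.
  by rewrite ge_min lexx orbT.
have Dprop : ProperFilter (filter_from [set d : R | 0 < d] D).
  apply: filter_from_proper => d /= d0.
  have [|x x1 xs] := @lt_opnorm _ _ _ T (s - d); first by rewrite ltrBlDr ltrDl.
  by exists x.
have [G [UG DG]] := ultraFilterLemma Dprop.
have GD d : 0 < d -> G (D d) by move=> d0; apply: DG; exists d.
have G1 : G [set x | hnorm x <= 1].
  by apply: filterS (GD 1 ltr01) => x [].
have cau (e : R) : 0 < e -> exists A, G A /\ A `<=` D e /\
    forall x y, A x -> A y -> hnorm (x - y) < e.
  (* The parallelogram law in both spaces gives [(s ^+ 2 - g ^+ 2) * hnorm (x - y) ^+ 2 <= (8 * s +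
     4 * g + 1) * d]; the larger constant makes the final inequality strict. *)
  move=> e0; pose c := 8 * s + 4 * g + 2.
  have c0 : 0 < c by rewrite /c; lra.
  have sg0 : 0 < s ^+ 2 - g ^+ 2 by rewrite subr_gt0 ltr_pXn2r ?nnegrE ?g0 ?(ltW s0).
  pose w := (s ^+ 2 - g ^+ 2) * e ^+ 2 / c.
  have w0 : 0 < w by rewrite /w !mulr_gt0 ?invr_gt0 ?exprn_gt0.
  pose d := Num.min 1 w.
  have d0 : 0 < d by rewrite lt_min ltr01.
  have d1 : d <= 1 by rewrite ge_min lexx.
  have dw : c * d <= (s ^+ 2 - g ^+ 2) * e ^+ 2.
    by rewrite mulrC -ler_pdivlMr// ge_min lexx orbT.
  have [A [GA AF]] := ultra_finite_rank UG G1 bF rF d0.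
  exists (A `&` D d `&` D e); split.
    by apply: filterI; [apply: filterI => //|]; exact: GD.
  split; first by move=> x [].
  move=> x y [[Ax [x1 xs]] _] [[Ay [y1 ys]] _].
  have sq z : hnorm z <= 1 -> s - d < hnorm (T z) -> s ^+ 2 - 2 * s * d <= hnorm (T z) ^+ 2.
    move=> z1 zs; have := sqr_ge0 (hnorm (T z) - s).
    have : 0 < s * (hnorm (T z) - (s - d)).
      by rewrite mulr_gt0// subr_gt0.
    lra.
  have D2 : hnorm (x - y) <= 2.
    by apply: le_trans (hnormB_le _ _) _; rewrite mulr2n lerD.
  have D0 := hnorm_ge0 (x - y).
  have TD : hnorm (T x - T y) <= g * hnorm (x - y) + d.
    have -> : T x - T y = (T (x - y) - F (x - y)) + (F x - F y).
      by rewrite (linearB T) (linearB F) subrK.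
    apply: le_trans (hnormD_le _ _) _; apply: lerD; first exact: TFg.
    exact: ltW (AF _ _ Ax Ay).
  have TS : hnorm (T x + T y) <= s * hnorm (x + y).
    by rewrite -linearD; exact: opnormP.
  have {}TD : hnorm (T x - T y) ^+ 2 <= g ^+ 2 * hnorm (x - y) ^+ 2 + 4 * g * d + d.
    apply: (@le_trans _ _ ((g * hnorm (x - y) + d) ^+ 2)).
      by rewrite ler_sqr2 ?hnorm_ge0// addr_ge0 ?mulr_ge0 ?(ltW d0).
    have h1 : 0 <= g * d * (2 - hnorm (x - y)).
      by rewrite !mulr_ge0 ?subr_ge0 ?(ltW d0).
    have h2 : 0 <= d * (1 - d) by rewrite mulr_ge0 ?subr_ge0 ?(ltW d0).
    by move: h1 h2; lra.
  have {}TS : hnorm (T x + T y) ^+ 2 <= s ^+ 2 * hnorm (x + y) ^+ 2.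
    by rewrite -exprMn ler_sqr2 ?mulr_ge0 ?hnorm_ge0 ?(ltW s0).
  have x2 : hnorm x ^+ 2 <= 1 by rewrite expr_le1 ?hnorm_ge0.
  have y2 : hnorm y ^+ 2 <= 1 by rewrite expr_le1 ?hnorm_ge0.
  have xy2 : s ^+ 2 * hnorm (x + y) ^+ 2 <= s ^+ 2 * (4 - hnorm (x - y) ^+ 2).
    rewrite ler_wpM2l ?sqr_ge0//; have := parallelogram x y; move: x2 y2.
    by lra.
  have := parallelogram (T x) (T y); have := sq _ x1 xs; have := sq _ y1 ys.
  rewrite -(@ltr_pXn2r _ 2) ?nnegrE ?hnorm_ge0 ?(ltW e0)// -(ltr_pM2l sg0).
  move: dw TD TS xy2 d0; rewrite /c.
  move: (hnorm (x - y) ^+ 2) (hnorm (x + y) ^+ 2) (hnorm (T x) ^+ 2) => D' S' X'.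
  move: (hnorm (T y) ^+ 2) (hnorm (T x + T y) ^+ 2) (hnorm (T x - T y) ^+ 2) => Y' P' M'.
  by lra.
have /choice[A AP] (k : nat) : exists A, G A /\ A `<=` D k.+1%:R^-1 /\
    forall x y, A x -> A y -> hnorm (x - y) < k.+1%:R^-1.
  by apply: cau; rewrite invr_gt0.
(* With nested sets, [u m] and [u n] both belong to [A N] as soon as [N <= m] and [N <= n]. *)
pose B k := [set x | forall j, (j <= k)%N -> A j x].
have GB k : G (B k).
  elim: k => [|k IH].
    by apply: filterS (AP 0%N).1 => x Ax j; rewrite leqn0 => /eqP->.
  apply: filterS (filterI IH (AP k.+1).1) => x [Bx Ax] j.
  by rewrite leq_eqVlt => /orP[/eqP->//|]; exact: Bx.
have /choice[u uB] k : exists x, B k x by exact: filter_ex (GB k).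
have [l ul] : exists l, dot_cvg hdot u l.
  apply: hdot_complete => e /small_inv[N /(_ N (leqnn N)) Ne].
  exists N => m n Nm Nn; apply: lt_trans Ne.
  by apply: (AP N).2.2; apply: uB.
have u1 n : hnorm (u n) <= 1 by have [] := (AP n).2.1 _ (uB n n (leqnn n)).
have us n : s - n.+1%:R^-1 < hnorm (T (u n)).
  by have [] := (AP n).2.1 _ (uB n n (leqnn n)).
have l1 : hnorm l <= 1.
  apply: (dot_cvg_norm_le ul) => e e0; exists 0%N => n _.
  by rewrite (le_trans (u1 n))// lerDl ltW.
have sl : s <= hnorm (T l).
  apply/ler_addgt0Pr => e e0; have e20 : 0 < e / 2 by rewrite divr_gt0.
  have [N hN] := ul _ (divr_gt0 e20 s0); have [M hM] := small_inv e20.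
  set n := maxn N M; have := hN n (leq_maxl _ _).
  rewrite -[dotnorm _ _]/(hnorm _) ltr_pdivlMr// => h1.
  have h2 := hM n (leq_maxr _ _).
  have h3 := opnormP (u n - l) bT.
  have := hnormD_le (T l) (T (u n - l)); rewrite -linearD addrC subrK => h4.
  have := us n; move: h1 h2 h3 h4; rewrite -/s; move: (n.+1%:R^-1) => p.
  by rewrite [_ * s]mulrC; lra.
have le_s : hnorm (T l) <= s * hnorm l by exact: opnormP.
have sl1 : s * hnorm l <= s by rewrite ger_pMr.
exists l; last by apply/eqP; rewrite eq_le sl (le_trans le_s sl1).
apply/eqP; rewrite eq_le l1 -(ler_pM2l s0) mulr1.
exact: le_trans sl le_s.
Qed.

End NormAttainment.

(** Absolute convergence at each vector, dominated by the partial sums of [mu]. It constructs both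
    [X] and its absolute value. *)
Lemma op_series (R : realType) (H K : hilbertType R) (G : nat -> {linear H -> K})
    (mu : nat -> R) (L : R) :
  (forall k, 0 <= mu k) -> (forall n, \sum_(k < n) mu k <= L) ->
  (forall k x, hnorm (G k x) <= mu k * hnorm x) ->
  exists X : {linear H -> K}, (forall x, hnorm (X x) <= L * hnorm x) /\
    forall x, dot_cvg hdot (fun n => \sum_(k < n) G k x) (X x).
Proof.
move=> mu0 muL Gmu.
have muS n : \sum_(k < n.+1) mu k = \sum_(k < n) mu k + mu n by rewrite big_ord_recr.
have ndB : {homo (fun n => \sum_(k < n) mu k) : m n / (m <= n)%N >-> m <= n}.
  apply: homo_leq => [//||n]; first by move=> ? ? ?; exact: le_trans.
  by rewrite muS lerDl.
have part m n x : (m <= n)%N -> hnorm (\sum_(k < n) G k x - \sum_(k < m) G k x) <=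
    (\sum_(k < n) mu k - \sum_(k < m) mu k) * hnorm x.
  move=> /subnKC <-; elim: (n - m)%N => [|j IH].
    by rewrite addn0 !subrr hnorm0 mul0r.
  rewrite addnS muS big_ord_recr/= addrAC (le_trans (hnormD_le _ _))//.
  by rewrite addrAC mulrDl lerD.
have /choice[X XP] x : exists l, dot_cvg hdot (fun n => \sum_(k < n) G k x) l.
  apply: hdot_complete => e e0.
  have c0 : 0 < hnorm x + 1 by rewrite ltr_wpDl ?hnorm_ge0.
  have [N hN] := nondecreasing_cauchy ndB muL (divr_gt0 e0 c0).
  have key m n : (N <= m)%N -> (m <= n)%N ->
      hnorm (\sum_(k < n) G k x - \sum_(k < m) G k x) < e.
    move=> Nm mn; have := hN _ _ (leq_trans Nm mn) Nm.
    rewrite ltr_pdivlMr//; apply: le_lt_trans; apply: le_trans (part _ _ _ mn) _.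
    rewrite ler_pM ?hnorm_ge0 ?ler_norm// ?lerDl// subr_ge0; exact: ndB.
  exists N => m n Nm Nn; have [mn|/ltnW nm] := leqP m n; last exact: key.
  by rewrite dotnormBC; exact: key.
have Xlin : linear X.
  move=> c x y; apply: dot_cvg_uniq (XP _) _.
  have := dot_cvgD (dot_cvgZ c (XP x)) (XP y); congr dot_cvg; apply/funext => n.
  by rewrite scaler_sumr -big_split; apply: eq_bigr => k _; rewrite linearP.
pose XL := GRing.isLinear.Build _ _ _ _ X Xlin.
pose X' : {linear H -> K} := HB.pack X XL.
exists X'; split => // x /=; apply: (dot_cvg_norm_le (XP x)) => e e0.
exists 0%N => n _; have := part 0%N n x (leq0n n); rewrite !big_ord0 !subr0.
move=> /le_trans; apply; rewrite -[leLHS]addr0 lerD ?(ltW e0)//.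
by rewrite ler_wpM2r ?hnorm_ge0.
Qed.

Section MaximalVector.
Variables (R : realType) (H K : hilbertType R) (T : {linear H -> K}).
Hypothesis bT : bounded_op T.

(* The form [opnorm T ^ 2 <x, y> - <T x, T y>] is positive; it vanishes at a vector
   attaining the norm, hence everywhere against it by Cauchy-Schwarz. *)
Definition defect (x y : H) : R[i] :=
  rC R (opnorm T ^+ 2) * hdot x y - hdot (T x) (T y).

Lemma defect_herm x y : defect x y = (-1) ^+ false * (defect y x)^*.
Proof.
rewrite expr0 mul1r /defect rmorphB (rmorphM _ (rC R _))/= conj_rC.
by rewrite -!hdotC.
Qed.

Lemma defect_linearl z : GRing.linear_for *%R (defect ^~ z).
Proof.
move=> c x y; rewrite /defect (linearD T) (linearZZ T) !hdotDl !hdotZl.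
by ring.
Qed.

Lemma defect_linearr z : GRing.linear_for (Num.conj \; *%R) (defect z).
Proof.
move=> c x y; rewrite [LHS]defect_herm defect_linearl expr0 mul1r.
by rewrite rmorphD rmorphM/= [defect z x]defect_herm
  [defect z y]defect_herm expr0 !mul1r.
Qed.

HB.instance Definition _ := bilinear_isBilinear.Build _ _ _ _ _ _ defect
  (defect_linearl, defect_linearr).
HB.instance Definition _ := isHermitianSesquilinear.Build _ _ _ _ defect
  defect_herm.

Lemma defectE x : defect x x =
  rC R (opnorm T ^+ 2 * hnorm x ^+ 2 - hnorm (T x) ^+ 2).
Proof. by rewrite /defect -!hnormKC -rmorphM -rmorphB. Qed.

Lemma defect_ge0 x : 0 <= defect x x.
Proof.
rewrite defectE ge0CE Re_rC eqxx andbT subr_ge0 -exprMn.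
by rewrite ler_sqr2 ?hnorm_ge0 ?mulr_ge0 ?hnorm_ge0 ?opnorm_ge0// opnormP.
Qed.

Lemma max_vector x y : hnorm (T x) = opnorm T * hnorm x ->
  hdot (T x) (T y) = rC R (opnorm T ^+ 2) * hdot x y.
Proof.
move=> Tx; have d0 : defect x x = 0.
  by rewrite defectE Tx exprMn subrr rmorph0.
have : normc (defect x y) ^+ 2 <= 0.
  apply: le_trans (hermCS (f := defect) defect_ge0 x y) _.
  by rewrite [X in complex.Re X]d0 mul0r.
move=> h; have := subr0_eq (eq0_normc (_ : normc (defect x y) = 0)).
move=> ->//; apply/eqP; rewrite -sqrf_eq0 eq_le h sqr_ge0//.
Qed.

End MaximalVector.

Lemma in_span_subset (R : realType) (H : hilbertType R) (s t : seq H) (x : H) :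
  {subset s <= t} -> in_span s x -> in_span t x.
Proof.
move=> st [c ->]; apply: (big_ind (in_span t)).
- exact: in_span0.
- by move=> ? ?; exact: in_spanD.
- by move=> i _; apply/in_spanZ/in_span_mem/st; rewrite mem_nth.
Qed.

(** * Decomposition into a contraction and a trace class operator *)

Section FiniteRankPerturbation.
Variables (R : realType) (H K : hilbertType R).

Lemma rank_ltB (F G : H -> K) m n : rank_lt F m -> rank_lt G n ->
  rank_lt (fun x => F x - G x) (m + n).
Proof.
move=> [s [sm sF]] [t [tn tG]]; exists (s ++ t); split.
  by rewrite size_cat (leq_trans _ (leq_add (ltnW sm) tn))// addnS.
move=> x; apply: in_spanB.
- by apply: in_span_subset (sF x) => y ys; rewrite mem_cat ys.
- by apply: in_span_subset (tG x) => y ys; rewrite mem_cat ys orbT.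
Qed.

(** A crude bound for arbitrary lists: it is used to construct the singular vectors, before their
    orthogonality is known. *)
Lemma gs_proj_bounded (s : seq H) : bounded_op (gs_proj hdot s).
Proof.
exists (\sum_(a <- s) hnorm a ^+ 2) => x; rewrite mulr_suml.
apply: le_trans (hnorm_sum _ _) _; apply: ler_sum => a _.
rewrite hnormZ expr2 mulrAC [hnorm a * _]mulrC ler_wpM2r ?hnorm_ge0//.
exact: hdot_CS.
Qed.

Lemma gs_proj_rank (T : {linear H -> K}) (s : seq H) :
  rank_lt (T \o gs_proj hdot s) (size s).+1.
Proof.
exists (map T s); rewrite size_map; split => // x.
exists (fun i => hdot x s`_i).
rewrite /= /gs_proj (big_nth 0) big_mkord linear_sum.
by apply: eq_bigr => i _; rewrite linearZ/= (nth_map 0).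
Qed.

End FiniteRankPerturbation.

Section FrameSplitting.
Variables (R : realType) (H : hilbertType R) (I : finType) (e : I -> H).

Lemma frame_split x : (forall y, frame_op e (frame_op e y) = frame_op e y) ->
  hnorm x ^+ 2 = hnorm (x - frame_op e x) ^+ 2 + \sum_i normc (hdot x (e i)) ^+ 2.
Proof.
move=> idem; have QQ : hnorm (frame_op e x) ^+ 2 = \sum_i normc (hdot x (e i)) ^+ 2.
  by apply: rC_inj; rewrite hnormKC -frame_op_adj idem; exact: hdot_sum.
rewrite -QQ -pythagoras ?subrK// hdotBl -(frame_op_adj e x x).
by rewrite -(frame_op_adj e (frame_op e x) x) idem subrr.
Qed.

(** The second condition says that each [e i] is a unit vector or zero. *)
Lemma frame_op_idem : (forall i j, i != j -> hdot (e i) (e j) = 0) ->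
  (forall i, hdot (e i) (e i) *: e i = e i) ->
  forall x, frame_op e (frame_op e x) = frame_op e x.
Proof.
move=> oe ee x; apply: eq_bigr => i _; rewrite frame_dot (bigD1 i)//= big1 ?addr0 => [|j ji].
  by rewrite -scalerA ee.
by rewrite oe ?mulr0.
Qed.

End FrameSplitting.

Section Deflation.
Variables (R : realType) (H K : hilbertType R) (T : {linear H -> K}).
Hypothesis bT : bounded_op T.
(** The essential norm of [T] is at most 1. *)
Hypothesis ess_le1 : forall t : R, 1 < t -> exists n (F : {linear H -> K}),
  [/\ bounded_op F, rank_lt F n & opnorm (T \- F) < t].

Definition deflate (s : seq H) : {linear H -> K} := T \- (T \o gs_proj hdot s).

Lemma deflate_bounded s : bounded_op (deflate s).
Proof. exact: bounded_opB bT (bounded_op_comp (gs_proj_bounded s) bT). Qed.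

(** Deflation changes [T] by a finite rank operator. Correcting [F] by the same operator leaves the
    error [T \- F], so [norm_attained] applies. *)
Lemma deflate_attained s : 1 < opnorm (deflate s) ->
  exists2 x, hnorm x = 1 & hnorm (deflate s x) = opnorm (deflate s).
Proof.
move=> /ess_le1[n [F [bF rF Fs]]].
have bg := bounded_op_comp (gs_proj_bounded s) bT.
have bTF := bounded_opB bT bF.
apply: (norm_attained (deflate_bounded s) (bounded_opB bF bg)
  (rank_ltB rF (gs_proj_rank T s)) (opnorm_ge0 bTF) Fs) => x.
rewrite (_ : _ - _ = (T \- F) x); first exact: opnormP bTF.
by rewrite /= opprB addrA subrK.
Qed.

(** The default 0 makes the sequence infinite even when only finitely many singular values exceed
    1. *)
Lemma next_sing_vec_exists s : exists x,
  (1 < opnorm (deflate s) -> hnorm x = 1 /\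
     hnorm (deflate s x) = opnorm (deflate s)) /\
  (opnorm (deflate s) <= 1 -> x = 0).
Proof.
have [h|h] := leP (opnorm (deflate s)) 1; first by exists 0.
by have [x x1 xs] := deflate_attained h; exists x.
Qed.

Definition next_sing_vec s : H := projT1 (cid (next_sing_vec_exists s)).

Definition sing_vecs n : seq H := iter n (fun s => rcons s (next_sing_vec s)) [::].

Definition sing_vec n : H := next_sing_vec (sing_vecs n).

Definition residue n := deflate (sing_vecs n).

(** Plays the role of the singular value of index [n.+1] as long as it exceeds 1. *)
Definition tau n : R := opnorm (residue n).

Lemma sing_vec_gt1 n : 1 < tau n ->
  hnorm (sing_vec n) = 1 /\ hnorm (residue n (sing_vec n)) = tau n.
Proof. by rewrite /sing_vec /next_sing_vec; case: cid => x [] /=. Qed.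

Lemma sing_vec_le1 n : tau n <= 1 -> sing_vec n = 0.
Proof. by rewrite /sing_vec /next_sing_vec; case: cid => x [] /=. Qed.

Lemma sing_vec_norm n : hnorm (sing_vec n) <= 1.
Proof.
have [/sing_vec_le1->|/sing_vec_gt1[-> _]//] := leP (tau n) 1.
by rewrite hnorm0.
Qed.

Lemma gs_projE n x : gs_proj hdot (sing_vecs n) x =
  \sum_(k < n) hdot x (sing_vec k) *: sing_vec k.
Proof.
elim: n => [|n IH]; first by rewrite /gs_proj big_nil big_ord0.
by rewrite big_ord_recr /= -IH /gs_proj -cats1 big_cat big_seq1.
Qed.

Lemma residueE n x : residue n x =
  T x - \sum_(k < n) hdot x (sing_vec k) *: T (sing_vec k).
Proof.
rewrite /residue /deflate /= gs_projE linear_sum; congr (_ - _).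
by apply: eq_bigr => k _; rewrite linearZ.
Qed.

Lemma residue_id n x : (forall k, (k < n)%N -> hdot x (sing_vec k) = 0) ->
  residue n x = T x.
Proof.
move=> h; rewrite residueE big1 ?subr0// => k _.
by rewrite h ?ltn_ord// scale0r.
Qed.

Lemma residue_max n y :
  hdot (residue n (sing_vec n)) (residue n y) =
  rC R (tau n ^+ 2) * hdot (sing_vec n) y.
Proof.
apply: max_vector; first exact: deflate_bounded.
have [/sing_vec_le1->|/sing_vec_gt1[-> ->]] := leP (tau n) 1; last by rewrite mulr1.
by rewrite linear0 !hnorm0 mulr0.
Qed.

Lemma sing_vec_self n : hdot (sing_vec n) (sing_vec n) *: sing_vec n = sing_vec n.
Proof.
have [/sing_vec_le1->|/sing_vec_gt1[h _]] := leP (tau n) 1; first by rewrite scaler0.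
by rewrite -hnormKC h expr1n rmorph1 scale1r.
Qed.

(** By orthogonality of the earlier vectors, [residue n] kills [sing_vec k], so [residue_max] makes
    [tau n ^+ 2] times the inner product vanish. *)
Lemma sing_vec_orth_lt n k : (k < n)%N -> hdot (sing_vec n) (sing_vec k) = 0.
Proof.
have [m] := ubnP n; elim: m n k => // m IH n k nm kn.
have [/sing_vec_le1->|tn] := leP (tau n) 1; first exact: hdot0l.
have Rk : residue n (sing_vec k) = 0.
  rewrite /residue /deflate /= gs_projE (bigD1 (Ordinal kn))//= big1.
    by rewrite addr0 sing_vec_self subrr.
  move=> j jk; have [jk'|kj|jk'] := ltngtP j k.
  - by rewrite (IH k j (leq_trans kn nm) jk') scale0r.
  - by rewrite (hdotC0 (IH j k (leq_trans (ltn_ord j) nm) kj)) scale0r.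
  - by move/eqP: jk; case; apply/val_inj.
have := residue_max n (sing_vec k); rewrite Rk hdot0r => /esym/eqP.
rewrite mulf_eq0 fmorph_eq0 expf_eq0/= gt_eqF/= ?(lt_trans ltr01)//.
by move/eqP.
Qed.

Lemma sing_vec_orth i j : i != j -> hdot (sing_vec i) (sing_vec j) = 0.
Proof.
rewrite neq_ltn => /orP[|] ij; last exact: sing_vec_orth_lt.
by apply/hdotC0/sing_vec_orth_lt.
Qed.

Lemma residue_diag n : residue n (sing_vec n) = T (sing_vec n).
Proof. by apply: residue_id => k kn; exact: sing_vec_orth_lt. Qed.

Lemma image_max n y : (forall k, (k < n)%N -> hdot y (sing_vec k) = 0) ->
  hdot (T (sing_vec n)) (T y) = rC R (tau n ^+ 2) * hdot (sing_vec n) y.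
Proof. by move=> h; rewrite -residue_diag -(residue_id h) residue_max. Qed.

Lemma image_orth i j : i != j -> hdot (T (sing_vec i)) (T (sing_vec j)) = 0.
Proof.
have lt m n : (m < n)%N -> hdot (T (sing_vec m)) (T (sing_vec n)) = 0.
  move=> mn; rewrite image_max ?sing_vec_orth ?mulr0 ?ltn_eqF// => k km.
  by apply: sing_vec_orth_lt; exact: ltn_trans mn.
rewrite neq_ltn => /orP[|] ij; first exact: lt.
by apply/hdotC0/lt.
Qed.

Lemma image_norm n : 1 < tau n -> hnorm (T (sing_vec n)) = tau n.
Proof. by move=> /sing_vec_gt1[_]; rewrite residue_diag. Qed.

Lemma tau_ge0 n : 0 <= tau n.
Proof. exact: opnorm_ge0 (deflate_bounded _). Qed.

(** [residue n.+1] is [residue n] after removal of the component along [sing_vec n], which does not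
    increase norms. *)
Lemma tauS n : tau n.+1 <= tau n.
Proof.
apply: opnorm_le; [by rewrite linear0|exact: tau_ge0|move=> x].
set c := hdot x (sing_vec n).
have -> : residue n.+1 x = residue n (x - c *: sing_vec n).
  rewrite (linearB (residue n)) (linearZZ (residue n)) residue_diag.
  by rewrite !residueE big_ord_recr opprD addrA.
apply: le_trans (opnormP _ (deflate_bounded _)) _.
rewrite ler_wpM2l ?tau_ge0//.
pose e (_ : 'I_1) := sing_vec n.
have ce : c *: sing_vec n = frame_op e x by rewrite /frame_op big_ord1.
rewrite -ler_sqr2 ?hnorm_ge0// ce [leRHS](frame_split (e := e)) ?lerDl ?sumr_ge0//.
  by move=> i _; exact: sqr_ge0.
by apply: frame_op_idem => [i j|i]; [rewrite !ord1|exact: sing_vec_self].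
Qed.

Lemma tau_le m n : (m <= n)%N -> tau n <= tau m.
Proof.
move=> /subnKC <-; elim: (n - m)%N => [|j IH]; first by rewrite addn0.
by rewrite addnS (le_trans (tauS _)).
Qed.

(** The first [n.+1] singular vectors are all nonzero here, by monotonicity, and their images are
    orthogonal of norm at least [tau n]. *)
Lemma tau_le_sing_val n : 1 < tau n -> tau n <= sing_val T n.+1.
Proof.
move=> tn; apply: (le_sing_val_orth bT (e := fun i : 'I_n.+1 => sing_vec i)) => //.
- exact: tau_ge0.
- apply: bessel_orth => [i j ij|i]; last exact: sing_vec_norm.
  by apply: sing_vec_orth; rewrite (inj_eq val_inj).
- by move=> i j ij; apply: image_orth; rewrite (inj_eq val_inj).
move=> i; have ti : tau n <= tau i by apply: tau_le; rewrite -ltnS.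
by rewrite image_norm// (lt_le_trans tn).
Qed.

End Deflation.

Section RankOne.
Variables (R : realType) (H K : hilbertType R) (a : R[i]) (u : H) (v : K).

Definition rank1 (x : H) : K := (a * hdot x u) *: v.

Lemma rank1_linear : linear rank1.
Proof.
move=> c x y; rewrite /rank1 hdotDl hdotZl mulrDr scalerDl mulrCA.
by rewrite -(scalerA c).
Qed.

HB.instance Definition _ := GRing.isLinear.Build _ _ _ _ rank1 rank1_linear.

Lemma rank1_norm x : hnorm (rank1 x) <= normc a * hnorm u * hnorm v * hnorm x.
Proof.
rewrite hnormZ normcM -!mulrA ler_wpM2l ?normc_ge0//.
rewrite [hnorm v * _]mulrC mulrA ler_wpM2r ?hnorm_ge0// mulrC.
exact: hdot_CS.
Qed.

End RankOne.

(** The induction needs the stronger bound by the product minus 1. *)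
Lemma sum_sub1_le_prod (R : realType) (a : nat -> R) n :
  (forall k, 1 <= a k) -> \sum_(k < n) (a k - 1) <= \prod_(k < n) a k.
Proof.
move=> a1; suff h : \sum_(k < n) (a k - 1) <= \prod_(k < n) a k - 1.
  by apply: le_trans h _; rewrite gerBl.
elim: n => [|n IH]; first by rewrite !big_ord0 subrr.
rewrite !big_ord_recr/=; have p1 : 1 <= \prod_(k < n) a k.
  elim/big_ind : _ => // x y x1 y1; rewrite -[1]mulr1.
  by rewrite ler_pM.
have := mulr_ge0 (_ : 0 <= \prod_(k < n) a k - 1) (_ : 0 <= a n - 1).
by rewrite !subr_ge0 => /(_ p1 (a1 n)); move: IH; lra.
Qed.

(** Otherwise more than [L / d] terms of size at least [d] would sum to more than [L]. *)
Lemma sums_le_small_term (R : realType) (a : nat -> R) (L d : R) : 0 < d ->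
  (forall n, \sum_(k < n) a k <= L) -> exists n, a n < d.
Proof.
move=> d0 aL; apply: contrapT => h.
have L0 : 0 <= L by have := aL 0%N; rewrite big_ord0.
have := aL (Num.truncn (L / d)).+1; apply/negP; rewrite -ltNge.
apply: (@lt_le_trans _ _ (\sum_(k < (Num.truncn (L / d)).+1) d)).
  rewrite sumr_const card_ord -[_ *+ _]mulr_natl -ltr_pdivrMr//.
  by have /andP[] := truncn_itv (divr_ge0 L0 (ltW d0)).
by apply: ler_sum => k _; rewrite leNgt; apply/negP => ak; apply: h; exists k.
Qed.

Lemma dot_cvg_hdot2 (R : realType) (H : hilbertType R) (u v : nat -> H) (l m : H) :
  dot_cvg hdot u l -> dot_cvg hdot v m ->
  cvgC (fun n => hdot (u n) (v n)) (hdot l m).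
Proof.
move=> ul vm; apply: (cvgC_near (dot_cvg_hdot m ul)) => e e0.
have c0 : 0 < hnorm l + 1 by rewrite ltr_wpDl ?hnorm_ge0.
have [N hN] := ul _ ltr01; have [M hM] := vm _ (divr_gt0 e0 c0).
exists (maxn N M) => n; rewrite geq_max => /andP[/hN h1 /hM h2].
rewrite -hdotBr; apply: le_lt_trans (hdot_CS _ _) _.
move: h2; rewrite ltr_pdivlMr// mulrC; apply: le_lt_trans.
rewrite ler_wpM2r ?hnorm_ge0//; have := hnormD_le (u n - l) l; rewrite subrK.
by move=> /le_trans; apply; rewrite addrC lerD2l ltW.
Qed.

Lemma orth_sum_dot (R : realType) (H : hilbertType R) (I : finType) (e : I -> H)
    (a b : I -> R[i]) : (forall i j, i != j -> hdot (e i) (e j) = 0) ->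
  hdot (\sum_i a i *: e i) (\sum_i b i *: e i) =
  \sum_i a i * (b i)^* * rC R (hnorm (e i) ^+ 2).
Proof.
move=> oe; rewrite hdot_suml; apply: eq_bigr => i _.
rewrite hdotZl hdot_sumr (bigD1 i)//= big1 => [|j ji].
  by rewrite addr0 hdotZr mulrA -hnormKC.
by rewrite hdotZr oe ?mulr0// eq_sym.
Qed.

Section Decomposition.
Variables (R : realType) (H K : hilbertType R) (T : {linear H -> K}) (L : R).
Hypothesis bT : bounded_op T.
Hypothesis TL : forall N, \prod_(1 <= n < N.+1) Num.max 1 (sing_val T n) <= L.

Lemma sum_sing_val_excess n : \sum_(k < n) (Num.max 1 (sing_val T k.+1) - 1) <= L.
Proof.
have := TL n; rewrite big_add1 big_mkord /=; apply: le_trans.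
pose a k := Num.max 1 (sing_val T k.+1).
have a1 k : 1 <= a k by rewrite /a le_max lexx.
exact: (sum_sub1_le_prod n a1).
Qed.

Lemma ess_norm_le1 t : 1 < t -> exists n (F : {linear H -> K}),
  [/\ bounded_op F, rank_lt F n & opnorm (T \- F) < t].
Proof.
move=> t1; have t0 : 0 < t - 1 by rewrite subr_gt0.
have [n /=] := sums_le_small_term (a := fun k => Num.max 1 (sing_val T k.+1) - 1) t0
  sum_sing_val_excess.
rewrite ltrD2r gt_max => /andP[_ /(sing_val_lt (ltn0Sn n))[F [bF rF TF]]].
by exists n.+1, F.
Qed.

Local Notation e := (sing_vec bT ess_norm_le1).
Local Notation t := (tau bT ess_norm_le1).

(** The eigenvalue of the absolute value of [X] at [e k]. *)
Definition excess k : R := Num.max 0 (t k - 1).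

(** Equal to [1 - 1 / t k] when [t k > 1]: subtracting this fraction of [T (e k)] leaves a unit
    vector. *)
Definition excess_ratio k : R := excess k / t k.

Lemma excess_ge0 k : 0 <= excess k.
Proof. by rewrite le_max lexx. Qed.

Lemma excess_sum n : \sum_(k < n) excess k <= L.
Proof.
apply: le_trans (sum_sing_val_excess n); apply: ler_sum => k _.
rewrite /excess ge_max subr_ge0 le_max lexx/=.
have [t1|t1] := leP (t k) 1; first by rewrite lerD2r le_max t1.
by rewrite lerD2r le_max tau_le_sing_val ?orbT.
Qed.

Lemma tau_cvg (d : R) : 0 < d -> exists N, forall n, (N <= n)%N -> t n <= 1 + d.
Proof.
move=> d0; have [N] := sums_le_small_term (a := excess) d0 excess_sum.
rewrite /excess gt_max ltrBlDr addrC => /andP[_ tN].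
by exists N => n Nn; apply: le_trans (tau_le _ _ Nn) (ltW tN).
Qed.

(* Both sides vanish when [t k <= 1], since then [e k = 0]. *)
Lemma excess_ratio_norm k :
  excess_ratio k * hnorm (T (e k)) = excess k * hnorm (e k).
Proof.
have [t1|t1] := leP (t k) 1.
  by rewrite sing_vec_le1// linear0 !hnorm0 !mulr0.
have t0 : t k != 0 by rewrite gt_eqF// (lt_trans ltr01).
by rewrite image_norm// /excess_ratio divfK// (sing_vec_gt1 t1).1 mulr1.
Qed.

Definition sing_term k : {linear H -> K} := rank1 (rC R (excess_ratio k)) (e k) (T (e k)).

Definition abs_term k : {linear H -> H} := rank1 (rC R (excess k)) (e k) (e k).

Lemma excess_ratio_ge0 k : 0 <= excess_ratio k.
Proof. by rewrite divr_ge0 ?excess_ge0 ?tau_ge0. Qed.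

Lemma sing_term_le k x : hnorm (sing_term k x) <= excess k * hnorm x.
Proof.
apply: le_trans (rank1_norm _ _ _ _) _; rewrite ler_wpM2r ?hnorm_ge0//.
rewrite normc_rC ger0_norm ?excess_ratio_ge0// mulrAC excess_ratio_norm -mulrA.
rewrite ler_piMr ?excess_ge0// mulr_ile1 ?hnorm_ge0//; exact: sing_vec_norm.
Qed.

Lemma abs_term_le k x : hnorm (abs_term k x) <= excess k * hnorm x.
Proof.
apply: le_trans (rank1_norm _ _ _ _) _; rewrite ler_wpM2r ?hnorm_ge0//.
rewrite normc_rC ger0_norm ?excess_ge0// -mulrA.
rewrite ler_piMr ?excess_ge0// mulr_ile1 ?hnorm_ge0//; exact: sing_vec_norm.
Qed.

Lemma sub_sing_terms n x : T x - \sum_(k < n) sing_term k x =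
  residue bT ess_norm_le1 n x +
  \sum_(k < n) (rC R (1 - excess_ratio k) * hdot x (e k)) *: T (e k).
Proof.
rewrite residueE; set Y := \sum_(k < n) _ *: _; set Z := \sum_(k < n) _ *: _.
have -> : Z = Y - \sum_(k < n) sing_term k x; last by rewrite addrA subrK.
rewrite -sumrB; apply: eq_bigr => k _; rewrite /sing_term /= /rank1 -scalerBl.
by congr (_ *: _); rewrite rmorphB rmorph1; ring.
Qed.

(** The two summands of [sub_sing_terms] are orthogonal. The first is [T y] with [y] orthogonal to
    the first [n] singular vectors, hence at most [t n * hnorm y]; the second has norm at most that
    of the projection of [x] onto these vectors. *)
Lemma sub_sing_terms_le n x :
  hnorm (T x - \sum_(k < n) sing_term k x) <= Num.max 1 (t n) * hnorm x.
Proof.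
pose en (k : 'I_n) := e k.
have oe (i j : 'I_n) : i != j -> hdot (en i) (en j) = 0.
  by move=> ij; apply: sing_vec_orth; rewrite (inj_eq val_inj).
have idem := frame_op_idem oe (fun i => sing_vec_self bT ess_norm_le1 i).
set y := x - frame_op en x.
have yo k : (k < n)%N -> hdot y (e k) = 0.
  move=> kn; rewrite /y -[e k]/(en (Ordinal kn)) hdotBl hdot_suml.
  rewrite (bigD1 (Ordinal kn))//= big1 ?addr0 => [|j jk].
    have ek : hdot (e k) (e k) *: en (Ordinal kn) = en (Ordinal kn).
      exact: sing_vec_self.
    by rewrite hdotZl -{1}ek hdotZr -hdotC mulrC subrr.
  by rewrite hdotZl oe ?mulr0.
have ry : residue bT ess_norm_le1 n x = T y.
  rewrite residueE /y /frame_op (linearB T) (linear_sum T); congr (_ - _).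
  by apply: eq_bigr => k _; rewrite linearZ.
have ryn : hnorm (T y) <= t n * hnorm y.
  rewrite -(residue_id yo).
  exact: opnormP (deflate_bounded bT _).
have M0 : 0 <= Num.max 1 (t n) by rewrite le_max ler01.
rewrite -ler_sqr2 ?mulr_ge0 ?hnorm_ge0// sub_sing_terms ry pythagoras; last first.
  rewrite hdot_sumr big1// => k _; rewrite hdotZr.
  rewrite (hdotC0 (_ : hdot (T (e k)) (T y) = 0)) ?mulr0//.
  rewrite image_max => [|j jk]; last by apply: yo; exact: ltn_trans (ltn_ord k).
  by rewrite (hdotC0 (yo k (ltn_ord k))) mulr0.
rewrite orth_sum => [|i j ij]; last by apply: image_orth; rewrite (inj_eq val_inj).
rewrite exprMn (frame_split x idem) mulrDr; apply: lerD.
  rewrite -exprMn ler_sqr2 ?mulr_ge0 ?hnorm_ge0//.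
  by apply: le_trans ryn _; rewrite ler_wpM2r ?hnorm_ge0// le_max lexx orbT.
rewrite mulr_sumr; apply: ler_sum => k _.
apply: (@le_trans _ _ (normc (hdot x (en k)) ^+ 2)); last first.
  by rewrite ler_peMl ?sqr_ge0// exprn_ege1// le_max lexx.
rewrite normcM normc_rC exprMn real_normK ?num_real// mulrAC.
have [t1|t1] := leP (t k) 1.
  by rewrite [e k]sing_vec_le1// linear0 hnorm0 expr0n/= mulr0 mul0r sqr_ge0.
rewrite image_norm// -exprMn /excess_ratio.
have t0 : 0 < t k by rewrite (lt_trans ltr01).
have -> : excess k = t k - 1 by apply/max_idPr; rewrite subr_ge0 ltW.
by rewrite (_ : (1 - _) * _ = 1) ?expr1n ?mul1r//; field; rewrite gt_eqF.
Qed.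

Lemma decomposition_exists : exists A X : {linear H -> K},
  [/\ forall x, T x = A x + X x, bounded_op A, bounded_op X,
      opnorm A <= 1 & trace_class X].
Proof.
have [X [XL Xcvg]] := op_series excess_ge0 excess_sum sing_term_le.
have [P [PL Pcvg]] := op_series excess_ge0 excess_sum abs_term_le.
have bX : bounded_op X by exists L.
have bP : bounded_op P by exists L.
have bA := bounded_opB bT bX.
exists (T \- X), X; split => //.
- by move=> x; rewrite /= subrK.
- apply: opnorm_le; [by rewrite linear0|exact: ler01|move=> x].
  rewrite mul1r; apply: (@dot_cvg_norm_le _ _ (fun n => T x - \sum_(k < n) sing_term k x)).
    move=> d /(Xcvg x)[N hN]; exists N => n /hN h.
    by rewrite opprB addrC addrA subrK dotnormBC.
  (* Taking [t n <= 1 + d / (hnorm x + 1)] costs at most [d] at [x]. *)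
  move=> d d0; have c0 : 0 < hnorm x + 1 by rewrite ltr_wpDl ?hnorm_ge0.
  have [N hN] := tau_cvg (divr_gt0 d0 c0); exists N => n /hN tn.
  apply: le_trans (sub_sing_terms_le n x) _.
  apply: (@le_trans _ _ ((1 + d / (hnorm x + 1)) * hnorm x)).
    by rewrite ler_wpM2r ?hnorm_ge0// ge_max tn lerDl ltW// divr_gt0.
  by rewrite mulrDl mul1r lerD2l mulrAC ler_pdivrMr// ler_pM2l// lerDl.
split => //.
have PE n x y : hdot (\sum_(k < n) abs_term k x) y =
    \sum_(k < n) rC R (excess k) * (hdot x (e k) * hdot (e k) y).
  by rewrite hdot_suml; apply: eq_bigr => k _; rewrite /= /rank1 hdotZl mulrA.
have PEn n x : hdot (\sum_(k < n) abs_term k x) x =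
    rC R (\sum_(k < n) excess k * normc (hdot x (e k)) ^+ 2).
  rewrite PE rmorph_sum; apply: eq_bigr => k _.
  by rewrite rmorphM normcKC -hdotC.
have P0 x : 0 <= hdot (P x) x.
  apply: cvgC_ge0 (dot_cvg_hdot x (Pcvg x)) _ => n.
  rewrite PEn ge0CE Re_rC eqxx andbT; apply: sumr_ge0 => k _.
  by rewrite mulr_ge0 ?excess_ge0 ?sqr_ge0.
have [B oB] := orthonormal_basis_exists H.
exists P, B; split => //.
  (* The identity is checked on partial sums: both sides expand over orthogonal vectors, and
     [excess_ratio_norm] matches the coefficients. *)
  split => // x y; rewrite (pos_herm P0 y (P x)) -hdotC.
  apply: cvgC_uniq (dot_cvg_hdot2 (Pcvg x) (Pcvg y)) _.
  have := dot_cvg_hdot2 (Xcvg x) (Xcvg y); congr cvgC; apply/funext => n.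
  rewrite /= /rank1 !orth_sum_dot; last 2 first.
  - by move=> i j ij; apply: sing_vec_orth; rewrite (inj_eq val_inj).
  - by move=> i j ij; apply: image_orth; rewrite (inj_eq val_inj).
  apply: eq_bigr => k _.
  have key : rC R (excess_ratio k) * rC R (excess_ratio k) *
      rC R (hnorm (T (e k)) ^+ 2) =
      rC R (excess k) * rC R (excess k) * rC R (hnorm (e k) ^+ 2).
    by rewrite -!rmorphM -!expr2 -!exprMn excess_ratio_norm.
  rewrite !(rmorphM _ (rC R _)) /= !conj_rC.
  transitivity (rC R (excess_ratio k) * rC R (excess_ratio k) *
      rC R (hnorm (T (e k)) ^+ 2) * (hdot x (e k) * (hdot y (e k))^*)).
    by ring.
  by rewrite key; ring.
(* Over a finite part of the basis, the sums are exchanged and Bessel's inequality is applied to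
   each [e k]; there remains the sum of the [excess k], at most [L]. *)
apply: (@le_lt_trans _ _ L%:E); last exact: ltry.
apply: ge_ereal_sup => _ [F [finF FB] <-].
rewrite fsbig_finite// sumEFin lee_fin.
set s : seq H := finmap.enum_fset _.
have sB b : b \in s -> B b by move=> bs; apply/FB/set_mem; rewrite -(in_fset_set finF).
have us : uniq s by exact: finmap.fset_uniq.
have bs : bessel (fun i : 'I_(size s) => s`_i).
  have os (i j : 'I_(size s)) : hdot s`_i s`_j = (i == j)%:R.
    rewrite (oB.1 _ _ (sB _ (mem_nth 0 (ltn_ord i))) (sB _ (mem_nth 0 (ltn_ord j)))).
    by rewrite nth_uniq.
  apply: bessel_orth => [i j ij|i]; first by rewrite os (negPf ij).
  by rewrite -(expr_le1 (n := 2)) ?hnorm_ge0// hnormK os eqxx.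
rewrite -raddf_sum; apply: cvgC_Re_le.
  by apply: cvgC_sum => b; exact: (dot_cvg_hdot b (Pcvg b)).
exists 0%N => n _; rewrite raddf_sum/=.
under eq_bigr do rewrite PEn Re_rC.
rewrite exchange_big/=; apply: le_trans (excess_sum n); apply: ler_sum => k _.
rewrite -mulr_sumr ler_piMr ?excess_ge0//.
apply: (@le_trans _ _ (hnorm (e k) ^+ 2)); last first.
  by rewrite expr_le1 ?hnorm_ge0// sing_vec_norm.
apply: le_trans (bessel_le bs (e k)); rewrite (big_nth 0) big_mkord.
by apply: ler_sum => i _; rewrite hdotC normc_conj.
Qed.

End Decomposition.

(** * The infinite product, the norm of the graph and the equivalence *)

Section SingularValueProduct.
Variables (R : realType) (H K : hilbertType R) (T : {linear H -> K}).
Local Open Scope ereal_scope.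

(** The factors are at least 1, so the partial products increase and their limit is a supremum. *)
Lemma sing_val_prodE : sing_val_prod T =
  ereal_sup (range (fun N => (\prod_(1 <= n < N.+1) Num.max 1 (sing_val T n))%R%:E)).
Proof.
apply/cvg_lim => //; apply: ereal_nondecreasing_cvgn.
apply: homo_leq => [//||N]; first by move=> ? ? ?; exact: le_trans.
rewrite lee_fin [leRHS]big_nat_recr//= ler_peMr ?le_max ?lexx//.
by apply: prodr_ge0 => k _; rewrite le_max ler01.
Qed.

Lemma sing_val_prod_le (M : R) :
  (forall N, \prod_(1 <= n < N.+1) Num.max 1 (sing_val T n) <= M)%R ->
  sing_val_prod T <= M%:E.
Proof.
move=> TM; rewrite sing_val_prodE; apply: ge_ereal_sup => _ [N _ <-].
by rewrite lee_fin.
Qed.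

Lemma le_sing_val_prod N :
  (\prod_(1 <= n < N.+1) Num.max 1 (sing_val T n))%R%:E <= sing_val_prod T.
Proof. by rewrite sing_val_prodE; apply: ereal_sup_ubound; exists N. Qed.

Lemma sing_val_prod_fin : sing_val_prod T < +oo ->
  exists2 L : R, sing_val_prod T = L%:E &
    forall N, (\prod_(1 <= n < N.+1) Num.max 1 (sing_val T n) <= L)%R.
Proof.
move=> Tfin; exists (fine (sing_val_prod T)).
  rewrite fineK// ge0_fin_numE//; apply: le_trans (le_sing_val_prod 0).
  by rewrite big_geq// lee_fin ler01.
move=> N; rewrite -lee_fin fineK ?le_sing_val_prod// ge0_fin_numE//.
by apply: le_trans (le_sing_val_prod 0); rewrite big_geq// lee_fin ler01.
Qed.

End SingularValueProduct.

Section GraphNorm.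
Variables (R : realType) (H K : hilbertType R) (T : {linear H -> K}).

Lemma graph_norm_le (M : R) : 0 <= M ->
  (forall x y, Lambda_graph T x y -> hnorm y <= M * hnorm x) ->
  graph_norm (Lambda_graph T) <= M.
Proof.
move=> M0 TM; apply: ge_sup.
  by exists (hnorm (wedge (map T [::]))), (wedge (map T [::])) => //=;
    exists (wedge [::]); split; [exact: Lambda_graph_wedge|rewrite wedge_nil_norm].
move=> _ [y [x [xy x1]] <-]; apply: le_trans (TM _ _ xy) _.
by rewrite ler_piMr.
Qed.

Lemma graph_normP : graph_bounded (Lambda_graph T) ->
  forall x y, Lambda_graph T x y -> hnorm y <= graph_norm (Lambda_graph T) * hnorm x.
Proof.
move=> [M TM] x y xy; have [x0|x0] := eqVneq (hnorm x) 0.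
  have := TM _ _ xy; rewrite x0 !mulr0.
  exact.
have xp : 0 < hnorm x by rewrite lt_def x0 hnorm_ge0.
rewrite -ler_pdivrMr//; apply: ub_le_sup.
  exists (Num.max 0 M) => _ [y' [x' [xy' x1]] <-]; apply: le_trans (TM _ _ xy') _.
  apply: (@le_trans _ _ (Num.max 0 M * hnorm x')).
    by rewrite ler_wpM2r ?hnorm_ge0// le_max lexx orbT.
  by rewrite ler_piMr// le_max lexx.
exists (rC R (hnorm x)^-1 *: y).
  exists (rC R (hnorm x)^-1 *: x); split.
    (* The graph is scaled by taking the pair [(0, 0)], obtained as the opposite of [(x, y)] plus
       [(x, y)], for the second summand. *)
    have := Lambda_graph_linear (rC R (hnorm x)^-1) xy (Lambda_graph_linear (-1) xy xy).
    by rewrite !scaleN1r !addNr !addr0.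
  by rewrite hnormZ normc_rC ger0_norm ?invr_ge0 ?hnorm_ge0// mulVf.
by rewrite hnormZ normc_rC ger0_norm ?invr_ge0 ?hnorm_ge0// mulrC.
Qed.

End GraphNorm.

Theorem theorem3p1 (R : realType) (H K : hilbertType R)
    (T : {linear H -> K}) (T_bounded : bounded_op T) :
  [/\ graph_bounded (Lambda_graph T) <->
        (exists A X : {linear H -> K},
          [/\ forall x, T x = A x + X x,
              bounded_op A, bounded_op X,
              opnorm A <= 1 & trace_class X]),
      graph_bounded (Lambda_graph T) <-> (sing_val_prod T < +oo)%E &
      graph_bounded (Lambda_graph T) ->
        (graph_norm (Lambda_graph T))%:E = sing_val_prod T].
Proof.
(* A uniform bound on the partial products is the pivot to which all three conditions are
   compared. *)
have ub_fin L : (forall N, \prod_(1 <= n < N.+1) Num.max 1 (sing_val T n) <= L) ->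
    graph_bounded (Lambda_graph T).
  by move=> TL; exists L; exact: Lambda_bounded.
have fin_ub : graph_bounded (Lambda_graph T) ->
    forall N, \prod_(1 <= n < N.+1) Num.max 1 (sing_val T n) <=
      graph_norm (Lambda_graph T).
  by move=> /graph_normP TM N; exact: prod_max_sing_val_le.
split.
- split=> [/fin_ub|[A [X [TAX bA bX A1 trX]]]].
    exact: decomposition_exists.
  by have [L /ub_fin] := prod_max_sing_val_bounded TAX bA bX A1 trX.
- split=> [/fin_ub/sing_val_prod_le Tfin|/sing_val_prod_fin[L _ /ub_fin//]].
  by apply: le_lt_trans Tfin _; rewrite ltry.
move=> /[dup] bL /fin_ub TN; apply/eqP; rewrite eq_le sing_val_prod_le// andbT.
have [|L -> TL] := @sing_val_prod_fin _ _ _ T.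
  by apply: le_lt_trans (sing_val_prod_le TN) _; rewrite ltry.
rewrite lee_fin graph_norm_le//; last exact: Lambda_bounded.
by apply: le_trans (TL 0%N); rewrite big_geq.
Qed.
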